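(* The pointwise limit on $\mathbb{R}_{>0}^3$, as $n\to\infty$, of the functions $\mathbf f_n$ is a function $\mathbf f:\mathbb{R}_{>0}^3\to\mathbb{R}$ that is $2\sqrt2\,e$-Lipschitz (with respect to the Euclidean norm) and concave.
   Context: For an integer $n\ge1$ let $V(\mathbb{T}_n)=(\mathbb{Z}/n\mathbb{Z})^2$ be the vertex set of the discrete torus obtained from the triangular lattice $\mathbb{Z}+\mathbb{Z}\omega$, $\omega=e^{2\pi i/3}$, modulo $n$ (with $1\mapsto(1,0)$, $\omega\mapsto(0,1)$). For $f:V(\mathbb{T}_n)\to\mathbb{R}$ the discrete Hessian on the three families $E_0,E_1,E_2$ of unit rhombi is given by $D_0f(a,b)=f(a,b)+f(a+2,b+1)-f(a+1,b)-f(a+1,b+1)$, $D_1f(a,b)=f(a+1,b)+f(a,b+1)-f(a,b)-f(a+1,b+1)$, $D_2f(a,b)=f(a,b)+f(a+1,b+2)-f(a+1,b+1)-f(a,b+1)$. For $s=(s_0,s_1,s_2)\in\mathbb{R}_{>0}^3$, $P_n(s)$ is the bounded convex polytope of all $g:V(\mathbb{T}_n)\to\mathbb{R}$ with $\sum_v g(v)=0$ and $D_rg(v)\le s_r$ for all $v$ and $r\in\{0,1,2\}$; $|P_n(s)|$ is its $(n^2-1)$-dimensional Lebesgue measure in the hyperplane of mean-zero functions. For $n\ge2$, $\mathbf f_n(s)=|P_n(s)|^{1/(n^2-1)}$. *)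

(* Defs.v *)
From HB Require Import structures.
From mathcomp Require Import all_boot all_order all_algebra.
From mathcomp Require Import all_classical all_reals all_analysis.
From mathcomp Require Import zify.

Set Implicit Arguments.
Unset Strict Implicit.
Unset Printing Implicit Defensive.

Import Order.TTheory GRing.Theory Num.Theory.
Import numFieldNormedType.Exports.

Local Open Scope classical_set_scope.
Local Open Scope ring_scope.

(* The Lebesgue measure of R^k, as an iterated product measure on k-tuples;
   R^0 carries the unit point mass. *)
Fixpoint lebesgue_tuple (R : realType) (k : nat) :
    set (k.-tuple (measurableTypeR R)) -> \bar R :=
  match k return set (k.-tuple (measurableTypeR R)) -> \bar R with
  | 0 => dirac [tuple]
  | k'.+1 => pushforward (@lebesgue_measure R \x @lebesgue_tuple R k')%E
      (fun p : measurableTypeR R * k'.-tuple (measurableTypeR R) =>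
         [tuple of p.1 :: p.2])
  end.

Section SubspaceMeasure.
Context {R : realType} {T : finType}.

Definition gram k (B : 'I_k -> T -> R) : 'M[R]_k :=
  \matrix_(i, j) \sum_v B i v * B j v.

Definition lincomb k (B : 'I_k -> T -> R) (x : k.-tuple R) : T -> R :=
  fun v => \sum_i tnth x i * B i v.

(* The k-dimensional Lebesgue measure on the span of the linearly independent
   family B, for the Euclidean structure induced by R^T: the coordinates with
   respect to B multiply volume by the square root of the Gram determinant, so
   the value depends on the span of B only. *)
Definition span_measure k (B : 'I_k -> T -> R) (A : set (T -> R)) : \bar R :=
  ((Num.sqrt (\det (gram B)))%:E * lebesgue_tuple (lincomb B @^-1` A))%E.

(* With T enumerated as v_0, v_1, ..., this is e_{v_{i+1}} - e_{v_0}. *)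
Definition mean0_basis (i : 'I_#|T|.-1) (v : T) : R :=
  (enum_rank v == i.+1 :> nat)%:R - (enum_rank v == 0 :> nat)%:R.

Let vtx_subproof (i : 'I_#|T|.-1) : (i.+1 < #|T|)%N.
Proof. by have := ltn_ord i; lia. Qed.

Let vtx (i : 'I_#|T|.-1) : T := enum_val (Ordinal (vtx_subproof i)).

Let lincomb_vtx (x : #|T|.-1.-tuple R) i :
  lincomb mean0_basis x (vtx i) = tnth x i.
Proof.
rewrite /lincomb (bigD1 i)//= /mean0_basis enum_valK/= eqxx subr0 mulr1.
rewrite big1 ?addr0// => j ji.
by rewrite eqSS val_eqE eq_sym (negPf ji) subr0 mulr0.
Qed.

Let sum_rank (k : 'I_#|T|) : \sum_(v : T) (enum_rank v == k :> nat)%:R = 1 :> R.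
Proof.
rewrite (bigD1 (enum_val k))//= enum_valK eqxx big1 ?addr0// => v vk.
case: eqP => // /val_inj vkE; move: vk.
by rewrite -vkE enum_rankK eqxx.
Qed.

Let sum_lincomb (x : #|T|.-1.-tuple R) : \sum_v lincomb mean0_basis x v = 0.
Proof.
rewrite exchange_big big1//= => i _.
rewrite -mulr_sumr /mean0_basis sumrB (sum_rank (Ordinal (vtx_subproof i))).
by rewrite (sum_rank (Ordinal (ltn_trans (ltn0Sn i) (vtx_subproof i)))) subrr mulr0.
Qed.

Lemma mean0_basisP (g : T -> R) :
  \sum_v g v = 0 <-> exists! x : #|T|.-1.-tuple R, lincomb mean0_basis x = g.
Proof.
split=> [g0|[x [<- _]]]; last exact: sum_lincomb.
pose x := [tuple g (vtx i) | i < #|T|.-1].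
have gE v : enum_rank v != 0%N :> nat -> lincomb mean0_basis x v = g v.
  move=> v0.
  have lt_v : ((enum_rank v).-1 < #|T|.-1)%N.
    by rewrite ltn_predRL prednK ?ltn_ord// lt0n.
  have -> : v = vtx (Ordinal lt_v).
    apply: enum_rank_inj; rewrite enum_valK; apply/val_inj => /=.
    by rewrite prednK// lt0n.
  by rewrite lincomb_vtx tnth_mktuple.
exists x; split; last first.
  move=> y yg; apply: eq_from_tnth => i.
  by rewrite -(lincomb_vtx y) yg tnth_mktuple.
apply/funext => v; have [v0|/gE//] := eqVneq (enum_rank v : nat) 0%N.
have := etrans (sum_lincomb x) (esym g0).
rewrite (bigD1 v)//= [RHS](bigD1 v)//=.
rewrite (eq_bigr g) => [/addIr//|w wv]; apply: gE.
apply: contra wv => /eqP w0; apply/eqP/enum_rank_inj/val_inj.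
by rewrite /= w0 v0.
Qed.

Definition mean0_measure (A : set (T -> R)) : \bar R :=
  span_measure mean0_basis A.

End SubspaceMeasure.

(* ordS is the cyclic successor on 'I_n, i.e. the addition of 1 modulo n. *)
Definition torus (n : nat) : finType := ('I_n * 'I_n)%type.

Definition hessian (R : realType) (n : nat) (r : 'I_3) (f : torus n -> R)
    (v : torus n) : R :=
  let: (a, b) := v in
  match nat_of_ord r with
  | 0 => f (a, b) + f (ordS (ordS a), ordS b)
         - f (ordS a, b) - f (ordS a, ordS b)
  | 1 => f (ordS a, b) + f (a, ordS b) - f (a, b) - f (ordS a, ordS b)
  | _ => f (a, b) + f (ordS a, ordS (ordS b))
         - f (ordS a, ordS b) - f (a, ordS b)
  end.

Definition hessian_polytope (R : realType) (n : nat) (s : 'rV[R]_3) :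
    set (torus n -> R) :=
  [set g | \sum_v g v = 0 /\ forall v r, hessian r g v <= s 0 r].

Arguments hessian_polytope {R} n s.

(* Only meaningful for n >= 2. *)
Definition volume_root (R : realType) (n : nat) (s : 'rV[R]_3) : R :=
  fine (mean0_measure (hessian_polytope n s)) `^ ((n ^ 2 - 1)%N%:R^-1).

Definition positive_octant (R : realType) : set 'rV[R]_3 :=
  [set s | forall r, 0 < s 0 r].

(* The library norm on 'rV[R]_3 is the sup norm. *)
Definition euclidean_norm (R : realType) (k : nat) (x : 'rV[R]_k) : R :=
  Num.sqrt (\sum_r x 0 r ^+ 2).

(* Main.v *)
Require Import Defs.
From HB Require Import structures.
From mathcomp Require Import all_boot all_order all_algebra.
From mathcomp Require Import all_classical all_reals all_analysis.
From mathcomp Require Import zify ring lra realalg.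
Import Order.TTheory GRing.Theory Num.Theory.
Import numFieldNormedType.Exports.

Set Implicit Arguments.
Unset Strict Implicit.
Unset Printing Implicit Defensive.

Local Open Scope ring_scope.

(** Everything is proved by counting integer points. A configuration is a
    function g on the torus with values in {0, ..., M - 1}; it is admissible for
    real thresholds u if its three Hessians are at most u_r. Cutting the
    coordinate space of the mean-zero hyperplane into cubes of side 1/L shows
    that, for fixed n and large L, the volume of P_n(s) times L^(n^2) and the
    number of configurations admissible for u = L s agree up to a factor
    polynomial in n (coord_volume_le_count, count_le_coord_volume). Such a
    factor disappears in the (n^2 - 1)-st root. On integer configurations,
    permutations of the vertices, triangular unimodular changes of variables
    and gluing are mere injections between finite sets, and rounding errors are
    absorbed by a slight increase of u. Four facts are needed.

    - Midpoints. If A, B and C are finite sets of integer vectors and C contains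
      every rounding of (x + y)/2 with x in A and y in B, then |A||B| <= |C|^2
      (card_midpoints). This is a discrete Prekopa-Leindler inequality, obtained
      by induction on the dimension from an elementary injection in dimension
      one. Hence vol(s) vol(t) <= poly(n) vol((s+t)/2)^2.

    - Upper bound. For each r separately, g is determined by its values on two
      lines and by D_r g at (n-1)^2 vertices; these are at most u_r and almost
      sum up to zero, so they range over a simplex whose volume yields the
      growth rate e s_r (card_admissible_le, coord_volume_upper).

    - Existence of the limit. Fix a torus of side a and freeze the values on a
      frame of bounded width. By pigeonhole some g is such that the frame
      values of g and of all its translates admit nearly as many fillings as an
      average frame. The frame values admitting many fillings are stable under
      midpoints, hence under averaging g with its translates, and the average
      is almost constant: a constant frame admits nearly as many fillings
      (card_flat_ge). Tiles with the same constant frame can be placed next to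
      each other on any larger torus, whether or not a divides its side
      (card_glue). So the entropy per vertex at side n is at least the one at
      side a up to an error that vanishes as a grows (entropy_tile), and a
      bounded sequence with this property converges.

    - Scaling. The limit f is positive, nondecreasing in each s_r, homogeneous
      of degree one, and f(s) <= e s_r for every r.

    These properties suffice. If mu = t_r/s_r is the smallest of the three
    ratios and mu < 1, then mu s <= t gives f(t) >= mu f(s), so that
    f(s) - f(t) <= (1 - mu) e s_r = e (s_r - t_r): the function f is even
    e-Lipschitz. The midpoint inequality makes the set {f >= 1} closed under
    midpoints, hence, by monotonicity and homogeneity, convex; applied to
    s/f(s) and t/f(t), homogeneity turns this convexity into concavity. *)

(** * Rounded midpoints of integer vectors *)

(** Both roundings of the half-integer (x + y)/2 are allowed: this is what makes
    the counting inequality below hold without loss. *)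
Definition near_midpoint (x y z : nat) : bool :=
  (z.*2 <= (x + y).+1)%N && (x + y <= z.*2.+1)%N.

(** If a is the largest element of A and b the smallest one of B, then A + b and
    a + B + 1 are disjoint sets of integers, and each of their elements has its
    half in C, up to rounding. At most two integers have the same half. *)
Lemma card_near_midpoints (M : nat) (A B C : {set 'I_M}) (x0 y0 : 'I_M) :
  x0 \in A -> y0 \in B ->
  (forall x y z : 'I_M, x \in A -> y \in B -> near_midpoint x y z -> z \in C) ->
  (#|A| + #|B| <= 2 * #|C|)%N.
Proof.
move=> Ax By HC.
have [a Aa amax] : exists2 a, a \in A & forall x, x \in A -> (x <= a)%N.
  by case: (arg_maxnP (fun x : 'I_M => x : nat) Ax) => a Aa Ha; exists a.
have [b Bb bmin] : exists2 b, b \in B & forall y, y \in B -> (b <= y)%N.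
  by case: (arg_minnP (fun x : 'I_M => x : nat) By) => b Bb Hb; exists b.
(* All sums x + b are smaller than all sums a + y + 1, and halving (rounding
   down) a sum of the first kind, or of the second, gives a point of C. *)
pose s := [seq (x + b)%N | x : 'I_M in A] ++ [seq (a + y).+1 | y : 'I_M in B].
pose t := [seq (nat_of_ord z, c) | z <- enum C, c <- [:: true; false]].
have szs : size s = (#|A| + #|B|)%N by rewrite size_cat !size_image.
have szt : size t = (2 * #|C|)%N by rewrite size_allpairs -cardE mulnC.
have us : uniq s.
  rewrite cat_uniq; apply/and3P; split.
  - by rewrite map_inj_uniq ?enum_uniq// => x x' /addIn /val_inj.
  - apply/hasPn => _ /mapP[y + ->]; rewrite mem_enum => By'; apply/negP => /mapP[x];
      rewrite mem_enum => Ax' E.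
    by have := amax _ Ax'; have := bmin _ By'; lia.
  - by rewrite map_inj_uniq ?enum_uniq// => y y' [] /addnI /val_inj.
rewrite -szs -szt -(size_map (fun k => (k./2, odd k)) s).
apply: uniq_leq_size.
  rewrite map_inj_uniq// => k k' [E1 E2].
  by rewrite -(odd_double_half k) -(odd_double_half k') E1 E2.
have mem_t (z : 'I_M) c : z \in C -> (nat_of_ord z, c) \in t.
  move=> Cz; apply/allpairsP; exists (z, c); split => //=; first by rewrite mem_enum.
  by case: c.
move=> _ /mapP[k ks ->]; move: ks; rewrite mem_cat => /orP[] /mapP[x];
  rewrite mem_enum => Ax' ->.
  have h : ((x + b)./2 < M)%N by have := ltn_ord x; have := ltn_ord b; lia.
  apply: (mem_t (Ordinal h)); apply: (HC x b) => //.
  by rewrite /near_midpoint /=; lia.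
have h : ((a + x).+1./2 < M)%N by have := ltn_ord a; have := ltn_ord x; lia.
apply: (mem_t (Ordinal h)); apply: (HC a x) => //.
by rewrite /near_midpoint /=; lia.
Qed.

(** The layer-cake argument: the level sets of f, g and h satisfy the hypothesis
    of card_near_midpoints. Peeling off one layer at a time, by induction on the
    sizes of the supports, avoids integrating over the level. *)
Lemma sum_near_midpoints (R : realFieldType) (M : nat) (f g h : 'I_M -> R) (x0 y0 : 'I_M) :
  (forall x, 0 <= f x <= f x0) -> (forall y, 0 <= g y <= g y0) -> f x0 = g y0 ->
  (forall z, 0 <= h z) ->
  (forall x y z : 'I_M, near_midpoint x y z -> Num.min (f x) (g y) <= h z) ->
  \sum_x f x + \sum_y g y <= 2 * \sum_z h z.
Proof.
have [N] := ubnP (#|[set x | (0 < f x)%R]| + #|[set y | (0 < g y)%R]|)%N.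
elim: N f g h => // N IH f g h; rewrite ltnS => leN Hf Hg fg Hh fgh.
have Hf0 x : 0 <= f x by case/andP: (Hf x).
have Hf1 x : f x <= f x0 by case/andP: (Hf x).
have Hg0 x : 0 <= g x by case/andP: (Hg x).
have Hg1 x : g x <= g y0 by case/andP: (Hg x).
have [fx0|fx0] := leP (f x0) 0.
  have f0 i : f i = 0 by apply: le_anti; rewrite Hf0 (le_trans (Hf1 i)).
  have g0 i : g i = 0 by apply: le_anti; rewrite Hg0 (le_trans (Hg1 i))// -fg.
  rewrite [X in X + _]big1 ?[X in _ + X]big1 ?addr0 => [|i _|i _] //.
  by rewrite mulr_ge0// sumr_ge0.
have [t [t0 ft gt tm]] : exists t, [/\ 0 < t, forall x, 0 < f x -> t <= f x,
    forall y, 0 < g y -> t <= g y &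
    (exists2 x, 0 < f x & f x = t) \/ (exists2 y, 0 < g y & g y = t)].
  have gy0 : 0 < g y0 by rewrite -fg.
  case: (@Order.TotalTheory.arg_minP _ _ _ x0 (fun x => 0 < f x) f fx0) => x fx xmin;
    case: (@Order.TotalTheory.arg_minP _ _ _ y0 (fun y => 0 < g y) g gy0) => y gy ymin.
  have [fgxy|fgxy] := leP (f x) (g y).
    exists (f x); split => //; last by left; exists x.
    by move=> y' /ymin; apply: le_trans.
  exists (g y); split => //; last by right; exists y.
  by move=> x' /xmin; apply: le_trans; exact: ltW.
(* Peel off the lowest layer, of height t, from the three functions. *)
pose A := [set x | 0 < f x]; pose B := [set y | 0 < g y]; pose C := [set z | t <= h z].
pose f' x := f x - t * (x \in A)%:R.
pose g' x := g x - t * (x \in B)%:R.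
pose h' x := h x - t * (x \in C)%:R.
have f'E x : f' x = if 0 < f x then f x - t else 0.
  rewrite /f' /A inE; case: ltP => fx; rewrite ?mulr1// mulr0 subr0.
  by have := Hf0 x; lra.
have g'E x : g' x = if 0 < g x then g x - t else 0.
  rewrite /g' /B inE; case: ltP => fx; rewrite ?mulr1// mulr0 subr0.
  by have := Hg0 x; lra.
have h'E x : h' x = if t <= h x then h x - t else h x.
  by rewrite /h' /C inE; case: leP => hx; rewrite ?mulr1// mulr0 subr0.
have sumE (F F' : 'I_M -> R) (D : {set 'I_M}) : (forall x, F' x = F x - t * (x \in D)%:R) ->
    \sum_x F x = \sum_x F' x + t * #|D|%:R.
  move=> FF'; rewrite -sum1_card natr_sum mulr_sumr [X in _ = _ + X]big_mkcond -big_split /=.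
  by apply: eq_bigr => x _; rewrite FF'; case: (x \in D);
    rewrite ?mulr1 ?mulr0 ?subr0 ?addr0// subrK.
have ABC : (#|A| + #|B| <= 2 * #|C|)%N.
  apply: (@card_near_midpoints _ _ _ _ x0 y0); rewrite /A /B /C ?inE -?fg//.
  move=> x y z; rewrite !inE => fx gy xyz; apply: le_trans (fgh _ _ _ xyz).
  by rewrite le_min ft// gt.
rewrite (sumE f f' A)// (sumE g g' B)// (sumE h h' C)//.
have key : \sum_x f' x + \sum_x g' x <= 2 * \sum_x h' x.
  apply: IH.
  - apply: leq_trans leN.
    have sA : [set x | 0 < f' x] \subset A.
      by rewrite /A; apply/fintype.subsetP => x; rewrite !inE f'E; case: (ltP 0 (f x)) => ?;
        rewrite ?ltxx.
    have sB : [set x | 0 < g' x] \subset B.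
      by rewrite /B; apply/fintype.subsetP => x; rewrite !inE g'E; case: (ltP 0 (g x)) => ?;
        rewrite ?ltxx.
    case: tm => -[x x0' xt].
      rewrite -addSn; apply: leq_add; last exact: subset_leq_card.
      apply: proper_card; apply/fintype.properP; split => //; exists x; rewrite ?/A ?/B inE//.
      by rewrite f'E x0' xt subrr ltxx.
    rewrite -addnS; apply: leq_add; first exact: subset_leq_card.
    apply: proper_card; apply/fintype.properP; split => //; exists x; rewrite ?/A ?/B inE//.
    by rewrite g'E x0' xt subrr ltxx.
  - move=> x; apply/andP; rewrite !f'E fx0; have := Hf1 x; have := ft x; have := ft _ fx0.
    by case: ltP => [_|_]; [move=> ? /(_ isT)|]; split; lra.
  - have gy0 : 0 < g y0 by rewrite -fg.
    move=> x; apply/andP; rewrite !g'E gy0; have := Hg1 x; have := gt x; have := gt _ gy0.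
    by case: ltP => [_|_]; [move=> ? /(_ isT)|]; split; lra.
  - by rewrite f'E g'E -fg fx0.
  - by move=> z; rewrite h'E; case: (leP t (h z)) => hz; [lra|exact: Hh].
  - move=> x y z xyz; have fghz := fgh _ _ _ xyz.
    have h'0 : 0 <= h' z by rewrite h'E; case: (leP t (h z)) => hz; [lra|exact: Hh].
    rewrite f'E g'E ge_min; case: (ltP 0 (f x)) => fx; last by rewrite h'0.
    case: (ltP 0 (g y)) => gy; last by rewrite h'0 orbT.
    have thz : t <= h z by apply: le_trans fghz; rewrite le_min ft ?gt.
    by rewrite h'E thz !lerD2r -ge_min.
have : (#|A|%:R + #|B|%:R : R) <= 2 * #|C|%:R by rewrite -natrD -natrM ler_nat.
by move=> /(ler_wpM2l (ltW t0)); lra.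
Qed.

(** Dividing f, g and h by max f, max g and their geometric mean reduces to
    sum_near_midpoints; the product then comes from the inequality between
    arithmetic and geometric means. *)
Lemma prekopa_leindler1 (R : rcfType) (M : nat) (f g h : 'I_M -> R) :
  (forall x, 0 <= f x) -> (forall y, 0 <= g y) -> (forall z, 0 <= h z) ->
  (forall x y z : 'I_M, near_midpoint x y z -> f x * g y <= h z ^+ 2) ->
  (\sum_x f x) * (\sum_y g y) <= (\sum_z h z) ^+ 2.
Proof.
move=> f0 g0 h0 fgh.
have [/forallP fz|] := boolP [forall x, f x == 0].
  by rewrite big1 ?mul0r ?sqr_ge0// => x _; exact/eqP.
rewrite negb_forall => /existsP[x1 fx1].
have [/forallP gz|] := boolP [forall x, g x == 0].
  by rewrite [X in _ * X]big1 ?mulr0 ?sqr_ge0// => x _; exact/eqP.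
rewrite negb_forall => /existsP[y1 gy1].
have [x0 fmax] : exists x0, forall x, f x <= f x0.
  by case: (@Order.TotalTheory.arg_maxP _ _ _ x1 predT f isT) => x _ H; exists x => x';
    exact: H.
have [y0 gmax] : exists y0, forall y, g y <= g y0.
  by case: (@Order.TotalTheory.arg_maxP _ _ _ y1 predT g isT) => x _ H; exists x => x';
    exact: H.
have a0 : 0 < f x0 by apply: lt_le_trans (fmax x1); rewrite lt_neqAle eq_sym fx1 f0.
have b0 : 0 < g y0 by apply: lt_le_trans (gmax y1); rewrite lt_neqAle eq_sym gy1 g0.
set a := f x0 in a0 fmax; set b := g y0 in b0 gmax.
pose c := Num.sqrt (a * b).
have c0 : 0 < c by rewrite sqrtr_gt0 mulr_gt0.
have c2 : c ^+ 2 = a * b by rewrite sqr_sqrtr// ltW// mulr_gt0.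
have key : \sum_x f x / a + \sum_y g y / b <= 2 * \sum_z h z / c.
  apply: (@sum_near_midpoints _ _ _ _ _ x0 y0).
  - by move=> x; rewrite divr_ge0 ?(ltW a0)//= ler_pM2r ?invr_gt0// fmax.
  - by move=> x; rewrite divr_ge0 ?(ltW b0)//= ler_pM2r ?invr_gt0// gmax.
  - by rewrite !divff ?gt_eqF.
  - by move=> z; rewrite divr_ge0// ltW.
  - move=> x y z /fgh xyz.
    have m0 : 0 <= Num.min (f x / a) (g y / b).
      by rewrite le_min !divr_ge0// ltW.
    rewrite -(@ler_pXn2r _ 2)// ?nnegrE ?divr_ge0 ?(ltW c0)//.
    apply: (@le_trans _ _ (f x / a * (g y / b))).
      by rewrite expr2 ler_pM// ge_min lexx ?orbT.
    by rewrite expr_div_n c2 mulf_div ler_pM2r// invr_gt0 mulr_gt0.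
rewrite -!mulr_suml in key.
set F := \sum_x f x in key *; set G := \sum_y g y in key *; set H := \sum_z h z in key *.
have F0 : 0 <= F by rewrite sumr_ge0.
have G0 : 0 <= G by rewrite sumr_ge0.
have H0 : 0 <= H by rewrite sumr_ge0.
have : (F / a) * (G / b) <= (H / c) ^+ 2.
  have Fa : 0 <= F / a by rewrite divr_ge0// ltW.
  have Gb : 0 <= G / b by rewrite divr_ge0// ltW.
  have Hc : 0 <= H / c by rewrite divr_ge0// ltW.
  move: Fa Gb Hc key; set p := F / a; set q := G / b; set r := H / c.
  move=> p0 q0 r0 key.
  have : (p + q) ^+ 2 <= (2 * r) ^+ 2.
    by rewrite ler_pXn2r ?nnegrE ?(addr_ge0 p0 q0) ?(mulr_ge0 _ r0).
  by have := sqr_ge0 (p - q); lra.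
by rewrite expr_div_n c2 mulf_div ler_pM2r// invr_gt0 mulr_gt0.
Qed.

Lemma sum_tuple_recl (V : nmodType) (X : finType) (k : nat) (f : k.+1.-tuple X -> V) :
  \sum_t f t = \sum_x \sum_(t : k.-tuple X) f [tuple of x :: t].
Proof.
rewrite pair_bigA /= (reindex (fun p : X * k.-tuple X => [tuple of p.1 :: p.2]))//=.
exists (fun t => (thead t, [tuple of behead t])) => [[x t]|t] _.
  by congr pair; exact/val_inj.
by rewrite -tuple_eta.
Qed.

(** Sums over all but the first coordinate inherit the hypothesis, by the
    induction hypothesis applied to each triple of slices. *)
Lemma prekopa_leindler_tuple (R : rcfType) (M k : nat) (f g h : k.-tuple 'I_M -> R) :
  (forall x, 0 <= f x) -> (forall y, 0 <= g y) -> (forall z, 0 <= h z) ->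
  (forall x y z : k.-tuple 'I_M,
     (forall i, near_midpoint (tnth x i) (tnth y i) (tnth z i)) -> f x * g y <= h z ^+ 2) ->
  (\sum_x f x) * (\sum_y g y) <= (\sum_z h z) ^+ 2.
Proof.
elim: k f g h => [|k IH] f g h f0 g0 h0 fgh.
  have E (F : 0.-tuple 'I_M -> R) : \sum_t F t = F [tuple].
    by rewrite (big_pred1 [tuple])// => t /=; apply/esym/eqP; exact: tuple0.
  by rewrite !E; apply: fgh => -[].
rewrite !sum_tuple_recl; apply: prekopa_leindler1.
- by move=> x; rewrite sumr_ge0.
- by move=> x; rewrite sumr_ge0.
- by move=> x; rewrite sumr_ge0.
move=> x y z xyz; apply: IH => // u v w uvw; apply: fgh => i.
by case: (unliftP ord0 i) => [j ->|->]; rewrite ?tnthS//.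
Qed.

(** A discrete counterpart of the multiplicative Brunn-Minkowski inequality:
    prekopa_leindler_tuple for indicator functions. The real algebraic numbers
    only serve to take square roots. *)
Lemma card_midpoints (T : finType) (M : nat) (A B C : {set {ffun T -> 'I_M}}) :
  (forall x y z : {ffun T -> 'I_M}, x \in A -> y \in B ->
     (forall v, near_midpoint (x v) (y v) (z v)) -> z \in C) ->
  (#|A| * #|B| <= #|C| ^ 2)%N.
Proof.
move=> HC; pose K : rcfType := realalg.
pose ind (D : {set {ffun T -> 'I_M}}) (t : #|T|.-tuple 'I_M) : K := (Finfun t \in D)%:R.
have indE D : \sum_t ind D t = #|D|%:R.
  rewrite -sum1_card natr_sum [RHS]big_mkcond /= (reindex (@Finfun T 'I_M)) /=.
    by apply: eq_bigr => t _; rewrite /ind; case: (_ \in _).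
  by exists (fun g : {ffun T -> 'I_M} => fgraph g) => t _; [exact: FinfunK|exact: fgraphK].
rewrite -(ler_nat K) natrM natrX -!indE; apply: prekopa_leindler_tuple => [t|t|t|x y z xyz].
- by rewrite /ind ler0n.
- by rewrite /ind ler0n.
- by rewrite /ind ler0n.
rewrite /ind -natrM -natrX ler_nat.
have [xA|] := boolP (Finfun x \in A); last by rewrite mul0n.
have [yB|] := boolP (Finfun y \in B); last by rewrite muln0.
rewrite (HC _ _ _ xA yB) // => v.
by rewrite -[v]enum_rankK -!tnth_fgraph !FinfunK.
Qed.

(** * The discrete Hessian on integer configurations *)

(** All that matters for linearity and for crude bounds is that two values enter
    with sign + and two with sign -. *)
Lemma hessianE (R : realType) (n : nat) (r : 'I_3) (v : torus n) :
  exists a b c d : torus n,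
    forall f : torus n -> R, hessian r f v = f a + f b - f c - f d.
Proof.
case: v => a b; rewrite /hessian.
case: (nat_of_ord r) => [|[|?]]; by do 4 eexists.
Qed.

Lemma hessianD (R : realType) (n : nat) (r : 'I_3) (v : torus n) (f g : torus n -> R) :
  hessian r (fun w => f w + g w) v = hessian r f v + hessian r g v.
Proof. by have [a [b [c [d E]]]] := hessianE R r v; rewrite !E; ring. Qed.

Lemma hessianZ (R : realType) (n : nat) (r : 'I_3) (v : torus n) (x : R) (f : torus n -> R) :
  hessian r (fun w => x * f w) v = x * hessian r f v.
Proof. by have [a [b [c [d E]]]] := hessianE R r v; rewrite !E; ring. Qed.

Lemma hessian_cst (R : realType) (n : nat) (r : 'I_3) (v : torus n) (x : R) :
  hessian r (fun=> x) v = 0.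
Proof. by have [a [b [c [d E]]]] := hessianE R r v; rewrite !E; ring. Qed.

Lemma hessian_le_nonneg (R : realType) (n : nat) (r : 'I_3) (v : torus n) (f : torus n -> R)
  (x : R) :
  (forall w, 0 <= f w) -> (forall w, f w <= x) -> hessian r f v <= 2 * x.
Proof.
move=> f0 fx; have [a [b [c [d E]]]] := hessianE R r v; rewrite E.
by have := fx a; have := fx b; have := f0 c; have := f0 d; lra.
Qed.

Lemma hessian_le_norm (R : realType) (n : nat) (r : 'I_3) (v : torus n) (f : torus n -> R)
  (x : R) :
  (forall w, `|f w| <= x) -> hessian r f v <= 4 * x.
Proof.
move=> fx; have [a [b [c [d E]]]] := hessianE R r v; rewrite E.
have := fx a; have := fx b; have := fx c; have := fx d.
by rewrite !ler_norml => /andP[? ?] /andP[? ?] /andP[? ?] /andP[? ?]; lra.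
Qed.

Lemma le_hessian_near (R : realType) (n : nat) (r : 'I_3) (v : torus n) (f g : torus n -> R)
  (x : R) :
  (forall w, `|f w - g w| <= x) -> hessian r f v <= hessian r g v + 4 * x.
Proof.
move=> fgx; rewrite -lerBlDl; have := hessian_le_norm r v fgx.
by have [a [b [c [d E]]]] := hessianE R r v; rewrite !E; lra.
Qed.

Definition shift1 (n : nat) (v : torus n) : torus n := (ordS v.1, v.2).
Definition shift2 (n : nat) (v : torus n) : torus n := (v.1, ordS v.2).

Lemma hessian_shift1 (R : realType) (n : nat) (r : 'I_3) (v : torus n) (f : torus n -> R) :
  hessian r (fun w => f (shift1 w)) v = hessian r f (shift1 v).
Proof. by case: v => a b; rewrite /hessian /shift1 /=; case: (nat_of_ord r) => [|[|?]]. Qed.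

Lemma hessian_shift2 (R : realType) (n : nat) (r : 'I_3) (v : torus n) (f : torus n -> R) :
  hessian r (fun w => f (shift2 w)) v = hessian r f (shift2 v).
Proof. by case: v => a b; rewrite /hessian /shift2 /=; case: (nat_of_ord r) => [|[|?]]. Qed.

Definition natval (R : realType) (n M : nat) (g : {ffun torus n -> 'I_M})
  (v : torus n) : R := (g v : nat)%:R.

(** The integer points of the polytope with thresholds u, without normalization
    of the mean; the range M keeps their number finite. *)
Definition admissible (R : realType) (n M : nat)
  (u : 'I_3 -> R) : {set {ffun torus n -> 'I_M}} :=
  [set g | [forall v, forall r, hessian r (natval R g) v <= u r]].

Lemma admissibleP (R : realType) (n M : nat) (u : 'I_3 -> R) (g : {ffun torus n -> 'I_M}) :
  reflect (forall v r, hessian r (natval R g) v <= u r) (g \in admissible n M u).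
Proof.
rewrite inE; apply: (iffP forallP) => [H v r|H v]; first exact: (forallP (H v)).
by apply/forallP => r; exact: H.
Qed.

Lemma card_torus (n : nat) : #|torus n| = (n ^ 2)%N.
Proof. by rewrite card_prod card_ord. Qed.

(** Functions with values in {0, ..., p - 1} have Hessian at most 2 p. *)
Lemma card_admissible_ge (R : realType) (n M p : nat) (u : 'I_3 -> R) :
  (p <= M)%N -> (forall r, 2 * p%:R <= u r) ->
  (p ^ (n ^ 2) <= #|admissible n M u|)%N.
Proof.
move=> pM pu; rewrite -card_torus -[p in (p ^ _)%N]card_ord -card_ffun.
pose w (h : {ffun torus n -> 'I_p}) : {ffun torus n -> 'I_M} := [ffun v => widen_ord pM (h v)].
have wi : injective w.
  move=> h h' /ffunP E; apply/ffunP => v; have := E v; rewrite !ffunE.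
  by move=> /(congr1 val) /= /val_inj.
rewrite -(card_imset _ wi); apply: subset_leq_card; apply/fintype.subsetP => _ /imsetP[h _ ->].
apply/admissibleP => v r; apply: le_trans (pu r).
apply: hessian_le_nonneg => v'; rewrite /natval ffunE /= ?ler0n// ler_nat.
exact: ltnW.
Qed.

(** Rounding the midpoint moves each value by at most 1/2, hence the Hessian by
    at most 2. *)
Lemma hessian_near_midpoint (R : realType) (n M : nat) (x y z : {ffun torus n -> 'I_M})
  (u u' : R) r v :
  (forall v, near_midpoint (x v) (y v) (z v)) ->
  hessian r (natval R x) v <= u -> hessian r (natval R y) v <= u' ->
  hessian r (natval R z) v <= (u + u') / 2 + 2.
Proof.
move=> xyz xu yu.
have : hessian r (fun w => 2 * natval R z w) v <=
       hessian r (fun w => natval R x w + natval R y w) v + 4 * 1.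
  apply: le_hessian_near => w; have /andP[] := xyz w; rewrite /natval.
  rewrite -!(ler_nat R) -!muln2 -!natr1 !natrD !natrM ler_norml => H1 H2.
  by apply/andP; split; lra.
by rewrite hessianZ hessianD; lra.
Qed.

Lemma card_admissible_midpoint (R : realType) (n M : nat) (u u' : 'I_3 -> R) :
  (#|admissible n M u| * #|admissible n M u'| <=
   #|admissible n M (fun r => ((u r + u' r) / 2 + 2)%R)| ^ 2)%N.
Proof.
apply: card_midpoints => x y z /admissibleP xu /admissibleP yu xyz.
by apply/admissibleP => v r; apply: hessian_near_midpoint.
Qed.

(** * Oscillation of functions with bounded Hessian *)

(** The increments of a periodic sequence sum up to zero over a period and
    increase by at most K at each step, so each of them is at least - n K. *)
Lemma periodic_oscillation (R : realFieldType) (n : nat) (phi : nat -> R) (K : R) :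
  (0 < n)%N -> 0 <= K -> (forall i, phi (i + n)%N = phi i) ->
  (forall i, phi i.+2 + phi i - 2 * phi i.+1 <= K) ->
  forall i j, (j <= n)%N -> phi i - phi (i + j)%N <= n%:R ^+ 2 * K.
Proof.
move=> n0 K0 per conv.
have incr i t : phi (i + t).+1 - phi (i + t)%N <= phi i.+1 - phi i + t%:R * K.
  elim: t => [|t IH]; first by rewrite addn0 mul0r addr0.
  rewrite addnS -natr1 mulrDl mul1r; have := conv (i + t)%N; lra.
have lb i : - (n%:R * K) <= phi i.+1 - phi i.
  have H : 0 <= n%:R * (phi i.+1 - phi i) + n%:R * (n%:R * K).
    have -> : 0 = \sum_(t < n) (phi (i + t).+1 - phi (i + t)%N).
      rewrite -(big_mkord xpredT (fun t => phi (i + t).+1 - phi (i + t)%N)).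
      under eq_bigr do rewrite -addnS.
      by rewrite (telescope_sumr (fun t => phi (i + t)%N)) ?leq0n// per addn0 subrr.
    rewrite -mulrDr (_ : n%:R * _ = \sum_(t < n) (phi i.+1 - phi i + n%:R * K)); last first.
      by rewrite sumr_const card_ord mulr_natl.
    apply: ler_sum => t _; apply: le_trans (incr i t) _.
    by rewrite lerD2l ler_wpM2r// ler_nat ltnW.
  move: H; rewrite -mulrDr pmulr_rge0 ?ltr0n//; lra.
move=> i j jn.
have : phi i - phi (i + j)%N <= j%:R * (n%:R * K).
  elim: j {jn} => [|j IH]; first by rewrite addn0 subrr mul0r.
  by rewrite addnS -natr1 mulrDl mul1r; have := lb (i + j)%N; lra.
move=> /le_trans; apply; rewrite expr2 -mulrA ler_wpM2r ?mulr_ge0// ler_nat//.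
Qed.

Lemma iter_ordS (n i : nat) (a : 'I_n) : iter i (@ordS n) a = ((a + i) %% n)%N :> nat.
Proof.
elim: i => [|i IH] /=; first by rewrite addn0 modn_small.
by rewrite IH -addn1 modnDml addn1 addnS.
Qed.

Lemma iter_ordS_period (n : nat) (a : 'I_n) : iter n (@ordS n) a = a.
Proof. by apply/val_inj; rewrite /= iter_ordS modnDr modn_small. Qed.

Lemma iter_ordS_connect (n : nat) (a b : 'I_n) : exists2 i, (i <= n)%N & iter i (@ordS n) a = b.
Proof.
exists (if a <= b then b - a else b + n - a)%N.
  by case: ifP; have := ltn_ord b; have := ltn_ord a; lia.
apply/val_inj; rewrite /= iter_ordS; have := ltn_ord b; have := ltn_ord a.
move=> la lb; have [ab|ab] := leqP a b; first by rewrite subnKC// modn_small.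
have -> : (a + (b + n - a) = b + n)%N by lia.
by rewrite modnDr modn_small.
Qed.

(** Along each lattice direction the sum of two of the Hessians is a second
    difference, so periodic_oscillation applies twice. *)
Lemma hessian_oscillation (R : realType) (n : nat) (f : torus n -> R) (s : 'I_3 -> R) :
  (forall r, 0 <= s r) -> (forall v r, hessian r f v <= s r) ->
  forall v w, f v - f w <= 2 * (n%:R ^+ 2 * \sum_r s r).
Proof.
move=> s0 fs [a b] [a' b'].
have n0 : (0 < n)%N by apply: leq_ltn_trans (ltn_ord a).
have S0 : 0 <= \sum_r s r by rewrite sumr_ge0.
have E : \sum_r s r = s ord0 + s (inord 1) + s (inord 2).
  rewrite !big_ord_recl big_ord0 addr0 addrA; congr (s _ + s _ + s _); apply/val_inj => /=;
    by rewrite inordK.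
have [h0 h1 h2] : [/\ forall c d, f (c, d) + f (ordS (ordS c), ordS d) - f (ordS c,
  d) - f (ordS c, ordS d) <= s ord0,
  forall c d, f (ordS c, d) + f (c, ordS d) - f (c, d) - f (ordS c, ordS d) <= s (inord 1) &
  forall c d, f (c, d) + f (ordS c, ordS (ordS d)) - f (ordS c, ordS d) - f (c, ordS d)
    <= s (inord 2)].
  split=> c d.
  - exact: (fs (c, d) ord0).
  - by have := fs (c, d) (inord 1); rewrite /hessian inordK.
  - by have := fs (c, d) (inord 2); rewrite /hessian inordK.
have {}s0 : [/\ 0 <= s ord0, 0 <= s (inord 1) & 0 <= s (inord 2)] by split.
have [s00 s01 s02] := s0.
(* Two adjacent rhombi of different families add up to a second difference
   along a lattice direction. *)
have row : f (a, b) - f (a', b) <= n%:R ^+ 2 * \sum_r s r.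
  have [i ilen <-] := iter_ordS_connect a a'.
  apply: (@periodic_oscillation _ n (fun i =>
    f (iter i (@ordS n) a, b)) _ n0 S0 _ _ 0%N i ilen).
    by move=> j; rewrite iterD iter_ordS_period.
  move=> j /=; set c := iter j _ a; rewrite E.
  have := h0 c (ord_pred b); have := h1 c (ord_pred b); rewrite ord_predK; lra.
have col : f (a', b) - f (a', b') <= n%:R ^+ 2 * \sum_r s r.
  have [i ilen <-] := iter_ordS_connect b b'.
  apply: (@periodic_oscillation _ n (fun i =>
    f (a', iter i (@ordS n) b)) _ n0 S0 _ _ 0%N i ilen).
    by move=> j; rewrite iterD iter_ordS_period.
  move=> j /=; set c := iter j _ b; rewrite E.
  have := h1 (ord_pred a') c; have := h2 (ord_pred a') c; rewrite ord_predK; lra.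
lra.
Qed.

(** Averaging the oscillation bound over one of the two vertices. It makes the
    polytope bounded. *)
Lemma hessian_mean0_bound (R : realType) (n : nat) (f : torus n -> R) (s : 'I_3 -> R) :
  (forall r, 0 <= s r) -> (forall v r, hessian r f v <= s r) -> \sum_v f v = 0 ->
  forall v, `|f v| <= 2 * (n%:R ^+ 2 * \sum_r s r).
Proof.
move=> s0 fs f0 v; set K := 2 * _.
have osc := hessian_oscillation s0 fs.
have N0 : 0 < (#|torus n|%:R : R) by rewrite ltr0n; apply/card_gt0P; exists v.
have E c : #|torus n|%:R * c = \sum_(w : torus n) c by rewrite sumr_const mulr_natl.
have up : #|torus n|%:R * f v <= #|torus n|%:R * K.
  rewrite !E -[leLHS]subr0 -[X in _ - X]f0 -sumrB; apply: ler_sum => w _; exact: osc.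
have lo : - (#|torus n|%:R * K) <= #|torus n|%:R * f v.
  rewrite !E -[leRHS]subr0 -[X in _ <= _ - X]f0 -sumrB -sumrN; apply: ler_sum => w _.
  by rewrite lerNl opprB; exact: osc.
by rewrite ler_norml -(ler_pM2l N0) mulrN lo/= -(ler_pM2l N0).
Qed.

(** * An upper bound from one family of rhombi *)

Lemma shift1_inj (n : nat) : injective (@shift1 n).
Proof. by move=> [a b] [c d] /pair_equal_spec[/ordS_inj /= -> /= ->]. Qed.

Lemma shift2_inj (n : nat) : injective (@shift2 n).
Proof. by move=> [a b] [c d] /pair_equal_spec[/= -> /ordS_inj /= ->]. Qed.

Lemma sum_hessian (R : realType) (n : nat) (r : 'I_3) (f : torus n -> R) :
  \sum_v hessian r f v = 0.
Proof.
have iter_inj (h : torus n -> torus n) k : injective h -> injective (iter k h).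
  by move=> hi; elim: k => [|k IH] x y //= /hi /IH.
pose g i j v := f (iter i (@shift1 n) (iter j (@shift2 n) v)).
have gE i j : \sum_v g i j v = \sum_v f v.
  rewrite [RHS](reindex_inj (h := fun v => iter i (@shift1 n) (iter j (@shift2 n) v)))//.
  apply: inj_comp; apply: iter_inj; [exact: shift1_inj|exact: shift2_inj].
have [i1 [j1 [i2 [j2 [i3 [j3 [i4 [j4 E]]]]]]]] : exists i1 j1 i2 j2 i3 j3 i4 j4, forall v,
    hessian r f v = g i1 j1 v + g i2 j2 v - g i3 j3 v - g i4 j4 v.
  rewrite /hessian; case: (nat_of_ord r) => [|[|?]].
  - by exists 0%N, 0%N, 2%N, 1%N, 1%N, 0%N, 1%N, 1%N => -[a b].
  - by exists 1%N, 0%N, 0%N, 1%N, 0%N, 0%N, 1%N, 1%N => -[a b].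
  - by exists 0%N, 0%N, 1%N, 2%N, 1%N, 1%N, 0%N, 1%N => -[a b].
rewrite (eq_bigr _ (fun v _ => E v)) !sumrB big_split /= !gE; ring.
Qed.

(** Coordinates on the torus whose axes are the two sides of the rhombi of
    family r: in these coordinates D_r is, up to sign, a mixed difference. *)
Definition rhombic_point (m : nat) (r : 'I_3) (a b : nat) : torus m.+1 :=
  match nat_of_ord r with
  | 0 => (inZp (a + b), inZp b)
  | 1 => (inZp a, inZp b)
  | _ => (inZp b, inZp (a + b))
  end.

Lemma ordS_inZp (m k : nat) : ordS (inZp k : 'I_m.+1) = inZp k.+1.
Proof. by apply/val_inj; rewrite /= -addn1 modnDml addn1. Qed.

Lemma hessian_rhombic_point (R : realType) (m : nat) (r : 'I_3) (a b : nat)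
  (f : torus m.+1 -> R) :
  let h := f (rhombic_point m r a b) + f (rhombic_point m r a.+1 b.+1)
           - f (rhombic_point m r a.+1 b) - f (rhombic_point m r a b.+1) in
  hessian r f (rhombic_point m r a b) = if nat_of_ord r == 1%N then - h else h.
Proof.
rewrite /= /hessian /rhombic_point; case: (nat_of_ord r) => [|[|k]] /=;
  rewrite !ordS_inZp ?addSn ?addnS; ring.
Qed.

Lemma rhombic_point_inj (m : nat) (r : 'I_3) (a b a' b' : nat) :
  (a <= m)%N -> (b <= m)%N -> (a' <= m)%N -> (b' <= m)%N ->
  rhombic_point m r a b = rhombic_point m r a' b' -> a = a' /\ b = b'.
Proof.
move=> am bm am' bm'; rewrite /rhombic_point.
have E k k' : (inZp k : 'I_m.+1) = inZp k' ->
  (k %% m.+1 = k' %% m.+1)%N by move=> /(congr1 val).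
have D c d e : (c <= m)%N -> (d <= m)%N -> ((c + e) %% m.+1 = (d + e) %% m.+1)%N -> c = d.
  by move=> cm dm /eqP; rewrite eqn_modDr !modn_small// => /eqP.
case: (nat_of_ord r) => [|[|k]] /pair_equal_spec[/E E1 /E E2].
- have Eb : b = b' by move: E2; rewrite !modn_small.
  by subst b'; split => //; apply: D E1.
- by move: E1 E2; rewrite !modn_small.
- have Eb : b = b' by move: E1; rewrite !modn_small.
  by subst b'; split => //; apply: D E2.
Qed.

Lemma rhombic_point_surj (m : nat) (r : 'I_3) (v : torus m.+1) :
  exists a b, [/\ (a <= m)%N, (b <= m)%N & v = rhombic_point m r a b].
Proof.
case: v => x y; rewrite /rhombic_point; have xm := ltn_ord x; have ym := ltn_ord y.
have E (c d : 'I_m.+1) : inZp ((c + (m.+1 - d)) %% m.+1 + d)%N = c.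
  apply/val_inj; rewrite /= modnDml -addnA subnK; last by rewrite ltnW.
  by rewrite modnDr modn_small.
case: (nat_of_ord r) => [|[|k]].
- by exists ((x + (m.+1 - y)) %% m.+1)%N, y; rewrite E valZpK -ltnS ltn_mod.
- by exists x, y; rewrite !valZpK.
- by exists ((y + (m.+1 - x)) %% m.+1)%N, x; rewrite E valZpK -ltnS ltn_mod.
Qed.

(** A function is recovered from its values on two axes and its mixed differences
    elsewhere. Subtracted from the bound U, the m^2 differences that are needed
    become natural numbers; over the whole torus they add up to (m+1)^2 U, since
    Hessians sum up to zero. The binomial coefficient counts such families. *)
Lemma card_admissible_le (R : realType) (m M U : nat) (u : 'I_3 -> R) (r : 'I_3) :
  u r < U.+1%:R ->
  (#|admissible m.+1 M u| <= M ^ m.+1 * M ^ m * 'C(m ^ 2 + m.+1 ^ 2 * U, m ^ 2))%N.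
Proof.
move=> uU; pose T := torus m.+1.
pose y (g : {ffun T -> 'I_M}) (v : T) : nat := Num.truncn (U%:R - hessian r (natval R g) v).
have yE g v : g \in admissible m.+1 M u -> (y g v)%:R = U%:R - hessian r (natval R g) v.
  move=> /admissibleP gu; rewrite /y truncnK//.
  have Dint : hessian r (natval R g) v \is a Num.int.
    have [a [b [c [d ->]]]] := hessianE R r v.
    by rewrite !rpredB ?rpredD// intr_nat// natr_nat.
  have UDint : U%:R - hessian r (natval R g) v \is a Num.int by rewrite rpredB// intr_nat//
    natr_nat.
  rewrite natrEint UDint /= subr_ge0.
  have : hessian r (natval R g) v < U.+1%:R by apply: le_lt_trans uU.
  have /intrP[z ->] := Dint.
  rewrite -[U.+1%:R]/((U.+1)%:Z%:~R) -[U%:R]/(U%:Z%:~R) ltr_int ler_int.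
  by rewrite -[U.+1]addn1 PoszD ltzD1.
have ysum g : g \in admissible m.+1 M u -> (\sum_v y g v = m.+1 ^ 2 * U)%N.
  move=> gA; apply/eqP; rewrite -(eqr_nat R) natr_sum; under eq_bigr do rewrite yE//.
  by rewrite sumrB sum_hessian subr0 sumr_const -mulrnA mulnC card_torus.
(* Keep D_r g only where it takes part in the reconstruction of g, so that no
   coordinate is counted twice: m^2 + (2m + 1) = (m + 1)^2. *)
pose P : finType := ('I_m * 'I_m)%type.
pose psi (p : P) : T := rhombic_point m r p.1 p.2.
have psi_inj : injective psi.
  move=> [a b] [c d] /rhombic_point_inj[]; rewrite ?(ltnW (ltn_ord _))//= => /val_inj ->
    /val_inj ->.
  by [].
have yps g : g \in admissible m.+1 M u -> (\sum_p y g (psi p) <= m.+1 ^ 2 * U)%N.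
  move=> gA; rewrite -(ysum _ gA).
  have -> : (\sum_p y g (psi p) = \sum_(v in psi @: [set: P]%SET) y g v)%N.
    rewrite big_imset /=; last exact: in2W.
    by apply: eq_bigl => p; rewrite finset.in_setT.
  by rewrite [leqRHS](bigID (fun v => v \in psi @: [set: P]%SET)) /= leq_addr.
pose K := (m.+1 ^ 2 * U)%N.
pose t (g : {ffun T -> 'I_M}) : #|P|.-tuple 'I_K.+1 := [tuple inord (y g (psi (enum_val i))) |
  i < #|P|].
have tE g i : g \in admissible m.+1 M u -> tnth (t g) i = y g (psi (enum_val i)) :> nat.
  move=> gA; rewrite tnth_mktuple inordK// ltnS; apply: leq_trans (yps g gA).
  by rewrite (bigD1 (enum_val i)) //= leq_addr.
pose row (g : {ffun T -> 'I_M}) : {ffun 'I_m.+1 -> 'I_M} :=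
  [ffun i : 'I_m.+1 => g (rhombic_point m r i 0)].
pose col (g : {ffun T -> 'I_M}) : {ffun 'I_m -> 'I_M} :=
  [ffun i : 'I_m => g (rhombic_point m r 0 i.+1)].
pose Phi g := ((row g, col g), t g).
pose target := finset.setX [set: {ffun 'I_m.+1 -> 'I_M} * {ffun 'I_m -> 'I_M}]%SET
  [set w : #|P|.-tuple 'I_K.+1 | (\sum_(i <- w) i <= K)%N].
have <- : #|target| = (M ^ m.+1 * M ^ m * 'C(m ^ 2 + K, m ^ 2))%N.
  rewrite cardsX cardsT card_prod !card_ffun !card_ord card_partial_ord_partitions.
  by rewrite /P card_prod card_ord.
rewrite -(card_in_imset (f := Phi)); last first.
  move=> g g' gA gA' /pair_equal_spec[/pair_equal_spec[/ffunP Erow /ffunP Ecol] Et].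
  have row_eq i : (i <= m)%N -> g (rhombic_point m r i 0) = g' (rhombic_point m r i 0).
    by move=> im; have := Erow (Ordinal (im : i < m.+1)%N); rewrite !ffunE.
  have col_eq i : (i <= m)%N -> g (rhombic_point m r 0 i) = g' (rhombic_point m r 0 i).
    case: i => [|i] im; first exact: row_eq.
    by have := Ecol (Ordinal im); rewrite !ffunE.
  have hess_eq a b : (a < m)%N -> (b < m)%N ->
      hessian r (natval R g) (rhombic_point m r a b) = hessian r (natval R g')
        (rhombic_point m r a b).
    move=> am bm; pose p : P := (Ordinal am, Ordinal bm).
    have := congr1 (fun w : #|P|.-tuple 'I_K.+1 => nat_of_ord (tnth w (enum_rank p))) Et.
    rewrite !tE// !enum_rankK => /(congr1 (fun k => k%:R : R)); rewrite !yE// /psi /=.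
    by move=> /addrI /oppr_inj.
  (* The value at (a + 1, b + 1) follows from D_r and the three other corners. *)
  have all_eq a : forall b, (a <= m)%N -> (b <= m)%N ->
    g (rhombic_point m r a b) = g' (rhombic_point m r a b).
    elim: a => [|a IHa] b am bm; first exact: col_eq.
    elim: b bm => [|b IHb] bm; first exact: row_eq.
    have := hess_eq a b am bm; rewrite !hessian_rhombic_point /natval.
    rewrite (IHa b) ?(ltnW am) ?(ltnW bm)// (IHa b.+1) ?(ltnW am)// IHb ?(ltnW bm)//.
    move=> E; apply/val_inj/eqP; rewrite -(eqr_nat R) /=; apply/eqP.
    by case: ifP E => _ E; lra.
  apply/ffunP => v; have [a [b [am bm ->]]] := rhombic_point_surj r v.
  exact: all_eq.
apply: subset_leq_card; apply/fintype.subsetP => w /imsetP[g gA ->].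
have tK : (\sum_(i <- t g) i <= K)%N.
  rewrite big_tuple (eq_bigr (fun i : 'I_#|P| => y g (psi (enum_val i)))); last by move=> i _;
    exact: tE.
  by rewrite -(big_enum_val (A := P) (fun p => y g (psi p))) yps.
by rewrite finset.in_setX finset.in_setT inE.
Qed.

(** * Constant frames *)

Definition fiber (R : realType) (n M : nat) (B : {set torus n}) (u : 'I_3 -> R)
    (b : torus n -> 'I_M) : {set {ffun torus n -> 'I_M}} :=
  [set x in admissible n M u | [forall v in B, x v == b v]].

Lemma fiberP (R : realType) (n M : nat) (B : {set torus n}) (u : 'I_3 -> R)
    (b : torus n -> 'I_M) (x : {ffun torus n -> 'I_M}) :
  reflect (x \in admissible n M u /\ forall v, v \in B -> x v = b v) (x \in fiber B u b).
Proof.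
have -> : (x \in fiber B u b) = (x \in admissible n M u) && [forall v in B, x v == b v].
  by rewrite [LHS]inE.
apply: (iffP andP) => -[xA xb]; split => //.
  by move=> v vB; apply/eqP; have /forall_inP := xb; apply.
by apply/forall_inP => v vB; apply/eqP; exact: xb.
Qed.

Definition overwrite (n M : nat) (B : {set torus n}) (b : torus n -> 'I_M)
    (x : {ffun torus n -> 'I_M}) : {ffun torus n -> 'I_M} :=
  [ffun v => if v \in B then b v else x v].

Lemma overwrite_fiber_inj (R : realType) (n M : nat) (B : {set torus n}) (u : 'I_3 -> R)
    (b c : torus n -> 'I_M) : {in fiber B u b &, injective (overwrite B c)}.
Proof.
move=> x y /fiberP[_ xb] /fiberP[_ yb] /ffunP xy; apply/ffunP => v.
have := xy v; rewrite !ffunE; case: ifP => // vB _.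
by rewrite xb// yb.
Qed.

(** Quasi-concavity of the number of fillings as a function of the prescribed
    values: prescribed values with at least K fillings are stable under rounded
    midpoints, with slightly larger thresholds. *)
Lemma card_fiber_midpoint (R : realType) (n M : nat) (B : {set torus n}) (u : 'I_3 -> R)
    (b1 b2 b : torus n -> 'I_M) :
  (forall v, near_midpoint (b1 v) (b2 v) (b v)) ->
  (#|fiber B u b1| * #|fiber B u b2| <= #|fiber B (fun r => u r + 2)%R b| ^ 2)%N.
Proof.
move=> b12.
(* Overwriting the values on B by those of b makes b their only rounded
   midpoint, so that all the sets compared consist of fillings of b. *)
rewrite -(card_in_imset (@overwrite_fiber_inj R n M B u b1 b)).
rewrite -(card_in_imset (@overwrite_fiber_inj R n M B u b2 b)).
apply: card_midpoints => _ _ z /imsetP[x /fiberP[/admissibleP xA xb] ->]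
  /imsetP[y /fiberP[/admissibleP yA yb] ->] xyz.
have zb v : v \in B -> z v = b v.
  move=> vB; have := xyz v; rewrite !ffunE vB => /andP[H1 H2].
  have e : nat_of_ord (z v) = nat_of_ord (b v) by lia.
  exact: val_inj.
apply/fiberP; split => //; apply/admissibleP => v r.
rewrite [leRHS](_ : _ = (u r + u r) / 2 + 2); last by lra.
apply: hessian_near_midpoint (xA v r) (yA v r) => w.
have := xyz w; rewrite !ffunE; case: ifP => // wB _.
by rewrite xb// yb// zb.
Qed.

Definition translate (n M i j : nat) (g : {ffun torus n -> 'I_M}) : {ffun torus n -> 'I_M} :=
  [ffun v => g (iter i (@ordS n) v.1, iter j (@ordS n) v.2)].

Lemma translate_translate (n M i j i' j' : nat) (g : {ffun torus n -> 'I_M}) :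
  translate i' j' (translate i j g) = translate (i + i') (j + j') g.
Proof. by apply/ffunP => v; rewrite !ffunE /= !iterD. Qed.

Lemma translate_inj (n M i j : nat) : injective (@translate n M i j).
Proof.
have iter_inj k : injective (iter k (@ordS n)).
  by elim: k => [|k IH] x y //= /ordS_inj /IH.
have surj k (a : 'I_n) : exists b, iter k (@ordS n) b = a.
  by have /injF_bij[f fK fK'] := iter_inj k; exists (f a); exact: fK'.
move=> g h /ffunP gh; apply/ffunP => -[a b].
have [a' <-] := surj i a; have [b' <-] := surj j b.
by have := gh (a', b'); rewrite !ffunE.
Qed.

Lemma translate_admissible (R : realType) (n M i j : nat) (u : 'I_3 -> R)
  (g : {ffun torus n -> 'I_M}) :
  g \in admissible n M u -> translate i j g \in admissible n M u.
Proof.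
move=> /admissibleP gu.
have s1 h : h \in admissible n M u -> translate 1 0 h \in admissible n M u.
  move=> /admissibleP hu; apply/admissibleP => v r.
  rewrite (_ : natval R _ = fun w => natval R h (shift1 w)) ?hessian_shift1//.
  by apply/funext => w; rewrite /natval ffunE.
have s2 h : h \in admissible n M u -> translate 0 1 h \in admissible n M u.
  move=> /admissibleP hu; apply/admissibleP => v r.
  rewrite (_ : natval R _ = fun w => natval R h (shift2 w)) ?hessian_shift2//.
  by apply/funext => w; rewrite /natval ffunE.
elim: i => [|i IH]; last by have := s1 _ IH; rewrite translate_translate addn1 addn0.
elim: j => [|j IH]; last by have := s2 _ IH; rewrite translate_translate addn1 addn0.
rewrite (_ : translate _ _ _ = g) //; first exact/admissibleP.
by apply/ffunP => -[a b]; rewrite ffunE.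
Qed.

(** Requiring many fillings for all the translates at once is what allows one to
    average a configuration with its own translates. *)
Definition robust (R : realType) (n M : nat) (B : {set torus n}) (K : nat) (u : 'I_3 -> R)
    (g : {ffun torus n -> 'I_M}) : Prop :=
  forall i j, (K <= #|fiber B u (translate i j g)|)%N.

(** Configurations with fewer than |X| / (n^2 M^|B|) fillings of their values on
    B are fewer than |X| / n^2, as there are at most M^|B| possible values on B.
    The n^2 translations cannot map such configurations onto all of X. *)
Lemma card_typical (R : realType) (n M : nat) (B : {set torus n}) (u : 'I_3 -> R) :
  (0 < n)%N -> (0 < #|admissible n M u|)%N ->
  exists g : {ffun torus n -> 'I_M}, forall i j : nat,
    (#|admissible n M u| <= n ^ 2 * M ^ #|B| * #|fiber B u (translate i j g)|)%N.
Proof.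
move=> n0 X0; set X := #|_| in X0 *; set K := (n ^ 2 * M ^ #|B|)%N.
have K0 : (0 < K)%N.
  have /card_gt0P[g _] := X0.
  have M0 : (0 < M)%N by apply: leq_ltn_trans (ltn_ord (g (Ordinal n0, Ordinal n0))).
  by rewrite muln_gt0 !expn_gt0 n0 M0.
pose bad := [set g in admissible n M u | (K * #|fiber B u g| < X)%N].
have [/exists_inP[g gA /forallP gok]|] := boolP [exists g in admissible n M u,
   [forall p : 'I_n * 'I_n, translate p.1 p.2 g \notin bad]].
  exists g => i j; pose p : 'I_n * 'I_n := (Ordinal (ltn_pmod i n0), Ordinal (ltn_pmod j n0)).
  have -> : translate i j g = translate p.1 p.2 g.
    apply/ffunP => v; rewrite !ffunE /=; congr (g (_, _)); apply/val_inj;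
    by rewrite /= !iter_ordS modnDmr.
  by have := gok p; rewrite inE translate_admissible//= -leqNgt.
rewrite negb_exists => /forallP H.
have Xbad : (X <= n ^ 2 * #|bad|)%N.
  have sub : admissible n M u \subset \bigcup_(p : 'I_n * 'I_n) translate p.1 p.2 @^-1: bad.
    apply/fintype.subsetP => g gA; have := H g; rewrite gA negb_forall => /existsP[p].
    by rewrite negbK => gp; apply/bigcupP; exists p => //; rewrite inE.
  apply: leq_trans (subset_leq_card sub) _; have card_cup (F : 'I_n * 'I_n ->
    {set {ffun torus n -> 'I_M}}) :
      (#|\bigcup_p F p| <= \sum_p #|F p|)%N.
    elim/big_rec2: _ => [|p a A _ IH]; first by rewrite cards0.
    by apply: leq_trans (leq_card_setU _ _) _; rewrite leq_add2l.
  apply: leq_trans (card_cup _) _.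
  rewrite -card_torus -sum_nat_const; apply: leq_sum => p _.
  by rewrite card_preimset//; exact: translate_inj.
have : (K * #|bad| <= M ^ #|B| * X.-1)%N.
  pose D := {v : torus n | v \in B}.
  pose res (g : {ffun torus n -> 'I_M}) : {ffun D -> 'I_M} := [ffun v => g (val v)].
  have -> : (M ^ #|B|)%N = #|{ffun D -> 'I_M}| by rewrite card_ffun card_ord card_sig.
  rewrite -sum1_card (partition_big res predT)//= big_distrr /= -sum_nat_const.
  apply: leq_sum => beta _; rewrite sum1dep_card.
  set C := [set g in bad | res g == beta].
  have [->|/card_gt0P[g0 g0P]] := posnP #|C|; first by rewrite muln0.
  move: (g0P); rewrite inE => /andP[]; rewrite inE => /andP[g0A g0bad] /eqP g0res.
  rewrite -ltnS prednK//; apply: leq_ltn_trans g0bad; rewrite leq_pmul2l//.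
  apply: subset_leq_card; apply/fintype.subsetP => g.
  rewrite inE => /andP[]; rewrite inE => /andP[gA _] /eqP gres.
  apply/fiberP; split => // v vB.
  have /ffunP/(_ (exist _ v vB)) : res g = res g0 by rewrite gres g0res.
  by rewrite !ffunE.
move=> /(leq_mul (leqnn (n ^ 2))) ; rewrite mulnA [(n ^ 2 * K)%N]mulnC -mulnA.
move=> /(leq_trans (leq_mul (leqnn K) Xbad)); rewrite mulnA -/K leq_pmul2l//.
by rewrite -[X in (X <= _)%N](prednK X0) ltnn.
Qed.

Lemma average_subproof (M : nat) (a b : 'I_M) : ((a + b)./2 < M)%N.
Proof. by have := ltn_ord a; have := ltn_ord b; lia. Qed.

Definition average (n M : nat) (g h : {ffun torus n -> 'I_M}) : {ffun torus n -> 'I_M} :=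
  [ffun v => Ordinal (average_subproof (g v) (h v))].

Lemma near_midpoint_average (n M : nat) (g h : {ffun torus n -> 'I_M}) v :
  near_midpoint (g v) (h v) (average g h v).
Proof. by rewrite ffunE /near_midpoint /=; lia. Qed.

Lemma natval_average (R : realType) (n M : nat) (g h : {ffun torus n -> 'I_M}) v :
  `|natval R (average g h) v - (natval R g v + natval R h v) / 2| <= 1 / 2.
Proof.
have /andP[H1 H2] := near_midpoint_average g h v; rewrite /natval.
have {}H1 : ((average g h v)%:R * 2 <= (g v)%:R + (h v)%:R + 1 :> R).
  by rewrite -natrM -natrD natr1 ler_nat muln2.
have {}H2 : ((g v)%:R + (h v)%:R <= (average g h v)%:R * 2 + 1 :> R).
  by rewrite -natrM -natrD natr1 ler_nat muln2.
by rewrite ler_norml; apply/andP; split; lra.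
Qed.

Lemma robust_average (R : realType) (n M : nat) (B : {set torus n}) (K : nat) (u : 'I_3 -> R)
    (g h : {ffun torus n -> 'I_M}) :
  robust B K u g -> robust B K u h -> robust B K (fun r => u r + 2) (average g h).
Proof.
move=> rg rh i j; rewrite -leq_sqr.
have nm v : near_midpoint (translate i j g v) (translate i j h v)
  (translate i j (average g h) v).
  by have := near_midpoint_average (translate i j g) (translate i j h) v; rewrite !ffunE.
apply: leq_trans (card_fiber_midpoint B u nm).
by rewrite -mulnn leq_mul.
Qed.

Lemma robust_translate (R : realType) (n M : nat) (B : {set torus n}) (K : nat) (u : 'I_3 -> R)
    (g : {ffun torus n -> 'I_M}) i j :
  robust B K u g -> robust B K u (translate i j g).
Proof. by move=> rg i' j'; rewrite translate_translate; exact: rg. Qed.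

(** Up to rounding, a_j is the mean of a_0 over 2^j consecutive points of an
    orbit of s, so that the increments of a_j along s telescope. *)
Lemma doubling_gradient (R : realType) (T : Type) (s : T -> T) (a : nat -> T -> R) :
  (forall j v, `|a j.+1 v - (a j v + a j (iter (2 ^ j) s v)) / 2| <= 1 / 2) ->
  forall j v, `|2 ^+ j * (a j (s v) - a j v) - (a 0%N (iter (2 ^ j) s v) - a 0%N v)|
    <= 2 ^+ j * j%:R.
Proof.
move=> H; elim=> [|j IH] v; first by rewrite expr0 mul1r mulr0 subrr normr0.
have /ler_normlP[h1 h2] := H j v; have /ler_normlP[h3 h4] := H j (s v).
have /ler_normlP[h5 h6] := IH v; have /ler_normlP[h7 h8] := IH (iter (2 ^ j) s v).
have e : (2 ^ j.+1 = 2 ^ j + 2 ^ j)%N by rewrite expnS mul2n addnn.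
move: h5 h6 h7 h8; rewrite -iterS -iterD -e => h5 h6 h7 h8.
have {}h3 : - (a j.+1 (s v) - (a j (s v) + a j (iter (2 ^ j).+1 s v)) / 2) <= 1 / 2.
  by rewrite iterSr.
have {}h4 : a j.+1 (s v) - (a j (s v) + a j (iter (2 ^ j).+1 s v)) / 2 <= 1 / 2.
  by rewrite iterSr.
have p0 : (0 : R) < 2 ^+ j by rewrite exprn_gt0.
rewrite exprS -natr1 ler_norml; move: h1 h2 h3 h4 h5 h6 h7 h8.
set x0 := a j v; set x1 := a j (s v); set x2 := a j (iter _ s v); set x3 := a j (iter _.+1 s v).
set y0 := a j.+1 v; set y1 := a j.+1 (s v).
set z0 := a 0%N v; set z1 := a 0%N _; set z2 := a 0%N _; set p := 2 ^+ j in p0 *.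
move=> h1 h2 h3 h4 h5 h6 h7 h8.
have k1 : p * (y1 - y0 - (x1 + x3 - x0 - x2) / 2) <= p * 1.
  by rewrite ler_wpM2l ?(ltW p0)//; lra.
have k2 : p * (y1 - y0 - (x1 + x3 - x0 - x2) / 2) >= p * (- 1).
  by rewrite ler_wpM2l ?(ltW p0)//; lra.
by apply/andP; split; lra.
Qed.

(** Averaging q times in each direction divides the range M of the gradient by
    2^q; the rounding errors add up to a multiple of q, which does not grow with
    the resolution. *)
Lemma exists_smooth_robust (R : realType) (n M q : nat) (B : {set torus n}) (K : nat)
  (u : 'I_3 -> R)
    (g : {ffun torus n -> 'I_M}) : robust B K u g ->
  exists h : {ffun torus n -> 'I_M}, robust B K (fun r => u r + 4 * q%:R) h /\
    forall v, `|natval R h (shift1 v) - natval R h v| <= M%:R / 2 ^+ q + 2 * q%:R /\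
              `|natval R h (shift2 v) - natval R h v| <= M%:R / 2 ^+ q + 2 * q%:R.
Proof.
move=> rg.
have iter1 k (v : torus n) : iter k (@shift1 n) v = (iter k (@ordS n) v.1, v.2).
  by elim: k => [|k IH] /=; [case: v|rewrite IH].
have iter2 k (v : torus n) : iter k (@shift2 n) v = (v.1, iter k (@ordS n) v.2).
  by elim: k => [|k IH] /=; [case: v|rewrite IH].
have natvalM (f : {ffun torus n -> 'I_M}) v w : `|natval R f v - natval R f w| <= M%:R.
  have : (natval R f v < M%:R) by rewrite ltr_nat.
  have : (natval R f w < M%:R) by rewrite ltr_nat.
  have : 0 <= natval R f v by rewrite ler0n.
  have : 0 <= natval R f w by rewrite ler0n.
  by rewrite ler_norml => *; apply/andP; split; lra.
have grad (s : torus n -> torus n) (a : nat -> {ffun torus n -> 'I_M}) :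
    (forall j v, `|natval R (a j.+1) v - (natval R (a j) v + natval R (a j)
      (iter (2 ^ j) s v)) / 2| <= 1 / 2) ->
    forall v, `|natval R (a q) (s v) - natval R (a q) v| <= M%:R / 2 ^+ q + q%:R.
  move=> H v; have := @doubling_gradient R _ s (fun j => natval R (a j)) H q v.
  have p0 : (0 : R) < 2 ^+ q by rewrite exprn_gt0.
  have := natvalM (a 0%N) (iter (2 ^ q) s v) v; rewrite !ler_norml => /andP[h1 h2] /andP[h3 h4].
  rewrite -(ler_pM2l p0) -[X in _ && X](ler_pM2l p0) mulrN mulrDr mulrCA divff ?gt_eqF// mulr1.
  by apply/andP; split; lra.
(* Average along the first direction, then along the second one. *)
pose a1 := fix a1 j := if j is j'.+1 then average (a1 j') (translate (2 ^ j') 0 (a1 j')) else g.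
pose a2 := fix a2 j := if j is j'.+1 then average (a2 j') (translate 0 (2 ^ j')
  (a2 j')) else a1 q.
have step1 j v : `|natval R (a1 j.+1) v - (natval R (a1 j) v + natval R (a1 j) (iter (2 ^ j)
  (@shift1 n) v)) / 2| <= 1 / 2.
  apply: le_trans (natval_average R (a1 j) (translate (2 ^ j) 0 (a1 j)) v).
  by rewrite iter1 [natval R (translate _ _ _) v]/natval ffunE.
have step2 j v : `|natval R (a2 j.+1) v - (natval R (a2 j) v + natval R (a2 j) (iter (2 ^ j)
  (@shift2 n) v)) / 2| <= 1 / 2.
  apply: le_trans (natval_average R (a2 j) (translate 0 (2 ^ j) (a2 j)) v).
  by rewrite iter2 [natval R (translate _ _ _) v]/natval ffunE.
have rob1 j : robust B K (fun r => u r + 2 * j%:R) (a1 j).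
  elim: j => [|j IH] /=; first by rewrite (_ : (fun r => _) = u)//; apply/funext => r;
    rewrite mulr0 addr0.
  rewrite (_ : (fun r => _) = fun r => u r + 2 * j%:R + 2);
    first by apply: robust_average => //; exact: robust_translate.
  by apply/funext => r; rewrite -natr1; ring.
have rob2 j : robust B K (fun r => u r + 2 * q%:R + 2 * j%:R) (a2 j).
  elim: j => [|j IH] /=.
    rewrite (_ : (fun r => _) = fun r => u r + 2 * q%:R); first exact: rob1.
    by apply/funext => r; rewrite mulr0 addr0.
  rewrite (_ : (fun r => _) = fun r => u r + 2 * q%:R + 2 * j%:R + 2);
    first by apply: robust_average => //; exact: robust_translate.
  by apply/funext => r; rewrite -natr1; ring.
have grad1 j v : `|natval R (a2 j) (shift1 v) - natval R (a2 j) v|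
  <= M%:R / 2 ^+ q + q%:R + j%:R.
  elim: j v => [|j IH] v /=; first by rewrite addr0; exact: grad.
  have /ler_normlP[h1 h2] := step2 j v; have /ler_normlP[h3 h4] := step2 j (shift1 v).
  have /ler_normlP[h5 h6] := IH v; have /ler_normlP[h7 h8] := IH (iter (2 ^ j) (@shift2 n) v).
  have comm : iter (2 ^ j) (@shift2 n) (shift1 v) = shift1 (iter (2 ^ j) (@shift2 n) v).
    by rewrite !iter2.
  move: h3 h4; rewrite comm => h3 h4.
  rewrite -natr1 -[average _ _]/(a2 j.+1) ler_norml; apply/andP; split; lra.
exists (a2 q); split.
  by have := rob2 q; rewrite (_ : (fun r => _) = fun r => u r + 4 * q%:R)//; apply/funext => r;
    ring.
move=> v; split; first by have := grad1 q v; lra.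
have := @grad (@shift2 n) a2 step2 v; have : 0 <= q%:R :> R by []. lra.
Qed.

(** The gradient bound of exists_smooth_robust summed along a path. *)
Definition averaged_oscillation (R : realType) (n M q : nat) : R :=
  2 * (n%:R * (M%:R / 2 ^+ q + 2 * q%:R)).

(** A robust configuration stays so after averaging, and is then almost constant;
    replacing its values on B by a constant c costs only a small increase of the
    thresholds. So some constant admits at least the average number of fillings. *)
Lemma card_flat_ge (R : realType) (n M q : nat) (B : {set torus n}) (u : 'I_3 -> R) :
  (0 < n)%N -> (0 < #|admissible n M u|)%N ->
  exists c : 'I_M,
    (#|admissible n M u| <= n ^ 2 * M ^ #|B| *
       #|fiber B (fun r => (u r + 4 * q%:R + 4 * averaged_oscillation R n M q)%R) (fun=> c)|)%N.
Proof.
move=> n0 X0; have [g gX] := card_typical B n0 X0.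
have K0 : (0 < n ^ 2 * M ^ #|B|)%N.
  by have := leq_trans X0 (gX 0%N 0%N); rewrite muln_gt0 => /andP[].
set K := (n ^ 2 * M ^ #|B|)%N in gX K0 *.
(* The quotient is rounded up. *)
pose Q := ((#|admissible n M u| + K.-1) %/ K)%N.
have rob : robust B Q u g.
  move=> i j; rewrite /Q -ltnS ltn_divLR// mulSn [(_ * K)%N]mulnC.
  by have := gX i j; lia.
have [h [rh hgrad]] := exists_smooth_robust q rob.
pose v0 : torus n := (Ordinal n0, Ordinal n0).
exists (h v0).
have near_h v : `|natval R h v - natval R h v0| <= averaged_oscillation R n M q.
  move: hgrad; set k := _ / _ + _ => hgrad.
  have k0 : 0 <= k by rewrite addr_ge0 ?mulr_ge0 ?invr_ge0 ?exprn_ge0.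
  have path1 i a b : `|natval R h (iter i (@ordS n) a, b) - natval R h (a, b)| <= i%:R * k.
    elim: i => [|i IH] /=; first by rewrite subrr normr0 mul0r.
    have [+ _] := hgrad (iter i (@ordS n) a, b); rewrite /shift1 /= => H.
    by apply: (le_trans (ler_distD (natval R h (iter i (@ordS n) a, b)) _ _));
      rewrite -natr1 mulrDl mul1r [leRHS]addrC; exact: lerD.
  have path2 i a b : `|natval R h (a, iter i (@ordS n) b) - natval R h (a, b)| <= i%:R * k.
    elim: i => [|i IH] /=; first by rewrite subrr normr0 mul0r.
    have [_] := hgrad (a, iter i (@ordS n) b); rewrite /shift2 /= => H.
    by apply: (le_trans (ler_distD (natval R h (a, iter i (@ordS n) b)) _ _));
      rewrite -natr1 mulrDl mul1r [leRHS]addrC; exact: lerD.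
  case: v => a b; rewrite /v0.
  have [i iln <-] := iter_ordS_connect (Ordinal n0) a.
  have [j jln <-] := iter_ordS_connect (Ordinal n0) b.
  apply: le_trans (ler_distD (natval R h (Ordinal n0, iter j (@ordS n) (Ordinal n0))) _ _) _.
  rewrite /averaged_oscillation -/k mulr_natl mulr2n; apply: lerD.
    by apply: le_trans (path1 i _ _) _; rewrite ler_wpM2r// ler_nat.
  by apply: le_trans (path2 j _ _) _; rewrite ler_wpM2r// ler_nat.
have XQ : (#|admissible n M u| <= K * Q)%N.
  by rewrite /Q; have := divn_eq (#|admissible n M u| + K.-1) K;
     have := ltn_pmod (#|admissible n M u| + K.-1) K0; rewrite [(_ * K)%N]mulnC; lia.
apply: leq_trans XQ _; rewrite leq_mul2l; apply/orP; right.
have := rh 0%N 0%N; rewrite (_ : translate 0 0 h = h); last by apply/ffunP => -[a b];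
  rewrite ffunE.
move=> /leq_trans; apply.
rewrite -(card_in_imset (@overwrite_fiber_inj R n M B _ h (fun=> h v0))).
apply: subset_leq_card; apply/fintype.subsetP => _ /imsetP[x /fiberP[/admissibleP xA xb] ->].
apply/fiberP; split; last by move=> v vB; rewrite ffunE vB.
apply/admissibleP => v r.
apply: le_trans (le_hessian_near (g := natval R x) (x := averaged_oscillation R n M q) r v _) _.
  move=> w; rewrite {1}/natval ffunE; case: ifP => wB; last first.
    rewrite subrr normr0; exact: le_trans (near_h w).
  by have := near_h w; rewrite distrC /natval -(xb _ wB).
by rewrite lerD2r; exact: xA.
Qed.

(** * Gluing tiles along constant frames *)

(** The Hessian at a vertex only sees a 3 by 3 window, which may be read off in a
    torus of another side. *)
Lemma hessian_local (R : realType) (n m : nat) (r : 'I_3) (f : torus n -> R) (g : torus m -> R)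
    (a b : 'I_n) (a' b' : 'I_m) :
  (forall i j, (i <= 2)%N -> (j <= 2)%N ->
     f (iter i (@ordS n) a, iter j (@ordS n) b)
       = g (iter i (@ordS m) a', iter j (@ordS m) b')) ->
  hessian r f (a, b) = hessian r g (a', b').
Proof.
move=> fg; rewrite /hessian; case: (nat_of_ord r) => [|[|?]].
- by have /= -> := fg 0%N 0%N isT isT; have /= -> := fg 2%N 1%N isT isT;
    have /= -> := fg 1%N 0%N isT isT; have /= -> := fg 1%N 1%N isT isT.
- by have /= -> := fg 0%N 0%N isT isT; have /= -> := fg 0%N 1%N isT isT;
    have /= -> := fg 1%N 0%N isT isT; have /= -> := fg 1%N 1%N isT isT.
- by have /= -> := fg 0%N 0%N isT isT; have /= -> := fg 1%N 2%N isT isT;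
    have /= -> := fg 0%N 1%N isT isT; have /= -> := fg 1%N 1%N isT isT.
Qed.

(** Tiles of side t + 3 are placed at the multiples of t + 3 up to k (t + 3). In
    each of them the first t coordinates are live, and the last three form the
    frame; coordinates beyond the k-th tile are dead. *)
Definition live (k t x : nat) : bool := (x < k * t.+3)%N && (x %% t.+3 < t)%N.

(** Seen from a window, x either is the live coordinate w of tile i, or is dead
    like w. *)
Definition in_tile (k t i w x : nat) : bool :=
  if live k t x then (x %/ t.+3 == i)%N && (x %% t.+3 == w)%N else (t <= w)%N.

Lemma in_tile_same (k t i b : nat) : (i < k)%N -> (b < t.+3)%N ->
  in_tile k t i b (i * t.+3 + b).
Proof.
move=> ik bt; have h : (i * t.+3 + b < k * t.+3)%N by nia.
rewrite /in_tile /live h modnMDl divnMDl// modn_small// divn_small// addn0 !eqxx /=.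
by case: ltnP.
Qed.

Lemma in_tile_dead (k t i w j b : nat) : (t <= b < t.+3)%N -> (t <= w)%N ->
  in_tile k t i w (j * t.+3 + b).
Proof.
move=> /andP[tb bt] tw; rewrite /in_tile /live modnMDl modn_small//.
by rewrite [(b < t)%N]ltnNge tb andbF.
Qed.

Lemma in_tile_filler (k t i w x : nat) : (k * t.+3 <= x)%N -> (t <= w)%N -> in_tile k t i w x.
Proof.
by move=> kx tw; rewrite /in_tile /live ltnNge kx.
Qed.

(** A window of width three meets the live part of at most one tile. A frame of
    width three, and not two, is needed to match the windows without live
    coordinate, such as those after the last tile, with a window of the small
    torus. *)
Lemma exists_tile (k t n x : nat) : (0 < k)%N -> (k * t.+3 <= n)%N -> (x < n)%N ->
  exists i w, [/\ (i < k)%N, (w < t.+3)%N &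
    forall a, (a <= 2)%N -> in_tile k t i ((w + a) %% t.+3) ((x + a) %% n)].
Proof.
move=> k0 kn xn.
(* S is the start of the next tile, which is tile j, or the tile 0 when S = n;
   everything between x and S is dead. *)
have main S j : (x < S)%N -> (S < n)%N || (S == n) -> (j < k)%N -> (S %% n = j * t.+3)%N ->
    (forall y i w, (x <= y < S)%N -> (t <= w)%N -> in_tile k t i w y) ->
    exists i w, [/\ (i < k)%N, (w < t.+3)%N &
      forall a, (a <= 2)%N -> in_tile k t i ((w + a) %% t.+3) ((x + a) %% n)].
  move=> xS Sn jk Sj dead.
  have [d3|d2] := leqP 3 (S - x).
    exists 0%N, t; split => //; first by lia.
    move=> a a2; rewrite !modn_small//; [|lia|lia].
    by apply: dead; lia.
  exists j, (t.+3 - (S - x))%N; split => //; first by lia.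
  move=> a a2; have [ad|da] := ltnP a (S - x).
    rewrite !modn_small//; [|lia|lia].
    by apply: dead; lia.
  have -> : ((t.+3 - (S - x) + a) = t.+3 + (a - (S - x)))%N by lia.
  have -> : ((x + a) = S + (a - (S - x)))%N by lia.
  rewrite modnDl -[((S + _) %% n)%N]modnDml Sj.
  have b2 : (a - (S - x) <= 1)%N by lia.
  move: (a - (S - x))%N b2 => b b2.
  have jn : (j * t.+3 + t.+3 <= n)%N by nia.
  rewrite !modn_small//; [|lia|lia].
  by apply: in_tile_same => //; lia.
have [xk|kx] := ltnP x (k * t.+3); last first.
  apply: (main n 0%N) => //; first by rewrite eqxx orbT.
  - by rewrite modnn.
  - by move=> y i w /andP[xy _]; apply: in_tile_filler; lia.
have xE := divn_eq x t.+3; set i0 := (x %/ t.+3)%N in xE; set b := (x %% t.+3)%N in xE.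
have bt : (b < t.+3)%N by rewrite ltn_mod.
have i0k : (i0 < k)%N by rewrite ltn_divLR.
have i0n : (i0 * t.+3 + t.+3 <= k * t.+3)%N by nia.
have [bt'|tb] := leqP b t.
  exists i0, b; split => // a a2; rewrite !modn_small//; [|lia|lia].
  by rewrite xE -addnA; apply: in_tile_same => //; lia.
have dead1 y i w : (x <= y < i0 * t.+3 + t.+3)%N -> (t <= w)%N -> in_tile k t i w y.
  move=> xy tw; have -> : (y = i0 * t.+3 + (y - i0 * t.+3))%N by lia.
  by apply: in_tile_dead => //; lia.
have [i1k|ki1] := ltnP i0.+1 k.
  apply: (main (i0 * t.+3 + t.+3)%N i0.+1) => //; first by lia.
  - by apply/orP; left; nia.
  - by rewrite modn_small; nia.
have ek : (k * t.+3 = i0 * t.+3 + t.+3)%N by rewrite (_ : k = i0.+1) ?mulSn 1?addnC//; lia.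
apply: (main n 0%N) => //; first by rewrite eqxx orbT.
- by rewrite modnn.
- move=> y i w xy tw; have [yk|ky] := ltnP y (k * t.+3); last exact: in_tile_filler.
  by apply: dead1 => //; lia.
Qed.

Lemma card_live (k t n : nat) : (k * t.+3 <= n)%N -> #|[set x : 'I_n | live k t x]| = (k * t)%N.
Proof.
move=> kn.
have lt_n (p : 'I_k * 'I_t) : (p.1 * t.+3 + p.2 < n)%N.
  by have := ltn_ord p.1; have := ltn_ord p.2; nia.
pose f (p : 'I_k * 'I_t) : 'I_n := Ordinal (lt_n p).
have fi : injective f.
  move=> [i a] [j b] /(congr1 val) /= E.
  have ha : (a < t.+3)%N by have := ltn_ord a; lia.
  have hb : (b < t.+3)%N by have := ltn_ord b; lia.
  have e2 : a = b :> nat by have := congr1 (modn^~ t.+3) E; rewrite !modnMDl !modn_small.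
  have e1 : i = j :> nat by move: E; rewrite e2 => /addIn /eqP; rewrite eqn_pmul2r// => /eqP.
  by rewrite (val_inj e1) (val_inj e2).
rewrite -[k in RHS]card_ord -[t in RHS]card_ord -card_prod -cardsT -(card_imset _ fi).
apply: eq_card => x; rewrite inE; apply/idP/imsetP => [/andP[xk xt]|[[i a] _ ->]].
  have ik : (x %/ t.+3 < k)%N by rewrite ltn_divLR.
  exists (Ordinal ik, Ordinal xt) => //; apply/val_inj => /=; exact: divn_eq.
have ha : (a < t.+3)%N by have := ltn_ord a; lia.
rewrite /live /= modnMDl modn_small// ltn_ord andbT.
by have := ltn_ord i; nia.
Qed.

Definition frame (t : nat) : {set torus t.+3} := [set v : torus t.+3 | (t <= v.1)%N || (t
  <= v.2)%N].

Definition live_vertices (n k t : nat) : {set torus n} := [set v : torus n | live k t v.1 &&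
  live k t v.2].

Lemma card_live_vertices (n k t : nat) : (k * t.+3 <= n)%N ->
  #|live_vertices n k t| = ((k * t) ^ 2)%N.
Proof.
move=> kn; rewrite -mulnn -{1}(card_live kn) -(card_live kn) -cardsX.
by apply: eq_card => -[x y]; rewrite !inE.
Qed.

Lemma card_frame (t : nat) : #|frame t| = (t.+3 ^ 2 - t ^ 2)%N.
Proof.
have kn : (1 * t.+3 <= t.+3)%N by rewrite mul1n.
rewrite (_ : frame t = ~: live_vertices t.+3 1 t).
  by rewrite cardsCs finset.setCK card_live_vertices// mul1n card_torus.
apply/finset.setP => v; rewrite !inE /live !mul1n !ltn_ord !modn_small//=.
by rewrite negb_and -!leqNgt.
Qed.

Definition glue (n k t M : nat) (c : 'I_M)
    (H : 'I_k.+1 * 'I_k.+1 -> {ffun torus t.+3 -> 'I_M}) (v : torus n) : 'I_M :=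
  if v \in live_vertices n k.+1 t
  then H (inord (v.1 %/ t.+3), inord (v.2 %/ t.+3)) (inord (v.1 %% t.+3), inord (v.2 %% t.+3))
  else c.

(** Every window of the large torus looks like a window of a single tile, where
    the constant frame takes the place of the other tiles. *)
Lemma hessian_glue (R : realType) (n k t M : nat) (c : 'I_M) (u : 'I_3 -> R)
    (H : 'I_k.+1 * 'I_k.+1 -> {ffun torus t.+3 -> 'I_M}) (r : 'I_3) (v : torus n) :
  (k.+1 * t.+3 <= n)%N -> (forall p, H p \in fiber (frame t) u (fun=> c)) ->
  hessian r (fun w => (glue c H w)%:R) v <= u r.
Proof.
move=> kn HF; case: v => x y.
have [i [w1 [ik w1t tile1]]] := exists_tile (isT : (0 < k.+1)%N) kn (ltn_ord x).
have [j [w2 [jk w2t tile2]]] := exists_tile (isT : (0 < k.+1)%N) kn (ltn_ord y).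
have /fiberP[/admissibleP HA Hc] := HF (Ordinal ik, Ordinal jk).
rewrite (_ : hessian r _ _ = hessian r (natval R (H (Ordinal ik, Ordinal jk)))
  (Ordinal w1t, Ordinal w2t)).
  exact: HA.
apply: hessian_local => a b a2 b2.
have := tile2 b b2; have := tile1 a a2.
rewrite -(iter_ordS a x) -(iter_ordS b y) -(iter_ordS a (Ordinal w1t)) -(iter_ordS b (Ordinal
  w2t)).
set x' := iter a _ x; set y' := iter b _ y; set a' := iter a _ _; set b' := iter b _ _.
rewrite /natval /in_tile /glue inE /=.
case: ifP => [_ /andP[/eqP xi /eqP xa]|_ ta]; last by rewrite Hc // inE /= ta.
case: ifP => [_ /andP[/eqP yj /eqP yb]|_ tb]; last by rewrite Hc // inE /= tb orbT.
rewrite xi xa yj yb /=; congr (nat_of_ord (H (_, _) (_, _)))%:R; apply/val_inj => /=;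
  exact: inordK.
Qed.

(** The k^2 tiles are filled independently with one and the same constant frame,
    and every dead vertex may in addition be raised by any amount up to p: the
    dead coordinates have to contribute to the dimension too. *)
Lemma card_glue (R : realType) (n k t M p : nat) (c : 'I_M) (u : 'I_3 -> R) :
  (k.+1 * t.+3 <= n)%N ->
  (#|fiber (frame t) u (fun=> c)| ^ (k.+1 ^ 2) * p.+1 ^ (n ^ 2 - (k.+1 * t) ^ 2)
   <= #|admissible n (M + p) (fun r => (u r + 2 * p%:R)%R)|)%N.
Proof.
move=> kn; set F := fiber _ _ _; set L := live_vertices n k.+1 t.
pose S1 := [set H : {ffun 'I_k.+1 * 'I_k.+1 -> {ffun torus t.+3 ->
  'I_M}} | H \in ffun_on (mem F)].
pose S2 := [set e : {ffun torus n -> 'I_p.+1} | e \in pffun_on ord0 (mem (~: L)) predT].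
have card1 : #|S1| = (#|F| ^ (k.+1 ^ 2))%N.
  by rewrite cardsE card_ffun_on card_prod card_ord mulnn.
have card2 : #|S2| = (p.+1 ^ (n ^ 2 - (k.+1 * t) ^ 2))%N.
  by rewrite cardsE card_pffun_on card_ord cardsCs finset.setCK card_live_vertices// card_torus.
rewrite -card1 -card2 -cardsX.
have bound (H : 'I_k.+1 * 'I_k.+1 -> {ffun torus t.+3 -> 'I_M}) (e : {ffun torus n ->
  'I_p.+1}) v :
    (glue c H v + e v < M + p)%N.
  by have := ltn_ord (glue c H v); have := ltn_ord (e v); lia.
pose Phi (q : {ffun 'I_k.+1 * 'I_k.+1 -> {ffun torus t.+3 -> 'I_M}} * {ffun torus n ->
  'I_p.+1}) :
  {ffun torus n -> 'I_(M + p)} := [ffun v => Ordinal (bound q.1 q.2 v)].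
rewrite -(card_in_imset (f := Phi)).
  apply: subset_leq_card; apply/fintype.subsetP => g /imsetP[[H e]].
  rewrite finset.in_setX inE => /andP[/ffun_onP HF _] ->.
  apply/admissibleP => v r.
  rewrite (_ : natval R _ = fun w => (glue c H w)%:R + (e w)%:R); last first.
    by apply/funext => w; rewrite /natval ffunE /= natrD.
  rewrite hessianD; apply: lerD; first exact: hessian_glue.
  by apply: hessian_le_nonneg => w; rewrite ?ler0n// ler_nat -ltnS.
have S1P H : H \in S1 -> forall q, H q \in F by rewrite /S1 inE => /ffun_onP.
have S2P e : e \in S2 -> ord0.-support e \subset mem (~: L) by rewrite /S2 inE => /pffun_onP[].
move=> [H e] [H' e']; rewrite !finset.in_setX =>
  /andP[/S1P HF /S2P eL] /andP[/S1P HF' /S2P eL'] /ffunP E.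
have {}E v : (glue c H v + e v = glue c H' v + e' v)%N.
  by have := congr1 val (E v); rewrite !ffunE.
have e0 (f : {ffun torus n -> 'I_p.+1}) : (ord0.-support f \subset mem (~: L)) ->
    forall v, v \in L -> f v = ord0.
  move=> /fintype.subsetP fL v vL; apply/eqP; apply: contraLR vL => fv.
  by have := fL v fv; rewrite !inE.
apply: congr2.
  apply/ffunP => -[i j]; apply/ffunP => -[a b].
  have [abB|] := boolP ((a, b) \in frame t).
    by have /fiberP[_ ->//] := HF (i, j); have /fiberP[_ ->//] := HF' (i, j).
  rewrite inE /= negb_or -!ltnNge => /andP[at_ bt].
  have tile_lt (i0 : 'I_k.+1) (a0 : 'I_t.+3) : (i0 * t.+3 + a0 < k.+1 * t.+3)%N.
    by have := ltn_ord a0; have := ltn_ord i0; nia.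
  pose v : torus n := (Ordinal (leq_trans (tile_lt i a) kn),
    Ordinal (leq_trans (tile_lt j b) kn)).
  have vL : v \in L.
    by rewrite inE /live /= !tile_lt !modnMDl !modn_small// at_ bt.
  have := E v; rewrite (e0 _ eL v vL) (e0 _ eL' v vL) !addn0 /glue vL.
  rewrite /v /= !divnMDl// !modnMDl !divn_small// !modn_small// !addn0 !inord_val.
  by move=> ?; exact/val_inj.
apply/ffunP => v; have [vL|vL] := boolP (v \in L).
  by rewrite (e0 _ eL v vL) (e0 _ eL' v vL).
by have := E v; rewrite /glue (negPf vL) => /addnI ?; exact/val_inj.
Qed.

Local Open Scope classical_set_scope.

(** * Lebesgue measure on tuples *)

Definition pcons (R : realType) (k : nat)
  (p : measurableTypeR R * k.-tuple (measurableTypeR R)) :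
  k.+1.-tuple (measurableTypeR R) := [tuple of p.1 :: p.2].

Lemma measurable_pcons (R : realType) (k : nat) :
  measurable_fun setT (@pcons R k).
Proof. by apply: measurable_cons; [exact: measurable_fst|exact: measurable_snd]. Qed.

(** Sigma-finiteness is carried along the induction because the product with the
    next factor requires it. *)
Lemma lebesgue_tuple_is_measure (R : realType) (k : nat) :
  exists m : {sigma_finite_measure set (k.-tuple (measurableTypeR R)) -> \bar R},
    lebesgue_tuple (R := R) (k := k) = m.
Proof.
elim: k => [|k [m mE]].
  by exists (dirac ([tuple] : 0.-tuple (measurableTypeR R))).
pose mu : {measure set (k.+1.-tuple (measurableTypeR R)) -> \bar R} :=
  (@measure_function_pushforward__canonical__measure_function_Measure _ _ _ _ _
    ((@lebesgue_measure R) \x m)%E _ (@measurable_pcons R k)).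
have sf : sigma_finite setT (mu : set _ -> \bar R).
  have /sigma_finiteP[F [TF ndF Foo]] := sigma_finiteT (@lebesgue_measure R).
  have /sigma_finiteP[G [TG ndG Goo]] := sigma_finiteT m.
  pose E n := [set t : k.+1.-tuple (measurableTypeR R) | F n (thead t) /\ G n [tuple of behead
    t]].
  have EFG n : @pcons R k @^-1` E n = F n `*` G n.
    by apply/seteqP; split => -[a b] /= []; rewrite /= ?theadE => Fa Gb; split => //=;
      move: Gb; congr (G n _); exact/val_inj.
  exists E.
    apply/seteqP; split => // t _.
    have [i _ Fi] : (\bigcup_i F i) (thead t) by rewrite -TF.
    have [j _ Gj] : (\bigcup_i G i) [tuple of behead t] by rewrite -TG.
    exists (maxn i j) => //; split.
      by move: (thead t) Fi; exact/subsetPset/ndF/leq_maxl.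
    by move: ([tuple of behead t]) Gj; exact/subsetPset/ndG/leq_maxr.
  move=> n; have [mF Fn] := Foo n; have [mG Gn] := Goo n; split.
    rewrite (_ : E n = (fun t : k.+1.-tuple (measurableTypeR R) => tnth t ord0) @^-1` F n `&`
      (fun t : k.+1.-tuple (measurableTypeR R) => [tuple of behead t]) @^-1` G n); last first.
      by [].
    apply: measurableI; rewrite -[X in measurable X]setTI.
      exact: measurable_tnth.
    exact: measurable_behead.
  rewrite /mu /= /pushforward EFG product_measure1E// lte_mul_pinfty// ge0_fin_numE//.
exists (HB.pack_for {sigma_finite_measure set (k.+1.-tuple (measurableTypeR R)) ->
  \bar R} (mu : set _ -> \bar R) (Measure.on mu)
  (Measure_isSigmaFinite.Build _ _ _ _ sf)).
by rewrite /= mE.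
Qed.

Definition cube (R : realType) (k : nat) (a : 'I_k -> R)
  (l : R) : set (k.-tuple (measurableTypeR R)) :=
  [set t | forall i, a i <= tnth t i < a i + l].

Lemma measurable_forall d (T : measurableType d) (I : finType) (P : I -> set T) :
  (forall i, measurable (P i)) -> measurable [set t | forall i, P i t].
Proof.
move=> mP; rewrite (_ : mkset _ = \big[setI/setT]_(i : I) P i).
  exact: bigsetI_measurable.
rewrite -bigcap_seq; apply/seteqP; split => t /= H i; first by move=> _; exact: H.
by apply: H; rewrite /= mem_index_enum.
Qed.

Lemma measurable_cube (R : realType) (k : nat) (a : 'I_k -> R) (l : R) :
  measurable (cube a l).
Proof.
rewrite (_ : cube a l = [set t | forall i : 'I_k,
    ((fun t : k.-tuple (measurableTypeR R) => tnth t i) @^-1` `[a i, a i + l[%classic) t]).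
  apply: measurable_forall => i; rewrite -[X in measurable X]setTI.
  by apply: measurable_tnth => //; exact: measurable_itv.
by apply/seteqP; split => t /= H i; have := H i; rewrite in_itv.
Qed.

Lemma lebesgue_tuple_cube (R : realType) (k : nat) (a : 'I_k -> R) (l : R) :
  0 < l -> lebesgue_tuple (cube a l) = (l ^+ k)%:E.
Proof.
move=> l0; elim: k a => [|k IH] a.
  rewrite /= diracE expr0; case: (boolP (_ \in _)) => // /negP[].
  by rewrite inE => -[].
have [m mE] := lebesgue_tuple_is_measure R k.
rewrite /= /pushforward mE.
have -> : (fun p : measurableTypeR R * k.-tuple (measurableTypeR R) =>
  [tuple of p.1 :: p.2]) @^-1` cube a l =
   `[a ord0, a ord0 + l[%classic `*` cube (fun i => a (lift ord0 i)) l.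
  apply/seteqP; split => -[x t] /=.
    move=> H; split; first by have := H ord0; rewrite /= in_itv.
    by move=> i; have := H (lift ord0 i); rewrite tnthS.
  rewrite in_itv /= => -[H0 H] i.
  case: (unliftP ord0 i) => [j ->|->]; last by [].
  by rewrite tnthS; exact: H.
rewrite product_measure1E//; first last.
- exact: measurable_cube.
- rewrite -mE IH /= lebesgue_measure_itv /= lte_fin ltrDl l0 -EFinB -EFinM exprS.
  by rewrite addrAC subrr add0r.
Qed.

(** The determinant of the block matrix with blocks 1, -v, u and 1, computed by
    eliminating either of the off-diagonal blocks. *)
Lemma det_rank_one_update (F : comNzRingType) (k : nat) (u : 'cV[F]_k) (v : 'rV[F]_k) :
  \det (1%:M + u *m v) = 1 + (v *m u) 0 0.
Proof.
have E1 : block_mx (1%:M : 'M[F]_1) (- v) u 1%:M =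
   block_mx 1%:M 0 u 1%:M *m block_mx 1%:M (- v) 0 (1%:M + u *m v).
  rewrite mulmx_block !mul1mx !mul0mx !mulmx1 !addr0 mulmxN.
  by rewrite addrC addrK.
have E2 : block_mx (1%:M : 'M[F]_1) (- v) u 1%:M =
   block_mx (1%:M + v *m u) (- v) 0 1%:M *m block_mx 1%:M 0 u 1%:M.
  by rewrite mulmx_block !mulmx1 !mulmx0 !mul1mx !add0r mulNmx addrK.
have := congr1 (fun A => \det A) (etrans (esym E1) E2).
rewrite !det_mulmx !det_lblock !det_ublock !det1 !mul1r !mulr1 => ->.
by rewrite det_mx11 !mxE.
Qed.

Lemma sum_rank_indicator (R : realType) (T : finType) (k : nat) : (k < #|T|)%N ->
  \sum_(v : T) (enum_rank v == k :> nat)%:R = 1 :> R.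
Proof.
move=> kT; rewrite (bigD1 (enum_val (Ordinal kT)))//= enum_valK eqxx big1 ?addr0// => v vk.
case: eqP => // vkE; case/eqP: vk; apply: enum_rank_inj; rewrite enum_valK.
exact/val_inj.
Qed.

(** The Gram matrix of the vectors e_i - e_0 is the identity plus the all-ones
    matrix. *)
Lemma det_gram_mean0 (R : realType) (T : finType) : (0 < #|T|)%N ->
  \det (gram (@mean0_basis R T)) = #|T|%:R.
Proof.
move=> T0.
have -> : gram (@mean0_basis R T) = 1%:M + (const_mx 1 : 'cV[R]_(#|T|.-1)) *m const_mx 1.
  apply/matrixP => i j; rewrite !mxE big_ord_recl big_ord0 !mxE mulr1 addr0.
  have iT (l : 'I_#|T|.-1) : (l.+1 < #|T|)%N by have := ltn_ord l; lia.
  have -> : (i == j)%:R = \sum_(v : T) (i == j)%:R * (enum_rank v == i.+1 :> nat)%:R :> R.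
    by rewrite -mulr_sumr sum_rank_indicator ?mulr1.
  rewrite -[X in _ = _ + X](sum_rank_indicator R T0) -big_split /=; apply: eq_bigr => v _;
    rewrite /mean0_basis.
  case: (eqVneq (enum_rank v : nat) 0%N) => [->|v0] /=.
    by rewrite !sub0r mulrNN mulr0 add0r mulr1.
  rewrite !subr0 addr0.
  case: (eqVneq (enum_rank v : nat) i.+1) => [->|_] /=; last by rewrite mul0r mulr0.
  by rewrite mul1r mulr1 eqSS.
rewrite det_rank_one_update mxE (eq_bigr (fun=> 1)); last by move=> i _; rewrite !mxE mulr1.
rewrite sumr_const card_ord -[in RHS](prednK T0) -natr1 addrC.
by [].
Qed.

(** * Volume and integer points *)

Lemma measure_le_cover d (X : measurableType d) (R : realType)
    (m : {measure set X -> \bar R}) (I : choiceType) (D : seq I) (F : I ->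
      set X) (A : set X) (c : R) :
  uniq D -> measurable A -> (forall i, measurable (F i)) -> (forall i, m (F i) = c%:E) ->
  (forall x, A x -> exists2 i, i \in D & F i x) -> (m A <= (c * (size D)%:R)%:E)%E.
Proof.
move=> uD mA mF mFc AF.
apply: (@le_trans _ _ (\sum_(i \in [set` D]) m (F i))%E).
  apply: content_sub_fsum; [exact: finite_seq|by []|by []|].
  by move=> x /AF[i iD Fix]; exists i.
rewrite -fsbig_seq// (eq_bigr (fun=> c%:E)) => [|i _]; last exact: mFc.
by rewrite big_const_seq count_predT iter_addr adde0 -[X in (X
  <= _)%E]/(c%:E *+ size D)%E -EFin_natmul mulr_natr.
Qed.

Lemma measure_ge_packing d (X : measurableType d) (R : realType)
    (m : {measure set X -> \bar R}) (I : choiceType) (D : seq I) (F : I ->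
      set X) (A : set X) (c : R) :
  uniq D -> measurable A -> (forall i, measurable (F i)) -> (forall i, m (F i) = c%:E) ->
  (forall i j x, F i x -> F j x -> i = j) ->
  (forall i x, i \in D -> F i x -> A x) -> ((c * (size D)%:R)%:E <= m A)%E.
Proof.
move=> uD mA mF mFc tF FA.
apply: (@le_trans _ _ (\sum_(i \in [set` D]) m (F i))%E).
  rewrite -fsbig_seq// (eq_bigr (fun=> c%:E)) => [|i _]; last exact: mFc.
  by rewrite big_const_seq count_predT iter_addr adde0 -[X in (_
    <= X)%E]/(c%:E *+ size D)%E -EFin_natmul mulr_natr.
rewrite -measure_fin_bigcup; first last.
- by move=> i _; exact: mF.
- by move=> i j _ _ [x [Fi Fj]]; exact: tF Fi Fj.
- exact: finite_seq.
apply: le_measure; rewrite ?inE//.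
  by apply: fin_bigcup_measurable => //; exact: finite_seq.
by move=> x [i iD Fi]; exact: FA iD Fi.
Qed.

Lemma lincomb_rankS (R : realType) (T : finType) (x : #|T|.-1.-tuple R) (i : 'I_#|T|.-1)
  (v : T) :
  enum_rank v = i.+1 :> nat -> lincomb (@mean0_basis R T) x v = tnth x i.
Proof.
move=> vi; rewrite /lincomb (bigD1 i)//= /mean0_basis vi eqxx subr0 mulr1.
rewrite big1 ?addr0// => j ji.
by rewrite eqSS val_eqE eq_sym (negPf ji) subr0 mulr0.
Qed.

Lemma exists_rankS (T : finType) (i : 'I_#|T|.-1) : exists v : T, enum_rank v = i.+1 :> nat.
Proof.
have h : (i.+1 < #|T|)%N by have := ltn_ord i; lia.
by exists (enum_val (Ordinal h)); rewrite enum_valK.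
Qed.

Lemma lincomb_mean0_inj (R : realType) (T : finType) (x y : #|T|.-1.-tuple R) :
  lincomb (@mean0_basis R T) x = lincomb (@mean0_basis R T) y -> x = y.
Proof.
move=> xy; apply: eq_from_tnth => i; have [v vi] := exists_rankS i.
by rewrite -(lincomb_rankS x vi) -(lincomb_rankS y vi) xy.
Qed.

Lemma sum_lincomb_mean0 (R : realType) (T : finType) (x : #|T|.-1.-tuple R) :
  \sum_v lincomb (@mean0_basis R T) x v = 0.
Proof.
apply/mean0_basisP; exists x; split => // y /esym; exact: lincomb_mean0_inj.
Qed.

(** The vertex of rank 0 sees the errors of all coordinates. *)
Lemma dist_lincomb_mean0 (R : realType) (T : finType) (x y : #|T|.-1.-tuple R) (a : R) (v : T) :
  (forall i, `|tnth x i - tnth y i| <= a) ->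
  `|lincomb (@mean0_basis R T) x v - lincomb (@mean0_basis R T) y v| <= #|T|.-1%:R * a.
Proof.
move=> xya; rewrite /lincomb -sumrB; apply: le_trans (ler_norm_sum _ _ _) _.
rewrite (_ : _%:R * a = \sum_(i < #|T|.-1) a); last by rewrite sumr_const card_ord mulr_natl.
apply: ler_sum => i _; rewrite -mulrBl normrM -[leRHS]mulr1.
apply: ler_pM => //; rewrite /mean0_basis.
by do 2 case: (_ == _) => /=; rewrite ?subrr ?subr0 ?sub0r ?normrN ?normr1 ?normr0.
Qed.

Lemma measurable_lincomb (R : realType) (T : finType) (k : nat) (B : 'I_k -> T -> R) (v : T) :
  measurable_fun setT (fun x : k.-tuple (measurableTypeR R) => lincomb B x v).
Proof.
apply: measurable_sum => i; apply: measurable_realfun.measurable_funM => //;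
  exact: measurable_tnth.
Qed.

(** The polytope in the coordinates of the basis of the mean-zero functions. Its
    vertices of rank i + 1 carry the i-th coordinate, and the vertex of rank 0
    carries minus the sum of all coordinates. *)
Definition coord_polytope (R : realType) (n : nat)
  (s : 'rV[R]_3) : set (#|torus n|.-1.-tuple (measurableTypeR R)) :=
  lincomb (@mean0_basis R (torus n)) @^-1` hessian_polytope n s.

Arguments coord_polytope {R} n s.

Lemma measurable_coord_polytope (R : realType) (n : nat) (s : 'rV[R]_3) :
  measurable (coord_polytope n s).
Proof.
rewrite (_ : coord_polytope n s = [set x | forall v r,
   hessian r (lincomb (@mean0_basis R (torus n)) x) v <= s 0 r]); last first.
  apply/seteqP; split => x /=; first by case.
  by move=> H; split => //; exact: sum_lincomb_mean0.
apply: measurable_forall => v; apply: measurable_forall => r.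
have [a [b [c [d E]]]] := hessianE R r v.
rewrite [X in measurable X](_ : _ = (fun x =>
  hessian r (lincomb (@mean0_basis R (torus n)) x) v) @^-1` `]-oo, s 0 r]); last first.
  by apply/seteqP; split => x /=; rewrite in_itv.
rewrite -[X in measurable X]setTI.
under eq_fun do rewrite E.
suff mf : measurable_fun setT (fun x : #|torus n|.-1.-tuple (measurableTypeR R) =>
  lincomb (@mean0_basis R (torus n)) x a + lincomb (@mean0_basis R (torus n)) x b - lincomb
    (@mean0_basis R (torus n)) x c - lincomb (@mean0_basis R (torus n)) x d).
  by apply: mf => //; exact: measurable_itv.
by apply: measurable_realfun.measurable_funB; [apply: measurable_realfun.measurable_funB;
  [apply: measurable_realfun.measurable_funD|]|]; exact: measurable_lincomb.
Qed.

Lemma mean0_basis_int (R : realType) (T : finType) (i : 'I_#|T|.-1) (v : T) :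
  (mean0_basis i v : R) \is a Num.int.
Proof. by rewrite /mean0_basis rpredB// intr_nat// natr_nat. Qed.

Lemma lincomb_mean0Z (R : realType) (T : finType) (x y : #|T|.-1.-tuple R) (a : R) :
  (forall i, tnth y i = a * tnth x i) ->
  forall v, lincomb (@mean0_basis R T) y v = a * lincomb (@mean0_basis R T) x v.
Proof.
by move=> yx v; rewrite /lincomb mulr_sumr; apply: eq_bigr => i _; rewrite yx mulrA.
Qed.

Lemma exists_natval (R : realType) (n M : nat) (f : torus n -> R) :
  (forall v, f v \is a Num.int) -> (forall v, 0 <= f v) -> (forall v, f v < M%:R) ->
  exists g : {ffun torus n -> 'I_M}, forall v, natval R g v = f v.
Proof.
move=> fint f0 fM.
have fn v : f v \is a Num.nat by rewrite natrEint fint f0.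
have tM v : (Num.truncn (f v) < M)%N by rewrite -(ltr_nat R) truncnK.
by exists [ffun v => Ordinal (tM v)] => v; rewrite /natval ffunE /= truncnK.
Qed.

(** The cubes of side 1/L that meet the polytope cover it. Their corners are,
    after scaling by L, integer functions that are admissible up to a rounding
    error bounded by 4 n^2, and adding M1 constants to each of them accounts for
    the direction orthogonal to the mean-zero functions. *)
Lemma coord_polytope_le_count (R : realType) (n : nat) (s : 'rV[R]_3) (L : R)
    (u : 'I_3 -> R) (M0 M1 M : nat) :
  (0 < n)%N -> 0 < L -> (forall r, 0 <= s 0 r) ->
  L * (2 * (n%:R ^+ 2 * \sum_r s 0 r)) <= M0%:R ->
  (2 * M0 + 2 * #|torus n| + M1 + 2 <= M)%N ->
  (forall r, L * s 0 r + 4 * #|torus n|%:R <= u r) ->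
  exists2 Y : nat, (Y * M1 <= #|admissible n M u|)%N &
    (lebesgue_tuple (coord_polytope n s) <= (L^-1 ^+ #|torus n|.-1 * Y%:R)%:E)%E.
Proof.
move=> n0 L0 s0 LM0 MM su.
set d := #|torus n|.-1.
(* The cubes are indexed by their lowest corners, shifted by M0 to be
   nonnegative. *)
pose I := {ffun 'I_d -> 'I_(2 * M0 + 1)}.
pose corner (y : I) (i : 'I_d) : R := ((y i : nat)%:R - M0%:R) / L.
pose F (y : I) := cube (corner y) L^-1.
pose good (y : I) := `[< exists2 x, F y x & coord_polytope n s x >].
have close y x i : F y x -> `|L * tnth x i - ((y i : nat)%:R - M0%:R)| <= 1.
  move=> /(_ i); rewrite /corner => /andP[H1 H2].
  have {}H1 : (y i : nat)%:R - M0%:R <= L * tnth x i by rewrite mulrC -ler_pdivrMr.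
  have {}H2 : L * tnth x i < (y i : nat)%:R - M0%:R + 1.
    by move: H2; rewrite -[X in _ + X]mul1r -mulrDl ltr_pdivlMr// [_ * L]mulrC.
  by rewrite ler_norml; apply/andP; split; lra.
exists #|[pred y | good y]|; last first.
  have [m mE] := lebesgue_tuple_is_measure R d; rewrite mE -/d cardE.
  apply: (measure_le_cover (F := F)).
  - exact: enum_uniq.
  - exact: measurable_coord_polytope.
  - by move=> y; exact: measurable_cube.
  - by move=> y; have := @lebesgue_tuple_cube R d (corner y) L^-1; rewrite mE invr_gt0; apply.
  - move=> x Px.
    have xb i : `|L * tnth x i| <= M0%:R.
      have [v vi] := exists_rankS i.
      rewrite -(lincomb_rankS x vi) normrM gtr0_norm//; apply: le_trans LM0.
      rewrite ler_pM2l//; case: Px => x0 xs; apply: hessian_mean0_bound => //.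
    have tx i : (Num.truncn (L * tnth x i + M0%:R) < 2 * M0 + 1)%N.
      have := xb i; rewrite ler_norml => /andP[H1 H2].
      rewrite -(ltr_nat R); apply: (@le_lt_trans _ _ (L * tnth x i + M0%:R)).
        by rewrite truncn_le; lra.
      by rewrite natrD natrM; lra.
    pose y : I := [ffun i => Ordinal (tx i)].
    have Fyx : F y x.
      move=> i; rewrite /corner /y ffunE /=; have := xb i; rewrite ler_norml => /andP[H1 H2].
      have /truncn_itv/andP[] : 0 <= L * tnth x i + M0%:R by lra.
      rewrite -natr1 => H3 H4; apply/andP; split.
        by rewrite ler_pdivrMr// [_ * L]mulrC; lra.
      by rewrite -[X in _ + X]mul1r -mulrDl ltr_pdivlMr// [_ * L]mulrC; lra.
    by exists y => //; rewrite mem_enum; apply/asboolP; exists x.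
pose G (y : I) := lincomb (@mean0_basis R (torus n)) [tuple (y i : nat)%:R - M0%:R | i < d].
have Gint y v : G y v \is a Num.int.
  apply: rpred_sum => i _; rewrite rpredM ?mean0_basis_int// tnth_mktuple.
  by rewrite rpredB// intr_nat// natr_nat.
have Gnear y x v : F y x -> `|G y v - L * lincomb (@mean0_basis R (torus n)) x v|
  <= #|torus n|%:R.
  move=> Fyx; rewrite -(@lincomb_mean0Z _ _ _ [tuple L * tnth x i | i < d]); last first.
    by move=> i; rewrite tnth_mktuple.
  apply: le_trans (dist_lincomb_mean0 (a := 1) _ _) _.
    by move=> i; rewrite !tnth_mktuple distrC close.
  by rewrite mulr1 ler_nat leq_pred.
have Gbound y v : good y -> `|G y v| <= M0%:R + #|torus n|%:R.
  move=> /asboolP[x Fyx [x0 xs]].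
  rewrite -(subrK (L * lincomb (@mean0_basis R (torus n)) x v) (G y v)) addrC.
  apply: le_trans (ler_normD _ _) _; apply: lerD; last exact: Gnear.
  rewrite normrM gtr0_norm//; apply: le_trans LM0; rewrite ler_pM2l//.
  exact: hessian_mean0_bound.
(* Each cube gives M1 configurations, which differ by a constant. *)
have ex (p : I * 'I_M1) : exists g : {ffun torus n -> 'I_M}, good p.1 ->
    forall v, natval R g v = G p.1 v + (M0 + #|torus n| + p.2)%:R.
  have [gp|] := boolP (good p.1); last first.
    have M_0 : (0 < M)%N by lia.
    by exists [ffun=> Ordinal M_0].
  have [] := @exists_natval R n M (fun v => G p.1 v + (M0 + #|torus n| + p.2)%:R).
  - by move=> v; rewrite rpredD// intr_nat// natr_nat.
  - move=> v; have := Gbound _ v gp; rewrite ler_norml !natrD => /andP[H1 H2].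
    by have : (0 : R) <= p.2%:R by []; lra.
  - move=> v; have := Gbound _ v gp; rewrite ler_norml => /andP[H1 H2].
    apply: (@lt_le_trans _ _ (2 * M0 + 2 * #|torus n| + M1 + 2)%:R); last by rewrite ler_nat.
    have : (p.2%:R : R) < M1%:R by rewrite ltr_nat.
    have -> : (2 * M0 + 2 * #|torus n| + M1 + 2)%:R
      = 2 * M0%:R + 2 * #|torus n|%:R + M1%:R + 2 :> R.
      by rewrite -!natrM -!natrD.
    by rewrite !natrD; lra.
  - by move=> g gE; exists g.
have [Phi PhiE] := choice ex.
rewrite -[M1]card_ord -cardX -(card_in_imset (f := Phi)) //.
  apply: subset_leq_card; apply/fintype.subsetP => g /imsetP[p]; rewrite inE => /andP[gp _] ->.
  apply/admissibleP => v r.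
  have -> : natval R (Phi p) = fun w => G p.1 w + (M0 + #|torus n| + p.2)%:R.
    by apply/funext => w; rewrite PhiE.
  rewrite hessianD hessian_cst addr0; apply: le_trans (su r).
  have /asboolP[x Fpx [x0 xs]] := gp.
  apply: (le_trans (le_hessian_near r v (fun w => Gnear _ _ w Fpx))).
  by rewrite lerD2r hessianZ ler_pM2l// xs.
move=> p q; rewrite !inE => /andP[gp _] /andP[gq _] E.
have EG v : G p.1 v + (M0 + #|torus n| + p.2)%:R = G q.1 v + (M0 + #|torus n| + q.2)%:R.
  by rewrite -!PhiE// E.
have e2 : p.2 = q.2.
  have : \sum_v (G p.1 v + (M0 + #|torus n| + p.2)%:R)
    = \sum_v (G q.1 v + (M0 + #|torus n| + q.2)%:R).
    by apply: eq_bigr.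
  rewrite !big_split /= !sum_lincomb_mean0 !add0r !sumr_const => /eqP.
  rewrite -!mulrnA eqr_nat eqn_pmul2r ?card_torus ?expn_gt0 ?n0//.
  by rewrite eqn_add2l => /eqP /val_inj.
have e1 : p.1 = q.1.
  apply/ffunP => i; have Epq : G p.1 = G q.1.
    by apply/funext => v; have := EG v; rewrite e2 => /addIr.
  have /(congr1 (fun t => tnth t i)) := lincomb_mean0_inj Epq.
  by rewrite !tnth_mktuple => /addIr /eqP; rewrite eqr_nat => /eqP /val_inj.
by case: p q e1 e2 {E EG gp gq} => [p1 p2] [q1 q2] /= -> ->.
Qed.

Lemma sum_rank_lt (R : realType) (T : finType) (j : nat) : (j <= #|T|)%N ->
  \sum_(v : T) (enum_rank v < j)%N%:R = j%:R :> R.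
Proof.
move=> jT; rewrite -natr_sum; congr _%:R.
rewrite (big_enum_val (A := T) (fun v => (enum_rank v < j) : nat)) /=.
under eq_bigr do rewrite enum_valK.
transitivity (\sum_(i < #|T| | (i < j)%N) 1)%N.
  by rewrite [RHS]big_mkcond /=; apply: eq_bigr => i _; case: (_ < _)%N.
by rewrite -(big_ord_widen _ (fun=> 1%N) jT) sum1_card card_ord.
Qed.

(** Each configuration is turned into an integer function h of sum zero; at most
    n^2 M configurations give the same h, since h and the sum determine the
    configuration. The cubes of side 1/L with these corners are disjoint and lie
    in the polytope. *)
Lemma count_le_coord_polytope (R : realType) (n : nat) (s : 'rV[R]_3) (L : R)
    (u : 'I_3 -> R) (M : nat) :
  (0 < n)%N -> 0 < L ->
  (forall r, u r + 2 + 4 * #|torus n|%:R <= L * s 0 r) ->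
  exists2 Y : nat, (#|admissible n M u| <= Y * (#|torus n| * M))%N &
    ((L^-1 ^+ #|torus n|.-1 * Y%:R)%:E <= lebesgue_tuple (coord_polytope n s))%E.
Proof.
move=> n0 L0 us.
set N := #|torus n|; set d := N.-1.
have N0 : (0 < N)%N by rewrite /N card_torus expn_gt0 n0.
pose S (g : {ffun torus n -> 'I_M}) : nat := (\sum_v g v)%N.
(* An integer function of sum zero: first the integer part of the mean is
   subtracted everywhere, then 1 at as many vertices as needed. *)
pose h (g : {ffun torus n -> 'I_M}) (v : torus n) : R :=
  natval R g v - (S g %/ N)%:R - ((enum_rank v < S g %% N)%N)%:R.
have SNM (g : {ffun torus n -> 'I_M}) : (S g < N * M)%N.
  have /card_gt0P[v0 _] := N0.
  have M0 : (0 < M)%N by apply: leq_ltn_trans (ltn_ord (g v0)).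
  apply: (@leq_ltn_trans (N * M.-1)); last by rewrite ltn_pmul2l// prednK.
  rewrite /N -sum_nat_const; apply: leq_sum => v _.
  by rewrite -ltnS prednK.
have h0 g : \sum_v h g v = 0.
  rewrite /h !sumrB sum_rank_lt; last by rewrite ltnW// ltn_mod.
  rewrite /natval -natr_sum sumr_const -/(S g) -/N {1}(divn_eq (S g) N).
  by rewrite natrD natrM mulr_natr addrAC addrK subrr.
have exX g : exists x : d.-tuple R, lincomb (@mean0_basis R (torus n)) x = h g.
  by have [x [xE _]] := (mean0_basisP (h g)).1 (h0 g); exists x.
have [X XE] := choice exX.
have hint g v : h g v \is a Num.int.
  by rewrite /h !rpredB// intr_nat// natr_nat.
have hlb g v : - M%:R <= h g v < M%:R.
  have : (S g %/ N < M)%N by rewrite ltn_divLR// mulnC.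
  rewrite -(ler_nat R) -natr1 /h /natval => H1.
  have : (g v < M)%N by [].
  rewrite -(ltr_nat R) => H2.
  have H3 : 0 <= (g v)%:R :> R by [].
  have H4 : 0 <= (S g %/ N)%:R :> R by [].
  have [H5 H6] : (0 : R) <= (enum_rank v < S g %% N)%N%:R /\ (enum_rank v < S g %% N)%N%:R
    <= (1 : R).
    by case: (_ < _)%N.
  by apply/andP; split; lra.
have Xh g i : exists v, tnth (X g) i = h g v /\ enum_rank v = i.+1 :> nat.
  by have [v vi] := exists_rankS i; exists v; rewrite -XE (lincomb_rankS _ vi).
pose I := {ffun 'I_d -> 'I_(2 * M)}.
have exPhi g : exists y : I, forall i, (y i : nat)%:R = tnth (X g) i + M%:R.
  have bd i : (Num.truncn (tnth (X g) i + M%:R) < 2 * M)%N.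
    have [v [-> _]] := Xh g i; have /andP[H1 H2] := hlb g v.
    rewrite -(ltr_nat R) truncnK; first by rewrite natrM; lra.
    by rewrite natrEint rpredD ?hint ?intr_nat ?natr_nat//=; lra.
  exists [ffun i => Ordinal (bd i)] => i; rewrite ffunE /= truncnK//.
  have [v [-> _]] := Xh g i; have /andP[H1 H2] := hlb g v.
  by rewrite natrEint rpredD ?hint ?intr_nat ?natr_nat//=; lra.
have [Phi PhiE] := choice exPhi.
exists #|Phi @: admissible n M u|.
  rewrite -[(N * M)%N]card_ord -cardsT -cardsX.
  pose J (g : {ffun torus n -> 'I_M}) := (Phi g, Ordinal (SNM g)).
  have Ji : injective J.
    move=> g g' [E1 E2]; have EX : X g = X g'.
      by apply: eq_from_tnth => i; apply: (@addIr _ M%:R); rewrite -!PhiE E1.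
    apply/ffunP => v; apply/val_inj/eqP; rewrite -(eqr_nat R) /=.
    have : h g v = h g' v by rewrite -!XE EX.
    by rewrite /h E2 => /addIr /addIr /eqP.
  rewrite -(card_imset _ Ji); apply: subset_leq_card.
  apply/fintype.subsetP => p /imsetP[g gA ->];
    by rewrite finset.in_setX finset.in_setT andbT imset_f.
have [m mE] := lebesgue_tuple_is_measure R d; rewrite mE -/d cardE.
pose corner (y : I) (i : 'I_d) : R := ((y i : nat)%:R - M%:R) / L.
pose F (y : I) := cube (corner y) L^-1.
have close y x i : F y x -> 0 <= L * tnth x i - ((y i : nat)%:R - M%:R) < 1.
  move=> /(_ i); rewrite /corner => /andP[H1 H2].
  have {}H1 : (y i : nat)%:R - M%:R <= L * tnth x i by rewrite mulrC -ler_pdivrMr.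
  have {}H2 : L * tnth x i < (y i : nat)%:R - M%:R + 1.
    by move: H2; rewrite -[X in _ + X]mul1r -mulrDl ltr_pdivlMr// [_ * L]mulrC.
  by apply/andP; split; lra.
apply: (measure_ge_packing (F := F)).
- exact: enum_uniq.
- exact: measurable_coord_polytope.
- by move=> y; exact: measurable_cube.
- by move=> y; have := @lebesgue_tuple_cube R d (corner y) L^-1; rewrite mE invr_gt0; apply.
- move=> y y' x Fy Fy'; apply/ffunP => i; apply/val_inj/eqP => /=.
  have /andP[H1 H2] := close _ _ i Fy; have /andP[H3 H4] := close _ _ i Fy'.
  have : ((y i : nat)%:R : R) < (y' i : nat).+1%:R by rewrite -natr1; lra.
  have : ((y' i : nat)%:R : R) < (y i : nat).+1%:R by rewrite -natr1; lra.
  by rewrite !ltr_nat !ltnS eqn_leq => -> ->.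
move=> y x; rewrite mem_enum => /imsetP[g /admissibleP gu ->] Fx.
split; first exact: sum_lincomb_mean0.
move=> v r; rewrite -(ler_pM2l L0) -hessianZ; apply: le_trans (us r).
apply: le_trans (le_hessian_near (g := h g) (x := N%:R) r v _) _.
  move=> w; rewrite -XE -(@lincomb_mean0Z _ _ _ [tuple L * tnth x i | i < d]); last first.
    by move=> i; rewrite tnth_mktuple.
  apply: le_trans (dist_lincomb_mean0 (a := 1) _ _) _; last by rewrite mulr1 ler_nat leq_pred.
  move=> i; rewrite tnth_mktuple; have /andP[] := close _ _ i Fx.
  by rewrite PhiE addrK ler_norml => H1 H2; apply/andP; split; lra.
rewrite lerD2r.
have -> : h g = fun w => natval R g w + (- (S g %/ N)%:R - 1 + (1 - (enum_rank w < S g %%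
  N)%N%:R)).
  by apply/funext => w; rewrite /h; ring.
rewrite hessianD hessianD hessian_cst add0r; apply: lerD; first exact: gu.
rewrite -[leRHS]mulr1; apply: hessian_le_nonneg => w; case: (_ < _)%N;
  rewrite /= ?subrr ?subr0 ?ler01 ?lexx //.
Qed.

Definition coord_volume (R : realType) (n : nat) (s : 'rV[R]_3) : R :=
  fine (lebesgue_tuple (coord_polytope n s)).

Lemma exists_nat_ge (R : realType) (x : R) : exists C : nat, x <= C%:R.
Proof.
have [x0|x0] := leP x 0; first by exists 0%N.
exists (Num.truncn x).+1; apply: ltW; have /truncn_itv/andP[] := ltW x0; by [].
Qed.

Lemma lebesgue_coord_polytope_ge0 (R : realType) (n : nat) (s : 'rV[R]_3) :
  (0 <= lebesgue_tuple (coord_polytope n s))%E.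
Proof.
by have [m mE] := lebesgue_tuple_is_measure R #|torus n|.-1; rewrite mE measure_ge0.
Qed.

Lemma coord_volume_finite (R : realType) (n : nat) (s : 'rV[R]_3) :
  (0 < n)%N -> (forall r, 0 <= s 0 r) -> 
  (lebesgue_tuple (coord_polytope n s) = (coord_volume n s)%:E)%E.
Proof.
move=> n0 s0; rewrite /coord_volume fineK// ge0_fin_numE ?lebesgue_coord_polytope_ge0//.
have [M0 HM0] := exists_nat_ge (1 * (2 * (n%:R ^+ 2 * \sum_r s 0 r))).
have [Y _ HY] := @coord_polytope_le_count R n s 1 (fun r => 1 * s 0 r + 4 * #|torus n|%:R) M0 0
  (2 * M0 + 2 * #|torus n| + 0 + 2) n0 ltr01 s0 HM0 (leqnn _) (fun r => lexx _).
by apply: le_lt_trans HY _; rewrite ltry.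
Qed.

Lemma coord_volume_ge0 (R : realType) (n : nat) (s : 'rV[R]_3) : 0 <= coord_volume n s.
Proof. by rewrite fine_ge0// lebesgue_coord_polytope_ge0. Qed.

(** The range of the configurations is proportional to L, by a factor polynomial
    in n: it has to contain the polytope scaled by L, and L translates. *)
Lemma coord_volume_le_count (R : realType) (n L C : nat) (s : 'rV[R]_3) (u : 'I_3 -> R) :
  (0 < n)%N -> (0 < L)%N -> (forall r, 0 <= s 0 r) ->
  2 * \sum_r s 0 r <= C%:R ->
  (forall r, L%:R * s 0 r + 4 * n%:R ^+ 2 <= u r) ->
  coord_volume n s * L%:R ^+ (n ^ 2) <= #|admissible n (L * (n ^ 2 * (2 * C + 5))) u|%:R.
Proof.
move=> n0 L0 s0 sC su.
have N0 : (0 < n ^ 2)%N by rewrite expn_gt0 n0.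
have L0' : 0 < L%:R :> R by rewrite ltr0n.
have H1 : L%:R * (2 * (n%:R ^+ 2 * \sum_r s 0 r)) <= (L * (n ^ 2 * C))%:R.
  rewrite natrM ler_wpM2l// mulrCA natrM natrX ler_wpM2l// exprn_ge0//.
have H2 : (2 * (L * (n ^ 2 * C)) + 2 * #|torus n| + L + 2 <= L * (n ^ 2 * (2 * C + 5)))%N.
  by rewrite card_torus; nia.
have H3 r : L%:R * s 0 r + 4 * #|torus n|%:R <= u r by rewrite card_torus natrX.
have [Y YX VY] := coord_polytope_le_count n0 L0' s0 H1 H2 H3.
move: VY; rewrite coord_volume_finite// lee_fin card_torus => VY.
apply: (@le_trans _ _ (L%:R^-1 ^+ (n ^ 2).-1 * Y%:R * L%:R ^+ (n ^ 2))).
  by rewrite ler_wpM2r// exprn_ge0.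
have E d : (0 < d)%N -> L%:R^-1 ^+ d.-1 * Y%:R * L%:R ^+ d = Y%:R * L%:R :> R.
  case: d => // d _; rewrite exprVn exprSr /=; field.
  by rewrite expf_neq0// gt_eqF.
by rewrite E// -natrM ler_nat.
Qed.

Lemma count_le_coord_volume (R : realType) (n M : nat) (L : R) (s : 'rV[R]_3) (u : 'I_3 -> R) :
  (0 < n)%N -> 0 < L -> (forall r, 0 <= s 0 r) ->
  (forall r, u r + 2 + 4 * n%:R ^+ 2 <= L * s 0 r) ->
  #|admissible n M u|%:R <= n%:R ^+ 2 * M%:R * L ^+ (n ^ 2).-1 * coord_volume n s.
Proof.
move=> n0 L0 s0 us.
have H r : u r + 2 + 4 * #|torus n|%:R <= L * s 0 r by rewrite card_torus natrX.
have [Y XY YV] := @count_le_coord_polytope R n s L u M n0 L0 H.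
move: YV; rewrite coord_volume_finite// lee_fin card_torus exprVn.
rewrite ler_pdivrMl ?exprn_gt0// => YV.
apply: (@le_trans _ _ (Y%:R * (n%:R ^+ 2 * M%:R))).
  by rewrite -natrX -!natrM ler_nat; move: XY; rewrite card_torus.
rewrite mulrC -mulrA ler_wpM2l// mulr_ge0 ?exprn_ge0//.
Qed.

(** * Inequalities between volumes *)

Lemma exists_positive_lower_bound (R : realType) (s : 'rV[R]_3) :
  positive_octant s -> exists2 mu : R, 0 < mu & forall r, mu <= s 0 r.
Proof.
move=> s0; case: (@Order.TotalTheory.arg_minP _ _ _ (ord0 : 'I_3) predT (fun r =>
  s 0 r) isT) => r _ H.
by exists (s 0 r); [exact: s0|move=> r'; exact: H].
Qed.

(** The price of multiplying the resolution by 1 + 1/N in dimension at most N. *)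
Lemma one_plus_inv_pow_le (R : realType) (N k : nat) :
  (k <= N)%N -> (1 + N%:R^-1) ^+ k <= expR 1 :> R.
Proof.
case: N => [|N] kN; first by move: kN; rewrite leqn0 => /eqP ->;
  rewrite expr0 -[X in X <= _]expR0 ler_expR.
apply: (@le_trans _ _ (expR (N.+1%:R^-1) ^+ k)).
  by apply: lerXn2r; rewrite ?nnegrE ?expR_ge0 ?addr_ge0 ?expR_ge1Dx.
rewrite -expRM_natr ler_expR mulrC ler_pdivrMr// mul1r ler_nat//.
Qed.

Lemma exists_scale (R : realType) (x mu : R) : 0 < mu ->
  exists2 L : nat, (0 < L)%N & x <= L%:R * mu.
Proof.
move=> mu0; have [C HC] := exists_nat_ge (x / mu); exists C.+1 => //.
rewrite -ler_pdivrMr//; apply: le_trans HC _; by rewrite ler_nat.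
Qed.

(** The same configurations approximate P_n(s) at resolution L and P_n(c s) at
    resolution L / c. The resulting homogeneity holds up to a factor polynomial
    in n, which the (n^2 - 1)-st root removes. *)
Lemma coord_volume_scale (R : realType) (n C : nat) (s : 'rV[R]_3) (c : R) :
  (0 < n)%N -> positive_octant s -> 0 < c -> 2 * \sum_r s 0 r <= C%:R ->
  c ^+ (n ^ 2).-1 * coord_volume n s <=
    expR 1 * n%:R ^+ 2 * (n ^ 2 * (2 * C + 5))%:R * coord_volume n (c *: s).
Proof.
move=> n0 s0 c0 sC; have [mu mu0 smu] := exists_positive_lower_bound s0.
have s0' r : 0 <= s 0 r by exact/ltW/s0.
have cs0 r : 0 <= (c *: s) 0 r by rewrite mxE mulr_ge0// ltW.
set nu : R := n%:R ^+ 2; have nu0 : 0 < nu by rewrite exprn_gt0// ltr0n.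
have [L L0 HL] := exists_scale (nu * (8 * nu + 2)) mu0.
have L0' : 0 < L%:R :> R by rewrite ltr0n.
set K := (n ^ 2 * (2 * C + 5))%N.
pose u (r : 'I_3) := L%:R * s 0 r + 4 * nu.
have low := @coord_volume_le_count R n L C s u n0 L0 s0' sC (fun r => lexx _).
(* The resolution for c s; the factor 1 + 1/n^2 absorbs the rounding errors and
   costs at most e after n^2 - 1 multiplications. *)
pose L' := L%:R / c * (1 + nu^-1).
have L'0 : 0 < L' by rewrite mulr_gt0 ?divr_gt0// addr_gt0// invr_gt0.
have us r : u r + 2 + 4 * nu <= L' * (c *: s) 0 r.
  rewrite mxE /L' (_ : L%:R / c * (1 + nu^-1) * (c * s 0 r)
    = L%:R * s 0 r + L%:R * s 0 r / nu); last first.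
    by field; rewrite !gt_eqF.
  have H : 8 * nu + 2 <= L%:R * s 0 r / nu.
    by rewrite ler_pdivlMr// mulrC; apply: le_trans HL _; rewrite ler_pM2l.
  by rewrite /u; lra.
have up := @count_le_coord_volume R n (L * K) L' (c *: s) u n0 L'0 cs0 us.
have := le_trans low up; rewrite -/nu natrM.
have N0 : (0 < n ^ 2)%N by rewrite expn_gt0 n0.
rewrite -[X in L%:R ^+ X](prednK N0) exprSr.
rewrite {1}/L' exprMn expr_div_n.
have ne : (1 + nu^-1) ^+ (n ^ 2).-1 <= expR 1.
  by rewrite /nu -natrX one_plus_inv_pow_le// leq_pred.
set d := (n ^ 2).-1 in ne *; set V := coord_volume n s; set W := coord_volume n (c *: s).
set Ld := L%:R ^+ d; set cd := c ^+ d; set e := _ ^+ d in ne *.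
have cd0 : 0 < cd by rewrite exprn_gt0.
have Ld0 : 0 < Ld by rewrite exprn_gt0.
rewrite (_ : nu * (L%:R * K%:R) * (Ld / cd * e) * W = (Ld * L%:R) * (nu * K%:R * e * W / cd));
  last first.
  by field; rewrite gt_eqF.
rewrite [V * _]mulrC ler_pM2l ?mulr_gt0// ler_pdivlMr// mulrC => /le_trans; apply.
rewrite (_ : nu * K%:R * e * W = (nu * K%:R * W) * e); last by ring.
rewrite (_ : expR 1 * nu * K%:R * W = (nu * K%:R * W) * expR 1); last by ring.
by rewrite ler_wpM2l// !mulr_ge0 ?coord_volume_ge0// ltW.
Qed.

(** card_admissible_midpoint, read through the two comparisons between volumes
    and counts. *)
Lemma coord_volume_midpoint (R : realType) (n C : nat) (s t : 'rV[R]_3) :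
  (0 < n)%N -> positive_octant s -> positive_octant t ->
  2 * \sum_r s 0 r <= C%:R -> 2 * \sum_r t 0 r <= C%:R ->
  coord_volume n s * coord_volume n t <=
    (expR 1 * n%:R ^+ 2 * (n ^ 2 * (2 * C + 5))%:R * coord_volume n (2^-1 *: (s + t))) ^+ 2.
Proof.
move=> n0 s0 t0 sC tC.
have st0 : positive_octant (2^-1 *: (s + t)).
  by move=> r; rewrite !mxE mulr_gt0 ?invr_gt0 ?addr_gt0.
have [mu mu0 smu] := exists_positive_lower_bound st0.
have s0' r : 0 <= s 0 r by exact/ltW/s0.
have t0' r : 0 <= t 0 r by exact/ltW/t0.
have st0' r : 0 <= (2^-1 *: (s + t)) 0 r by exact/ltW/st0.
set nu : R := n%:R ^+ 2; have nu0 : 0 < nu by rewrite exprn_gt0// ltr0n.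
have [L L0 HL] := exists_scale (nu * (8 * nu + 4)) mu0.
have L0' : 0 < L%:R :> R by rewrite ltr0n.
set K := (n ^ 2 * (2 * C + 5))%N.
pose u (r : 'I_3) := L%:R * s 0 r + 4 * nu.
pose u' (r : 'I_3) := L%:R * t 0 r + 4 * nu.
have lows := @coord_volume_le_count R n L C s u n0 L0 s0' sC (fun r => lexx _).
have lowt := @coord_volume_le_count R n L C t u' n0 L0 t0' tC (fun r => lexx _).
pose L' := L%:R * (1 + nu^-1).
have L'0 : 0 < L' by rewrite mulr_gt0// addr_gt0// invr_gt0.
have us r : ((u r + u' r) / 2 + 2) + 2 + 4 * nu <= L' * (2^-1 *: (s + t)) 0 r.
  set x := (2^-1 *: (s + t)) 0 r; have xE : x = (s 0 r + t 0 r) / 2 by rewrite /x !mxE mulrC.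
  rewrite /L' (_ : L%:R * (1 + nu^-1) * x = L%:R * x + L%:R * x / nu); last first.
    by field; rewrite !gt_eqF.
  rewrite /u /u' (_ : (L%:R * s 0 r + 4 * nu + (L%:R * t 0 r + 4 * nu)) / 2 + 2 + 2 + 4 * nu
    = L%:R * x + (8 * nu + 4)); last first.
    by rewrite xE; field.
  rewrite lerD2l ler_pdivlMr// mulrC; apply: le_trans HL _; by rewrite ler_pM2l// smu.
have up := @count_le_coord_volume R n (L * K) L' (2^-1 *: (s + t)) _ n0 L'0 st0' us.
have mid := card_admissible_midpoint n (L * K) u u'.
have N0 : (0 < n ^ 2)%N by rewrite expn_gt0 n0.
have ne : (1 + nu^-1) ^+ (n ^ 2).-1 <= expR 1.
  by rewrite /nu -natrX one_plus_inv_pow_le// leq_pred.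
move: lows lowt up; rewrite -/nu natrM -[X in L%:R ^+ X](prednK N0) exprSr /L' exprMn.
set d := (n ^ 2).-1 in ne *; set V := coord_volume n s; set V' := coord_volume n t.
set W := coord_volume n _.
set Ld := L%:R ^+ d; set e := _ ^+ d in ne *.
have Ld0 : 0 < Ld by rewrite exprn_gt0.
have V0 : 0 <= V by exact: coord_volume_ge0.
have V'0 : 0 <= V' by exact: coord_volume_ge0.
have W0 : 0 <= W by exact: coord_volume_ge0.
set X := #|_|%:R; set X' := #|_|%:R; set Y := #|_|%:R => VX VX' YW.
have XY : X * X' <= Y ^+ 2 by rewrite /X /X' /Y -natrM -natrX ler_nat.
set Q := Ld * L%:R in VX VX'.
have Q0 : 0 < Q by rewrite mulr_gt0.
have YW' : Y <= Q * (expR 1 * nu * K%:R * W).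
  apply: le_trans YW _.
  rewrite (_ : nu * (L%:R * K%:R) * (Ld * e) * W = (nu * K%:R * W * Q) * e);
    last by rewrite /Q; ring.
  rewrite (_ : Q * (expR 1 * nu * K%:R * W) = (nu * K%:R * W * Q) * expR 1); last by ring.
  by rewrite ler_wpM2l// !mulr_ge0// ltW.
have H : (V * Q) * (V' * Q) <= (Q * (expR 1 * nu * K%:R * W)) ^+ 2.
  apply: (@le_trans _ _ (X * X')).
    by apply: ler_pM => //; rewrite mulr_ge0// ltW.
  apply: le_trans XY _; rewrite ler_pXn2r ?nnegrE//.
  by rewrite !mulr_ge0// ?expR_ge0 ?ltW.
by move: H; rewrite exprMn mulrACA -expr2 mulrC ler_pM2l// exprn_gt0.
Qed.

(** The cube of card_admissible_ge, at a resolution adapted to its side p. *)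
Lemma coord_volume_lower (R : realType) (n : nat) (s : 'rV[R]_3) (mu : R) :
  (0 < n)%N -> 0 < mu -> (forall r, mu <= s 0 r) ->
  (mu / 4) ^+ (n ^ 2).-1 <= n%:R ^+ 2 * coord_volume n s.
Proof.
move=> n0 mu0 smu.
have s0' r : 0 <= s 0 r by exact/ltW/(lt_le_trans mu0).
set nu : R := n%:R ^+ 2; have nu0 : 0 < nu by rewrite exprn_gt0// ltr0n.
have [p p0 Hp] := exists_scale (2 + 4 * nu) (ltr0n R 2).
have p0' : 0 < p%:R :> R by rewrite ltr0n.
pose L := 4 * p%:R / mu.
have L0 : 0 < L by rewrite divr_gt0// mulr_gt0.
have us r : 2 * p%:R + 2 + 4 * nu <= L * s 0 r.
  apply: (@le_trans _ _ (L * mu)); last by rewrite ler_pM2l.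
  by rewrite /L divfK ?gt_eqF//; lra.
have up := @count_le_coord_volume R n p L s (fun=> 2 * p%:R) n0 L0 s0' us.
have low := @card_admissible_ge R n p p (fun=> 2 * p%:R) (leqnn _) (fun=> lexx _).
have {low} : p%:R ^+ (n ^ 2) <= #|admissible n p (fun=> 2 * p%:R : R)|%:R :> R.
  by rewrite -natrX ler_nat.
have N0 : (0 < n ^ 2)%N by rewrite expn_gt0 n0.
move=> /le_trans/(_ up); rewrite -/nu -[X in p%:R ^+ X](prednK N0) exprSr.
set d := (n ^ 2).-1; set W := coord_volume n s => H.
have Ld0 : 0 < L ^+ d by rewrite exprn_gt0.
have {}H : p%:R ^+ d <= L ^+ d * (nu * W).
  by rewrite -(ler_pM2r p0'); apply: le_trans H _; rewrite le_eqVlt; apply/orP; left;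
    apply/eqP; ring.
rewrite (_ : mu / 4 = p%:R / L); last by rewrite /L; field; rewrite !gt_eqF.
by rewrite expr_div_n ler_pdivrMr// mulrC.
Qed.

Lemma succ_pow_le (R : realType) (b : nat) : b.+1%:R ^+ b <= b%:R ^+ b * expR 1 :> R.
Proof.
case: b => [|b]; first by rewrite !expr0 mul1r -expR0 ler_expR.
rewrite (_ : b.+2%:R = b.+1%:R * (1 + b.+1%:R^-1)); last first.
  by rewrite mulrDr mulr1 divff ?gt_eqF// natr1.
by rewrite exprMn ler_wpM2l ?exprn_ge0 ?one_plus_inv_pow_le.
Qed.

Lemma pow_le_fact (R : realType) (b : nat) : b%:R ^+ b <= expR 1 ^+ b * b`!%:R :> R.
Proof.
elim: b => [|b IH]; first by rewrite !expr0 fact0 mulr1.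
rewrite exprS factS natrM exprSr.
apply: (@le_trans _ _ (b.+1%:R * (b%:R ^+ b * expR 1))).
  by rewrite ler_wpM2l// succ_pow_le.
rewrite (_ : expR 1 ^+ b * expR 1 * _ = b.+1%:R * (expR 1 ^+ b * b`!%:R * expR 1));
  last by ring.
by rewrite ler_wpM2l// ler_wpM2r ?expR_ge0.
Qed.

Lemma ffact_le_pow (a b : nat) : (a ^_ b <= a ^ b)%N.
Proof.
elim: b a => [|b IH] a; first by rewrite ffactn0.
rewrite ffactnS expnS leq_mul2l; apply/orP; right.
apply: leq_trans (IH _) _; case: b {IH} => // b.
by rewrite leq_exp2r ?leq_pred.
Qed.

(** The volume of the simplex in card_admissible_le is estimated by b! >= (b/e)^b
    with b = m^2. The 2m + 1 axis values only contribute to a factor whose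
    logarithm is negligible with respect to m^2. *)
Lemma coord_volume_upper (R : realType) (m C : nat) (s : 'rV[R]_3) (r : 'I_3) :
  positive_octant s -> 2 * \sum_r s 0 r <= C%:R ->
  coord_volume m.+1 s <= ((m.+1 ^ 2 * (2 * C + 5))%:R * expR 1) ^+ (2 * m + 1) * (expR 1 * s 0
    r) ^+ (m ^ 2).
Proof.
move=> s0 sC.
have s0' r' : 0 <= s 0 r' by exact/ltW/s0.
have e1 : (m.+1 + m = 2 * m + 1)%N by lia.
have e3 : (m.+1 ^ 2 = 2 * m + 1 + m ^ 2)%N by rewrite -!mulnn; lia.
set n := m.+1 in e1 e3 *; set nu : R := n%:R ^+ 2;
  have nu0 : 0 < nu by rewrite exprn_gt0// ltr0n.
have [L L0 HL] := exists_scale (nu * (4 * nu + 1)) (s0 r).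
have L0' : 0 < L%:R :> R by rewrite ltr0n.
set K := (n ^ 2 * (2 * C + 5))%N.
pose u (r : 'I_3) := L%:R * s 0 r + 4 * nu.
have low := @coord_volume_le_count R n L C s u isT L0 s0' sC (fun r => lexx _).
have ur0 : 0 <= u r by rewrite addr_ge0 ?mulr_ge0 ?ltW.
have /truncn_itv/andP[Uu uU] := ur0; set U := Num.truncn (u r) in Uu uU.
have up := @card_admissible_le R m (L * K) U u r uU.
set b := (m ^ 2)%N in up *; set a := (b + n ^ 2 * U)%N in up.
have ab : a%:R <= nu * L%:R * s 0 r * (1 + nu^-1).
  apply: (@le_trans _ _ (nu * (1 + u r))).
    rewrite /a natrD natrM mulrDr mulr1 lerD//.
      by rewrite /nu -natrX ler_nat /b leq_sqr.
    by rewrite natrX ler_pM2l.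
  rewrite (_ : nu * L%:R * s 0 r * (1 + nu^-1) = nu * (L%:R * s 0 r + L%:R * s 0 r / nu));
    last first.
    by field; rewrite gt_eqF.
  rewrite ler_pM2l// /u; suff : 4 * nu + 1 <= L%:R * s 0 r / nu by lra.
  by rewrite ler_pdivlMr// mulrC.
have bin : 'C(a, b)%:R * b`!%:R <= (nu * L%:R * s 0 r * (1 + nu^-1)) ^+ b.
  apply: (@le_trans _ _ (a%:R ^+ b)).
    by rewrite -natrM bin_ffact -natrX ler_nat ffact_le_pow.
  by apply: lerXn2r; rewrite ?nnegrE ?ler0n// (le_trans _ ab).
have ne : (1 + nu^-1) ^+ b <= expR 1.
  rewrite /nu -natrX one_plus_inv_pow_le// leq_sqr leqnSn//.
have f0 : 0 < b`!%:R :> R by rewrite ltr0n fact_gt0.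
have nub : nu ^+ b <= expR 1 ^+ b * b`!%:R * expR 1 ^+ (2 * m).
  rewrite /nu -exprM /b.
  rewrite (_ : (2 * m ^ 2 = m * (2 * m))%N); last by rewrite mulnCA mulnn.
  rewrite exprM; apply: (@le_trans _ _ ((m%:R ^+ m * expR 1) ^+ (2 * m))).
    by apply: lerXn2r; rewrite ?nnegrE ?exprn_ge0 ?mulr_ge0 ?expR_ge0 ?exprn_ge0 ?succ_pow_le.
  rewrite exprMn ler_wpM2r ?exprn_ge0 ?expR_ge0//.
  have e2 q : q = (m ^ 2)%N -> (m%:R ^+ m) ^+ (2 * m) = q%:R ^+ q :> R.
    move=> qE; rewrite -exprM (_ : (m * (2 * m) = 2 * q)%N); last by rewrite qE mulnCA mulnn.
    by rewrite [RHS](_ : _ = (m%:R ^+ 2) ^+ q) ?exprM// qE natrX.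
  by rewrite (e2 _ erefl); exact: pow_le_fact.
set V := coord_volume n s in low *.
have cnt : V * L%:R ^+ (n ^ 2) <= (L%:R * K%:R) ^+ (2 * m + 1) * 'C(a, b)%:R.
  apply: le_trans low _; rewrite -natrM -natrX -natrM ler_nat; apply: leq_trans up _.
  by rewrite -expnD leq_mul2r; apply/orP; right; rewrite e1.
have key : V * b`!%:R <= K%:R ^+ (2 * m + 1) * (nu * s 0 r) ^+ b * expR 1.
  have Lp : 0 < L%:R ^+ (n ^ 2) :> R by rewrite exprn_gt0.
  rewrite -(ler_pM2r Lp) mulrAC.
  apply: (@le_trans _ _ ((L%:R * K%:R) ^+ (2 * m + 1) * ('C(a, b)%:R * b`!%:R))).
    by rewrite mulrA ler_pM2r.
  apply: (@le_trans _ _ ((L%:R * K%:R) ^+ (2 * m + 1) * ((nu * L%:R * s 0 r) ^+ b * expR 1))).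
    rewrite ler_wpM2l ?exprn_ge0 ?mulr_ge0//; apply: le_trans bin _.
    by rewrite exprMn ler_wpM2l// exprn_ge0// !mulr_ge0// ltW.
  rewrite le_eqVlt; apply/orP; left; apply/eqP.
  rewrite e3 -/b.
  by move: (2 * m + 1)%N => q; rewrite !exprMn exprD; ring.
rewrite -(ler_pM2r f0); apply: le_trans key _.
rewrite (_ : _ * _ * b`!%:R = K%:R ^+ (2 * m + 1) * s 0 r ^+ b * expR 1 * (expR 1 ^+ b * b`!%:R
  * expR 1 ^+ (2 * m))); last first.
  rewrite !exprMn [expR 1 ^+ (2 * m + 1)]exprD expr1.
  by move: (2 * m + 1)%N (2 * m)%N => q q'; ring.
rewrite [(nu * _) ^+ b]exprMn.
rewrite (_ : _ * _ * expR 1 = K%:R ^+ (2 * m + 1) * s 0 r ^+ b * expR 1 * nu ^+ b);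
  last by ring.
by rewrite ler_wpM2l// !mulr_ge0 ?exprn_ge0 ?expR_ge0.
Qed.

Lemma exists_pow2_ge (R : realType) (x : R) : exists q : nat, x <= 2 ^+ q.
Proof.
have [q Hq] := exists_nat_ge x; exists q; apply: le_trans Hq _.
by rewrite -natrX ler_nat ltnW// ltn_expl.
Qed.

Lemma tile_exponents (a b k n : nat) : (b <= a)%N -> (k * b <= n)%N -> (0 < n)%N ->
  (a * k + (n - k * b) = (a - b) * k + n.-1.+1)%N.
Proof.
move=> ba kb n0; rewrite prednK// mulnBl [(b * k)%N]mulnC.
have : (k * b <= k * a)%N by rewrite leq_mul2l ba orbT.
by rewrite [(a * k)%N]mulnC; move: (k * a)%N (k * b)%N kb => x y; lia.
Qed.

(** The powers of the resolution L on both sides agree because the live and dead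
    vertices together exhaust the n^2 dimensions; they cancel. *)
Lemma tile_bound_algebra (R : realType) (V L A K F P W nu eps : R) (a2 t2 k2 n2 : nat) :
  0 < L -> 0 <= V -> 0 <= F -> 0 <= A -> 0 <= K -> 0 <= eps -> 0 <= W -> 0 <= nu ->
    eps * L <= P ->
  (t2 <= a2)%N -> (k2 * t2 <= n2)%N -> (0 < n2)%N ->
  V * L ^+ a2 <= A * (L * K) ^+ (a2 - t2) * F ->
  F ^+ k2 * P ^+ (n2 - k2 * t2) <= nu * (L * K) * L ^+ n2.-1 * W ->
  V ^+ k2 * eps ^+ (n2 - k2 * t2) <= (A * K ^+ (a2 - t2)) ^+ k2 * (nu * K) * W.
Proof.
move=> L0 V0 F0 A0 K0 e0 W0 nu0 eP ta kt n20 H1 H2.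
have La0 d : 0 < L ^+ d by rewrite exprn_gt0.
have Q0 : 0 < L ^+ (a2 * k2 + (n2 - k2 * t2)) by [].
rewrite -(ler_pM2r Q0).
have E := tile_exponents ta kt n20.
apply: (@le_trans _ _ ((V * L ^+ a2) ^+ k2 * (eps * L) ^+ (n2 - k2 * t2))).
  rewrite le_eqVlt; apply/orP; left; apply/eqP.
  by rewrite exprD exprM !exprMn; ring.
apply: (@le_trans _ _ ((A * (L * K) ^+ (a2 - t2) * F) ^+ k2 * P ^+ (n2 - k2 * t2))).
  apply: ler_pM.
  - by rewrite exprn_ge0// mulr_ge0// ltW.
  - by rewrite exprn_ge0// mulr_ge0// ltW.
  - by apply: lerXn2r; rewrite ?nnegrE ?mulr_ge0 ?exprn_ge0 ?mulr_ge0 ?(ltW L0)// ltW.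
  - apply: lerXn2r; rewrite ?nnegrE ?mulr_ge0 ?(ltW L0)//.
    by apply: le_trans eP; rewrite mulr_ge0// ltW.
rewrite [(_ * F) ^+ _]exprMn -[leLHS]mulrA.
apply: (@le_trans _ _ ((A * (L * K) ^+ (a2 - t2)) ^+ k2 * (nu * (L * K) * L ^+ n2.-1 * W))).
  by rewrite ler_wpM2l// exprn_ge0// mulr_ge0// exprn_ge0// mulr_ge0// ltW.
rewrite E exprD exprSr [L ^+ (_ * k2)]exprM !exprMn le_eqVlt; apply/orP; left; apply/eqP; ring.
Qed.

(** card_flat_ge on the small torus followed by card_glue, read through the two
    comparisons between volumes and counts. The number eps is the thickness of
    the dead coordinates, relative to the resolution. *)
Lemma coord_volume_tile (R : realType) (n k t C : nat) (s : 'rV[R]_3) (delta mu : R) :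
  let a := t.+3 in let K := (a ^ 2 * (2 * C + 5))%N in
  (k.+1 * a <= n)%N -> positive_octant s -> 2 * \sum_r s 0 r <= C%:R ->
  0 < delta -> delta <= 1 -> 0 < mu -> (forall r, mu <= s 0 r) ->
  coord_volume a s ^+ (k.+1 ^ 2) * (delta * mu / 8) ^+ (n ^ 2 - k.+1 ^ 2 * t ^ 2) <=
  (a%:R ^+ 2 * (2 * K%:R) ^+ (a ^ 2 - t ^ 2)) ^+ (k.+1 ^ 2) * (n%:R ^+ 2 * (2 * K%:R)) *
    coord_volume n ((1 + delta) *: s).
Proof.
move=> a K kn s0 sC d0 d1 mu0 smu.
have arith : [/\ (0 < n)%N, (0 < n ^ 2)%N, (t ^ 2 <= a ^ 2)%N, (k.+1 ^ 2 * t ^ 2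
  <= n ^ 2)%N & (C <= K)%N].
  have n0 : (0 < n)%N by rewrite /a in kn; nia.
  split => //; first by rewrite expn_gt0 n0.
  - by rewrite leq_sqr /a; lia.
  - by rewrite -expnMn leq_sqr; rewrite /a in kn; nia.
  - by rewrite /K /a; nia.
have [n0 n20 ta ktn CK] := arith; move: arith => _.
have s0' r : 0 <= s 0 r by exact/ltW/s0.
have ds0' r : 0 <= ((1 + delta) *: s) 0 r by rewrite mxE mulr_ge0// addr_ge0// ltW.
have muC : mu <= C%:R.
  apply: le_trans (smu ord0) _; apply: le_trans sC.
  have S0 : 0 <= \sum_(r < 3 | r != ord0) s 0 r by rewrite sumr_ge0.
  by rewrite (bigD1 ord0)//=; have := s0' ord0; lra.
set nu : R := n%:R ^+ 2; have nu0 : 0 < nu by rewrite exprn_gt0// ltr0n.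
have K0 : 0 < K%:R :> R by rewrite ltr0n /K muln_gt0 expn_gt0 addnS.
have dm0 : 0 < delta * mu by rewrite mulr_gt0.
(* The slack L delta mu is spent in quarters: on the oscillation left after q
   averagings, on the thickening of the frames by p, and on rounding errors
   that do not depend on L. *)
have [q Hq] := exists_pow2_ge (32 * (a%:R * K%:R) / (delta * mu)).
have {}Hq : 8 * (a%:R * (K%:R / 2 ^+ q)) <= delta * mu / 4.
  move: Hq; rewrite ler_pdivrMr// => Hq.
  have p0 : (0 : R) < 2 ^+ q by rewrite exprn_gt0.
  rewrite mulrA mulrA ler_pdivrMr//; lra.
have dm40 : 0 < delta * mu / 4 by rewrite divr_gt0.
have [L L0 HL] := exists_scale (4 * a%:R ^+ 2 + 4 * q%:R + 16 * (a%:R * q%:R) + 2 + 4 * nu)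
  dm40.
have L0' : 0 < L%:R :> R by rewrite ltr0n.
pose u (r : 'I_3) := L%:R * s 0 r + 4 * (a%:R : R) ^+ 2.
pose M := (L * K)%N.
have low := @coord_volume_le_count R a L C s u isT L0 s0' sC (fun r => lexx _).
have X0 : (0 < #|admissible a M u|)%N.
  have M0 : (1 <= M)%N by rewrite muln_gt0 L0 -(ltr0n R).
  have := @card_admissible_ge R a M 1 u M0; rewrite exp1n; apply=> r.
  have a1 : (1 : R) <= a%:R by rewrite ler1n.
  have a2 : (1 : R) <= a%:R ^+ 2 by rewrite exprn_ege1.
  rewrite /u; have : 0 <= L%:R * s 0 r by rewrite mulr_ge0.
  by lra.
have [c flat] := card_flat_ge q (frame t) (isT : (0 < a)%N) X0.
set u' := (fun r : 'I_3 => u r + _ + _) in flat.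
set F := fiber _ _ _ in flat.
pose p := Num.truncn (delta * mu / 8 * L%:R).
have /truncn_itv/andP[pL Lp] : 0 <= delta * mu / 8 * L%:R by rewrite mulr_ge0// divr_ge0// ltW.
have glued := card_glue p c u' kn.
have us r : (u' r + 2 * p%:R) + 2 + 4 * nu <= L%:R * ((1 + delta) *: s) 0 r.
  rewrite mxE /u' /u /averaged_oscillation /M natrM.
  have -> : 4 * (2 * (a%:R * (L%:R * K%:R / 2 ^+ q + 2 * q%:R)))
    = L%:R * (8 * (a%:R * (K%:R / 2 ^+ q))) + 16 * (a%:R * q%:R) :> R by ring.
  have H1 := ler_wpM2l (ltW L0') Hq.
  have H2 : L%:R * (delta * mu) <= L%:R * (delta * s 0 r) by rewrite !ler_pM2l.
  have -> : L%:R * ((1 + delta) * s 0 r) = L%:R * s 0 r + L%:R * (delta * s 0 r) by ring.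
  have H3 : 0 <= L%:R * (delta * mu) by rewrite mulr_ge0// ltW.
  by move: HL pL; rewrite -/p => HL pL; lra.
have up := @count_le_coord_volume R n (M + p) L%:R _ _ n0 L0' ds0' us.
apply: (@tile_bound_algebra R _ L%:R (a%:R ^+ 2) (2 * K%:R) #|F|%:R p.+1%:R) => //.
- exact: coord_volume_ge0.
- by rewrite divr_ge0// ltW.
- exact: coord_volume_ge0.
- exact: ltW.
- exact: ltW.
- have flatR : #|admissible a M u|%:R <= a%:R ^+ 2 * M%:R ^+ (a ^ 2 - t ^ 2) * #|F|%:R :> R.
    by rewrite -!natrX -!natrM ler_nat -card_frame.
  apply: le_trans low _; apply: le_trans flatR _.
  have ME : M%:R = L%:R * K%:R :> R by rewrite /M natrM.
  rewrite ME ler_wpM2r// ler_wpM2l ?exprn_ge0//; apply: lerXn2r.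
  + by rewrite nnegrE mulr_ge0.
  + by rewrite nnegrE !mulr_ge0.
  + by rewrite ler_pM2l//; have := ltW K0; lra.
- apply: (@le_trans _ _ #|admissible n (M + p) (fun r => u' r + 2 * p%:R)|%:R).
    by rewrite -!natrX -natrM ler_nat -expnMn; exact: glued.
  apply: le_trans up _; rewrite ler_wpM2r ?coord_volume_ge0// ler_wpM2r ?exprn_ge0//.
  rewrite ler_pM2l// natrD natrM mulrCA [leRHS]mulr_natl mulr2n lerD2l.
  apply: le_trans pL _; rewrite mulrC ler_pM2l//; apply: (@le_trans _ _ C%:R);
    last by rewrite ler_nat.
  apply: le_trans muC; rewrite ler_pdivrMr//; have : delta * mu <= 1 * mu by rewrite ler_pM2r.
  by lra.
Qed.

(** * Entropy per vertex and its limit *)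

(** The normalization by n^2 in place of the dimension n^2 - 1 is asymptotically
    equivalent, and simpler. *)
Definition entropy (R : realType) (n : nat) (s : 'rV[R]_3) : R :=
  ln (coord_volume n s) / n%:R ^+ 2.

Lemma coord_volume_gt0 (R : realType) (n : nat) (s : 'rV[R]_3) :
  (0 < n)%N -> positive_octant s -> 0 < coord_volume n s.
Proof.
move=> n0 s0; have [mu mu0 smu] := exists_positive_lower_bound s0.
have := coord_volume_lower n0 mu0 smu.
have p0 : 0 < (mu / 4) ^+ (n ^ 2).-1 by rewrite exprn_gt0// divr_gt0.
by move=> /(lt_le_trans p0); rewrite pmulr_rgt0// exprn_gt0// ltr0n.
Qed.

Lemma entropyE (R : realType) (n : nat) (s : 'rV[R]_3) : (0 < n)%N ->
  n%:R ^+ 2 * entropy n s = ln (coord_volume n s).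
Proof. by move=> n0; rewrite /entropy mulrC divfK// expf_neq0// pnatr_eq0 -lt0n. Qed.

(** This disposes of all the polynomial factors. *)
Lemma ln_negligible (R : realType) (A B eta : R) : 0 < eta ->
  \forall n \near \oo%classic, (A + B * ln n%:R <= eta * n%:R :> R).
Proof.
move=> eta0; set eta' := eta / (2 * (`|B| + 1)).
have B0 : 0 < `|B| + 1 by rewrite ltr_wpDl.
have eta'0 : 0 < eta' by rewrite divr_gt0// mulr_gt0.
have [n0 Hn0] := exists_nat_ge (2 * (`|A| + `|B| * `|ln eta'|) / eta).
exists n0.+1 => // n /= n0n.
have n1 : 0 < n%:R :> R by rewrite ltr0n; lia.
have ln0 : 0 <= ln n%:R :> R by rewrite ln_ge0// ler1n; lia.
have H1 : ln n%:R <= eta' * n%:R + `|ln eta'|.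
  have e0 : eta' * n%:R \is Num.pos by rewrite posrE mulr_gt0.
  have := le_ln1Dx (x := eta' * n%:R - 1).
  rewrite addrCA subrr addr0 lnM ?posrE// => H.
  have := H _; have := ler_norm (- ln eta'); rewrite normrN.
  have : -1 < eta' * n%:R - 1 by have := e0; rewrite posrE; lra.
  by move=> h1 h2 h3; have := h3 h1; lra.
have H2 : B * ln n%:R <= `|B| * (eta' * n%:R + `|ln eta'|).
  apply: (@le_trans _ _ (`|B| * ln n%:R)); first by rewrite ler_wpM2r// ler_norm.
  by rewrite ler_wpM2l.
have H3 : `|B| * eta' <= eta / 2.
  rewrite /eta' mulrA ler_pdivrMr ?mulr_gt0//.
  by have := normr_ge0 B; lra.
have H4 : `|A| + `|B| * `|ln eta'| <= eta / 2 * n%:R.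
  have : 2 * (`|A| + `|B| * `|ln eta'|) / eta <= n%:R.
    by apply: le_trans Hn0 _; rewrite ler_nat ltnW.
  by rewrite ler_pdivrMr//; lra.
have H5 : `|B| * eta' * n%:R <= eta / 2 * n%:R by rewrite ler_pM2r.
have := ler_norm A; lra.
Qed.

Lemma exists_sum_bound (R : realType) (s t : 'rV[R]_3) :
  exists C : nat, 2 * \sum_r s 0 r <= C%:R /\ 2 * \sum_r t 0 r <= C%:R.
Proof.
have [C1 H1] := exists_nat_ge (2 * \sum_r s 0 r).
have [C2 H2] := exists_nat_ge (2 * \sum_r t 0 r).
exists (C1 + C2)%N; split.
  by apply: le_trans H1 _; rewrite ler_nat leq_addr.
by apply: le_trans H2 _; rewrite ler_nat leq_addl.
Qed.

Lemma ln_poly_const (R : realType) (n C : nat) : (0 < n)%N ->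
  ln (expR 1 * n%:R ^+ 2 * (n ^ 2 * (2 * C + 5))%:R) = 1 + 4 * ln n%:R + ln (2 * C + 5)%:R :> R.
Proof.
move=> n0; have n0' : 0 < n%:R :> R by rewrite ltr0n.
have C0 : 0 < (2 * C + 5)%:R :> R by rewrite ltr0n addnS.
have lq : ln (n%:R ^+ 2) = 2 * ln n%:R :> R by rewrite lnXn// mulr_natl.
have : 0 < n%:R ^+ 2 :> R by rewrite exprn_gt0.
rewrite natrM natrX; move: lq; set q := _ ^+ 2; move: q => q lq q0.
by rewrite !lnM ?posrE ?mulr_gt0 ?expR_gt0// expRK lq; ring.
Qed.

Lemma entropy_scale (R : realType) (s : 'rV[R]_3) (c eta : R) :
  positive_octant s -> 0 < c -> 0 < eta ->
  \forall n \near \oo%classic, entropy n s + ln c <= entropy n (c *: s) + eta.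
Proof.
move=> s0 c0 eta0; have [C [sC _]] := exists_sum_bound s s.
have cs0 : positive_octant (c *: s) by move=> r; rewrite mxE mulr_gt0.
have [n0 _ Hn0] := ln_negligible (1 + ln (2 * C + 5)%:R + ln c) 4 eta0.
exists (maxn n0 1) => // n /=; rewrite geq_max => /andP[n0n n1].
have n0' : 0 < n%:R :> R by rewrite ltr0n.
have n1' : 1 <= n%:R :> R by rewrite ler1n.
have N0 : (0 < n ^ 2)%N by rewrite expn_gt0 n1.
have nn0 : 0 < n%:R ^+ 2 :> R by rewrite exprn_gt0.
have := coord_volume_scale n1 s0 c0 sC.
have V0 := coord_volume_gt0 n1 s0; have W0 := coord_volume_gt0 n1 cs0.
have K0 : 0 < expR 1 * n%:R ^+ 2 * (n ^ 2 * (2 * C + 5))%:R :> R.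
  by rewrite !mulr_gt0 ?expR_gt0// ltr0n muln_gt0 N0 addnS.
have KW := mulr_gt0 K0 W0.
rewrite -ler_ln ?posrE ?KW ?mulr_gt0 ?exprn_gt0//.
rewrite lnM ?posrE ?exprn_gt0// lnM ?posrE// ln_poly_const// lnXn// -!entropyE//.
have -> : ln c *+ (n ^ 2).-1 = (n%:R ^+ 2 - 1) * ln c.
  by rewrite -[LHS]mulr_natl -subn1 natrB// natrX.
have H := Hn0 n n0n; rewrite /= in H.
have H2 : eta * n%:R <= eta * n%:R ^+ 2 by rewrite ler_pM2l// expr2 ler_peMl// ltW.
by move=> H3; rewrite -(ler_pM2l nn0); lra.
Qed.

Lemma entropy_midpoint (R : realType) (s t : 'rV[R]_3) (eta : R) :
  positive_octant s -> positive_octant t -> 0 < eta ->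
  \forall n \near \oo%classic, entropy n s + entropy n t
    <= 2 * entropy n (2^-1 *: (s + t)) + eta.
Proof.
move=> s0 t0 eta0; have [C [sC tC]] := exists_sum_bound s t.
have st0 : positive_octant (2^-1 *: (s + t)).
  by move=> r; rewrite !mxE mulr_gt0 ?invr_gt0 ?addr_gt0.
have [n0 _ Hn0] := ln_negligible (2 * (1 + ln (2 * C + 5)%:R)) 8 eta0.
exists (maxn n0 1) => // n /=; rewrite geq_max => /andP[n0n n1].
have n0' : 0 < n%:R :> R by rewrite ltr0n.
have n1' : 1 <= n%:R :> R by rewrite ler1n.
have N0 : (0 < n ^ 2)%N by rewrite expn_gt0 n1.
have nn0 : 0 < n%:R ^+ 2 :> R by rewrite exprn_gt0.
have := coord_volume_midpoint n1 s0 t0 sC tC.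
have V0 := coord_volume_gt0 n1 s0; have V'0 := coord_volume_gt0 n1 t0;
  have W0 := coord_volume_gt0 n1 st0.
have K0 : 0 < expR 1 * n%:R ^+ 2 * (n ^ 2 * (2 * C + 5))%:R :> R.
  by rewrite !mulr_gt0 ?expR_gt0// ltr0n muln_gt0 N0 addnS.
have KW := mulr_gt0 K0 W0.
rewrite -ler_ln ?posrE ?(exprn_gt0 _ KW) ?mulr_gt0//.
rewrite lnM ?posrE// lnXn// lnM ?posrE// ln_poly_const// -!entropyE// mulr2n.
have H := Hn0 n n0n; rewrite /= in H.
have H2 : eta * n%:R <= eta * n%:R ^+ 2 by rewrite ler_pM2l// expr2 ler_peMl// ltW.
by move=> H3; rewrite -(ler_pM2l nn0); lra.
Qed.

(** Without it the entropies could tend to minus infinity. *)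
Lemma entropy_lower (R : realType) (s : 'rV[R]_3) : positive_octant s ->
  exists c : R, \forall n \near \oo%classic, c <= entropy n s.
Proof.
move=> s0; have [mu mu0 smu] := exists_positive_lower_bound s0.
have m40 : 0 < mu / 4 by rewrite divr_gt0.
have lower n (n1 : (0 < n)%N) := coord_volume_lower n1 mu0 smu.
move: (mu / 4) m40 lower => y m40 lower.
exists (ln y - 1); have [n0 _ Hn0] := ln_negligible (ln y) 2 (ltr01 : 0 < 1 :> R).
exists (maxn n0 1) => // n /=; rewrite geq_max => /andP[n0n n1].
have n0' : 0 < n%:R :> R by rewrite ltr0n.
have n1' : 1 <= n%:R :> R by rewrite ler1n.
have N0 : (0 < n ^ 2)%N by rewrite expn_gt0 n1.
have nn0 : 0 < n%:R ^+ 2 :> R by rewrite exprn_gt0.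
have V0 := coord_volume_gt0 n1 s0; have := lower n n1.
rewrite -ler_ln ?posrE ?mulr_gt0 ?exprn_gt0// lnXn// lnM ?posrE// lnXn// -entropyE//.
have -> : ln y *+ (n ^ 2).-1 = (n%:R ^+ 2 - 1) * ln y.
  by rewrite -[LHS]mulr_natl -subn1 natrB// natrX.
have H := Hn0 n n0n; rewrite /= mul1r in H.
have H2 : n%:R <= n%:R ^+ 2 :> R by rewrite expr2 ler_peMl// ltW.
by rewrite -[_ *+ 2]mulr_natl => H3; rewrite -(ler_pM2l nn0); lra.
Qed.

Lemma entropy_upper (R : realType) (s : 'rV[R]_3) (r : 'I_3) (eta : R) :
  positive_octant s -> 0 < eta ->
  \forall n \near \oo%classic, entropy n s <= 1 + ln (s 0 r) + eta.
Proof.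
move=> s0 eta0; have [C [sC _]] := exists_sum_bound s s.
set x := 1 + ln (s 0 r).
have eta20 : 0 < eta / 2 by rewrite divr_gt0.
have [n0 _ Hn0] := ln_negligible (ln (2 * C + 5)%:R + 1 + `|x|) 2 eta20.
exists (maxn n0 1) => // n /=; rewrite geq_max => /andP[n0n n1].
case: n n0n n1 => // m n0n _.
have n0' : 0 < m.+1%:R :> R by rewrite ltr0n.
have nn0 : 0 < m.+1%:R ^+ 2 :> R by rewrite exprn_gt0.
have C0 : 0 < (2 * C + 5)%:R :> R by rewrite ltr0n addnS.
have K0 : 0 < (m.+1 ^ 2 * (2 * C + 5))%:R :> R by rewrite ltr0n muln_gt0 expn_gt0 addnS.
have := coord_volume_upper m r s0 sC.
have V0 := coord_volume_gt0 (isT : (0 < m.+1)%N) s0.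
rewrite -ler_ln ?posrE ?mulr_gt0 ?exprn_gt0 ?mulr_gt0 ?expR_gt0//.
rewrite lnM ?posrE ?exprn_gt0 ?mulr_gt0 ?expR_gt0// !lnXn ?mulr_gt0 ?expR_gt0//.
rewrite !lnM ?posrE ?expR_gt0// expRK -/x natrM lnM ?posrE ?natrX ?exprn_gt0// lnXn//
  -entropyE//.
have H := Hn0 m.+1 n0n; rewrite /= in H.
rewrite -[_ *+ (2 * m + 1)]mulr_natl -[_ *+ (m ^ 2)]mulr_natl natrX -[_ *+ 2]mulr_natl.
rewrite natrD natrM.
have m0 : 0 <= m%:R :> R by [].
have nE : m.+1%:R = m%:R + 1 :> R by rewrite -natr1.
have ln0 : 0 <= ln m.+1%:R :> R by rewrite ln_ge0// ler1n.
have lC0 : 0 <= ln (2 * C + 5)%:R :> R by rewrite ln_ge0// ler1n addnS.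
set q := 2 * ln m.+1%:R + ln (2 * C + 5)%:R + 1.
have q0 : 0 <= q by rewrite /q; lra.
have H2 : (2 * m%:R + 1) * q <= 2 * m.+1%:R * q by rewrite ler_wpM2r// nE; lra.
have H3 : m%:R ^+ 2 * x <= m.+1%:R ^+ 2 * x + 2 * m.+1%:R * `|x|.
  have := ler_norm (- x); rewrite normrN => hx.
  have : (2 * m%:R + 1) * - x <= (2 * m%:R + 1) * `|x| by rewrite ler_wpM2l// addr_ge0//
    mulr_ge0.
  have := normr_ge0 x; rewrite nE; lra.
have H4 : 2 * m.+1%:R * (q + `|x|) <= 2 * m.+1%:R * (eta / 2 * m.+1%:R).
  by rewrite ler_pM2l ?mulr_gt0// /q; lra.
by move=> H5; rewrite -(ler_pM2l nn0); lra.
Qed.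

(** The bookkeeping for entropy_tile, divided by x^2 = n^2. Here k2 a^2 is the
    part of the torus covered by tiles and (a - 3)^2 the live part of a tile;
    k2 a^2 differs from x^2 by at most 2 a x. *)
Lemma tile_entropy_algebra (R : realType) (a x k2 Th W l1 lna l2 lnx eta : R) :
  3 <= a -> a <= x -> 0 <= k2 -> k2 * a ^+ 2 <= x ^+ 2 -> x ^+ 2 - k2 * a ^+ 2 <= 2 * a * x ->
  0 <= l1 -> 0 <= l2 -> 0 <= lna -> 0 <= lnx ->
  6 * l1 + 2 * lna + 6 * l2 <= eta / 2 * a ->
  2 * a * (`|Th| + l1) + 2 * lnx + l2 <= eta / 2 * x ->
  k2 * (a ^+ 2 * Th) - (x ^+ 2 - k2 * (a - 3) ^+ 2) * l1 <=
    k2 * (2 * lna + (a ^+ 2 - (a - 3) ^+ 2) * l2) + (2 * lnx + l2) + x ^+ 2 * W ->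
  Th <= W + eta.
Proof.
move=> a3 ax k20 ka kax l10 l20 lna0 lnx0 Ha Hx main.
have x0 : 0 < x by lra.
have x20 : 0 < x ^+ 2 by rewrite exprn_gt0.
have a20 : 0 < a by lra.
have xx : x <= x ^+ 2 by rewrite expr2 ler_peMl// ?ltW//; lra.
set y := k2 * a ^+ 2 in ka kax.
have eta0 : 0 <= eta / 2.
  have : 0 <= eta / 2 * a by apply: le_trans Ha; lra.
  by rewrite pmulr_lge0.
have h1 : (x ^+ 2 - y) * Th <= 2 * a * x * `|Th|.
  apply: (@le_trans _ _ ((x ^+ 2 - y) * `|Th|)).
    by rewrite ler_wpM2l ?ler_norm// subr_ge0.
  by rewrite ler_wpM2r.
have Bb : k2 * (a ^+ 2 - (a - 3) ^+ 2) <= k2 * (6 * a) by rewrite ler_wpM2l//; lra.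
have h2 : (x ^+ 2 - k2 * (a - 3) ^+ 2) * l1 <= (2 * a * x + k2 * (6 * a)) * l1.
  rewrite ler_wpM2r//; rewrite /y in kax; lra.
have h3 : k2 * ((a ^+ 2 - (a - 3) ^+ 2) * l2) <= k2 * (6 * a) * l2.
  by rewrite mulrA ler_wpM2r.
have h4 : k2 * (2 * lna) <= k2 * (a * (2 * lna)) by rewrite ler_wpM2l// ler_peMl//; lra.
have h5 : k2 * a * (6 * l1 + 2 * lna + 6 * l2) <= k2 * a * (eta / 2 * a).
  by rewrite ler_wpM2l// mulr_ge0// ltW.
have h6 : k2 * a * (eta / 2 * a) <= x ^+ 2 * (eta / 2).
  rewrite (_ : k2 * a * (eta / 2 * a) = y * (eta / 2)); last by rewrite /y; ring.
  by rewrite ler_wpM2r.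
have h7 : x * (2 * a * (`|Th| + l1) + 2 * lnx + l2) <= x * (eta / 2 * x) by rewrite ler_pM2l.
have h8 : 2 * lnx + l2 <= x * (2 * lnx + l2) by rewrite ler_peMl//; lra.
rewrite -(ler_pM2l x20).
have main' : y * Th - (x ^+ 2 - k2 * (a - 3) ^+ 2) * l1 <=
    k2 * (2 * lna) + k2 * ((a ^+ 2 - (a - 3) ^+ 2) * l2) + (2 * lnx + l2) + x ^+ 2 * W.
  by rewrite /y; lra.
lra.
Qed.

(** The frames are a proportion O(1/a) of the torus and the incomplete tiles a
    proportion O(a/n): a is chosen first, then n. *)
Lemma entropy_tile (R : realType) (s : 'rV[R]_3) (delta eta : R) :
  positive_octant s -> 0 < delta -> delta <= 1 -> 0 < eta ->
  \forall a \near \oo%classic, \forall n \near \oo%classic,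
    entropy a s <= entropy n ((1 + delta) *: s) + eta.
Proof.
move=> s0 d0 d1 eta0; have [mu' mu'0 smu'] := exists_positive_lower_bound s0.
(* A lower bound of at most 1 makes ln eps nonpositive. *)
pose mu := Num.min mu' 1.
have mu0 : 0 < mu by rewrite lt_min mu'0 ltr01.
have mu1 : mu <= 1 by rewrite ge_min lexx orbT.
have smu r : mu <= s 0 r by apply: le_trans (smu' r); rewrite ge_min lexx.
have [C [sC _]] := exists_sum_bound s s.
have ds0 : positive_octant ((1 + delta) *: s) by move=> r; rewrite mxE mulr_gt0// addr_gt0.
set eps := delta * mu / 8.
have eps0 : 0 < eps by rewrite divr_gt0// mulr_gt0.
have eps1 : eps <= 1.
  rewrite ler_pdivrMr//; have : delta * mu <= 1 * 1 by rewrite ler_pM// ltW.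
  by lra.
set l1 := - ln eps; have l10 : 0 <= l1 by rewrite oppr_ge0 ln_le0.
have eta20 : 0 < eta / 2 by rewrite divr_gt0.
have C0 : 0 < (2 * C + 5)%:R :> R by rewrite ltr0n addnS.
have [a0 _ Ha0] := ln_negligible (6 * l1 + 6 * (ln 2 + ln (2 * C + 5)%:R)) 14 eta20.
exists (maxn a0 3) => // a /=; rewrite geq_max => /andP[a0a a3].
pose t := (a - 3)%N; have at3 : a = t.+3 by rewrite /t -addn3 subnK.
have a_gt0 : (0 < a)%N by exact: leq_trans a3.
set K := (a ^ 2 * (2 * C + 5))%N.
have a00 : 0 < a%:R :> R by rewrite ltr0n.
have K0 : 0 < 2 * K%:R :> R by rewrite mulr_gt0// natrM mulr_gt0// natrX exprn_gt0.
set l2 := ln (2 * K%:R : R).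
have l2E : l2 = ln 2 + 2 * ln a%:R + ln (2 * C + 5)%:R.
  have lq : ln (a%:R ^+ 2) = 2 * ln a%:R :> R by rewrite lnXn// mulr_natl.
  have : 0 < a%:R ^+ 2 :> R by rewrite exprn_gt0.
  rewrite /l2 /K natrM natrX; move: lq; set q := _ ^+ 2; move: q => q lq q0.
  by rewrite !lnM ?posrE ?mulr_gt0// lq; ring.
have [n0 _ Hn0] := ln_negligible (2 * a%:R * (`|entropy a s| + l1) + l2) 2 eta20.
exists (maxn n0 a) => // n /=; rewrite geq_max => /andP[n0n an].
have na0 : (0 < n %/ a)%N by rewrite divn_gt0.
set k := (n %/ a).-1; have kE : k.+1 = (n %/ a)%N by rewrite /k prednK.
have kn : (k.+1 * a <= n)%N by rewrite kE leq_divM.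
have n_gt0 : (0 < n)%N by exact: leq_trans an.
have nn0 : 0 < n%:R :> R by rewrite ltr0n.
have ka_n : (n < k.+1 * a + a)%N by rewrite kE -mulSnr; apply: ltn_ceil.
have tn : (k.+1 ^ 2 * t ^ 2 <= n ^ 2)%N.
  rewrite -expnMn leq_sqr; apply: leq_trans kn; rewrite leq_mul2l /t leq_subr orbT//.
have ta : (t ^ 2 <= a ^ 2)%N by rewrite leq_sqr /t leq_subr.
have := @coord_volume_tile R n k t C s delta mu.
rewrite /= -at3 -/K -/eps => /(_ kn s0 sC d0 d1 mu0 smu).
have Va := coord_volume_gt0 a_gt0 s0; have Wn := coord_volume_gt0 n_gt0 ds0.
have p1 : 0 < coord_volume a s ^+ (k.+1 ^ 2) by rewrite exprn_gt0.
have p2 : 0 < eps ^+ (n ^ 2 - k.+1 ^ 2 * t ^ 2) by rewrite exprn_gt0.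
have p3 : 0 < a%:R ^+ 2 :> R by rewrite exprn_gt0.
have p4 : 0 < (2 * K%:R) ^+ (a ^ 2 - t ^ 2) :> R by rewrite exprn_gt0.
have p5 : 0 < (a%:R ^+ 2 * (2 * K%:R) ^+ (a ^ 2 - t ^ 2)) ^+ (k.+1 ^ 2) :> R by rewrite
  exprn_gt0// mulr_gt0.
have p6 : 0 < n%:R ^+ 2 :> R by rewrite exprn_gt0.
have p7 := mulr_gt0 p6 K0; have p8 := mulr_gt0 p5 p7.
rewrite -ler_ln ?posrE ?(mulr_gt0 p1 p2) ?(mulr_gt0 p8 Wn)//.
rewrite (lnM (x := _ ^+ (k.+1 ^ 2))) ?posrE// [ln (eps ^+ _)]lnXn// [ln (coord_volume a s ^+
  _)]lnXn//.
rewrite (lnM (y := coord_volume n _)) ?posrE// (lnM (y := n%:R ^+ 2 * _)) ?posrE//.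
rewrite [ln (_ ^+ (k.+1 ^ 2))]lnXn ?mulr_gt0// (lnM (y := 2 * K%:R)) ?posrE// -/l2.
rewrite (lnM (y := _ ^+ (a ^ 2 - t ^ 2))) ?posrE// !lnXn// -/l2 -!entropyE//.
rewrite -[_ *+ (k.+1 ^ 2)]mulr_natl -[_ *+ (n ^ 2 - _)]mulr_natl -[_ *+ (a ^ 2 - t ^
  2)]mulr_natl.
rewrite -[_ *+ (k.+1 ^ 2)]mulr_natl -[ln a%:R *+ 2]mulr_natl -[ln n%:R *+ 2]mulr_natl (natrB _
  tn) (natrB _ ta) natrM !natrX.
have tE : t%:R = a%:R - 3 :> R by rewrite /t natrB.
rewrite tE (_ : ln eps = - l1); last by rewrite /l1 opprK.
have knR : k.+1%:R * a%:R <= n%:R :> R by rewrite -natrM ler_nat.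
have kanR : n%:R - a%:R <= k.+1%:R * a%:R :> R.
  by rewrite lerBlDr -natrM -natrD ler_nat ltnW.
have anR : a%:R <= n%:R :> R by rewrite ler_nat.
have HA := Ha0 a a0a; have HN := Hn0 n n0n; rewrite /= in HA HN.
move=> H; apply: (@tile_entropy_algebra R a%:R n%:R (k.+1%:R ^+ 2) _ _ l1 (ln a%:R) l2 (ln
  n%:R)) => //.
- by rewrite (ler_nat R 3).
- by rewrite -exprMn; apply: lerXn2r; rewrite ?nnegrE ?mulr_ge0.
- have : (n%:R - a%:R) ^+ 2 <= (k.+1%:R * a%:R) ^+ 2 :> R.
    by apply: lerXn2r; rewrite ?nnegrE ?subr_ge0 ?mulr_ge0.
  have : 0 <= a%:R ^+ 2 :> R by exact: ltW.
  by rewrite exprMn; lra.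
- rewrite /l2 ln_ge0//; have : (1 : R) <= K%:R by rewrite ler1n /K muln_gt0 expn_gt0 a_gt0
    addnS.
  by lra.
- by rewrite ln_ge0// ler1n.
- by rewrite ln_ge0// ler1n.
- by rewrite l2E; lra.
- by lra.
- by move: H; lra.
Qed.

(** The increase of s in entropy_tile is undone by scaling, at a cost of at most
    ln (1 + delta). *)
Lemma entropy_almost_nondecreasing (R : realType) (s : 'rV[R]_3) (eta : R) :
  positive_octant s -> 0 < eta ->
  \forall a \near \oo, \forall n \near \oo, entropy a s <= entropy n s + eta.
Proof.
move=> s0 eta0; have eta30 : 0 < eta / 3 by rewrite divr_gt0.
pose delta := Num.min 1 (eta / 3).
have d0 : 0 < delta by rewrite lt_min ltr01.
have d1 : delta <= 1 by rewrite ge_min lexx.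
have de : delta <= eta / 3 by rewrite ge_min lexx orbT.
have d10 : 0 < 1 + delta by rewrite addr_gt0.
have ds0 : positive_octant ((1 + delta) *: s) by move=> r; rewrite mxE mulr_gt0.
have cinv : 0 < (1 + delta)^-1 by rewrite invr_gt0.
have sc := entropy_scale ds0 cinv eta30.
have sE : (1 + delta)^-1 *: ((1 + delta) *: s) = s by rewrite scalerA mulVf ?scale1r// gt_eqF.
have lnd : ln (1 + delta)^-1 >= - delta.
  by rewrite lnV ?posrE// lerN2; apply: le_ln1Dx; lra.
apply: filterS (entropy_tile s0 d0 d1 eta30) => a ha.
apply: filterS2 ha sc => n H1; rewrite sE; lra.
Qed.

(** The upper limit of u, taken as the infimum of the eventual upper bounds, is
    the limit: u cannot come back from near the upper limit. *)
Lemma cvg_almost_nondecreasing (R : realType) (u : nat -> R) (lo up : R) :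
  (\forall n \near \oo, lo <= u n) -> (\forall n \near \oo, u n <= up) ->
  (forall eta, 0 < eta -> \forall a \near \oo, \forall n \near \oo, u a <= u n + eta) ->
  exists l : R, u n @[n --> \oo] --> l.
Proof.
move=> ulo uup inc; pose E : set R := fun x => \forall n \near \oo, u n <= x.
have E0 : E !=set0 by exists up.
have Elb : has_lbound E.
  exists lo => x Ex; have [n [Hn1 Hn2]] := filter_ex (filterI ulo Ex).
  exact: le_trans Hn1 Hn2.
exists (inf E); apply/cvgrPdist_le => eta eta0.
have eta20 : 0 < eta / 2 by rewrite divr_gt0.
have [x Ex xl] : exists2 x, E x & x < inf E + eta.
  by apply: inf_adherent.
have notE : ~ E (inf E - eta / 2).
  by move=> /(ge_inf Elb); lra.
(* u is infinitely often above inf E - eta/2, hence also at an index from which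
   on it cannot drop by more than eta/2. *)
have freq : exists a, inf E - eta / 2 < u a /\ \forall n \near \oo, u a <= u n + eta / 2.
  apply: contrapT => H; apply: notE; apply: filterS (inc _ eta20) => a Ha.
  by rewrite leNgt; apply/negP => ua; apply: H; exists a.
have [a [ua incr]] := freq.
apply: filterS2 incr Ex => n H1 H2; rewrite ler_norml; apply/andP; split; lra.
Qed.

Lemma limit_le (R : realType) (u v : nat -> R) (a b : R) :
  u n @[n --> \oo] --> a -> v n @[n --> \oo] --> b ->
  (forall eta, 0 < eta -> \forall n \near \oo, u n <= v n + eta) -> a <= b.
Proof.
move=> ua vb uv; apply/ler_addgt0Pr => e e0.
have e30 : 0 < e / 3 by rewrite divr_gt0.
move/cvgrPdist_le : ua => /(_ _ e30) ua; move/cvgrPdist_le : vb => /(_ _ e30) vb.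
have [n [[/ler_normlP[h1 h2] /ler_normlP[h3 h4]] h5]] := filter_ex (filterI (filterI ua vb)
  (uv _ e30)).
lra.
Qed.

Definition entropy_limit (R : realType) (s : 'rV[R]_3) : R := limn (fun n => entropy n s).

Lemma cvg_entropy (R : realType) (s : 'rV[R]_3) : positive_octant s ->
  entropy n s @[n --> \oo] --> entropy_limit s.
Proof.
move=> s0; have [lo Hlo] := entropy_lower s0.
have Hup := entropy_upper ord0 s0 ltr01.
have [l ul] := cvg_almost_nondecreasing Hlo Hup (fun eta => entropy_almost_nondecreasing s0).
by rewrite /entropy_limit (cvg_lim _ ul).
Qed.

Lemma entropy_limit_upper (R : realType) (s : 'rV[R]_3) r : positive_octant s ->
  entropy_limit s <= 1 + ln (s 0 r).
Proof.
move=> s0; apply: (limit_le (cvg_entropy s0) (cvg_cst _)) => eta eta0.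
exact: entropy_upper.
Qed.

(** One inequality for c gives the other one for 1/c. *)
Lemma entropy_limit_scale (R : realType) (s : 'rV[R]_3) c : positive_octant s -> 0 < c ->
  entropy_limit (c *: s) = entropy_limit s + ln c.
Proof.
have half (t : 'rV[R]_3) d : positive_octant t -> 0 < d ->
  entropy_limit t + ln d <= entropy_limit (d *: t).
  move=> t0 d0; have dt0 : positive_octant (d *: t) by move=> r; rewrite mxE mulr_gt0.
  apply: (limit_le (cvgD (cvg_entropy t0) (cvg_cst (ln d))) (cvg_entropy dt0)) => eta eta0.
  exact: entropy_scale.
move=> s0 c0; apply: le_anti; rewrite half// andbT.
have cs0 : positive_octant (c *: s) by move=> r; rewrite mxE mulr_gt0.
have ci0 : 0 < c^-1 by rewrite invr_gt0.
have := half _ _ cs0 ci0; rewrite scalerA mulVf ?gt_eqF// scale1r lnV ?posrE//; lra.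
Qed.

Lemma entropy_limit_midpoint (R : realType)
  (s t : 'rV[R]_3) : positive_octant s -> positive_octant t ->
  entropy_limit s + entropy_limit t <= 2 * entropy_limit (2^-1 *: (s + t)).
Proof.
move=> s0 t0; have st0 : positive_octant (2^-1 *: (s + t)).
  by move=> r; rewrite !mxE mulr_gt0 ?invr_gt0 ?addr_gt0.
have h1 : entropy n s + entropy n t @[n --> \oo] --> entropy_limit s + entropy_limit t.
  by apply: cvgD; exact: cvg_entropy.
have h2 : 2 * entropy n (2^-1 *: (s + t)) @[n --> \oo] --> 2 * entropy_limit (2^-1 *: (s + t)).
  by apply: cvgM; [exact: cvg_cst|exact: cvg_entropy].
apply: (limit_le h1 h2) => eta eta0.
exact: entropy_midpoint.
Qed.

Lemma coord_volume_mono (R : realType) (n : nat) (s t : 'rV[R]_3) : (0 < n)%N ->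
  positive_octant s -> (forall r, s 0 r <= t 0 r) -> coord_volume n s <= coord_volume n t.
Proof.
move=> n0 s0 st; rewrite -lee_fin -!coord_volume_finite//; last 2 first.
- by move=> r; apply: le_trans (st r); exact/ltW/s0.
- by move=> r; exact/ltW/s0.
have [m mE] := lebesgue_tuple_is_measure R #|torus n|.-1; rewrite mE.
apply: le_measure; rewrite ?inE; [exact: measurable_coord_polytope|exact:
  measurable_coord_polytope|].
by move=> x [x0 xs]; split => // v r; exact: le_trans (st r).
Qed.

Lemma entropy_limit_mono (R : realType) (s t : 'rV[R]_3) : positive_octant s ->
  (forall r, s 0 r <= t 0 r) -> entropy_limit s <= entropy_limit t.
Proof.
move=> s0 st; have t0 : positive_octant t by move=> r; exact: lt_le_trans (st r).
apply: (limit_le (cvg_entropy s0) (cvg_entropy t0)) => eta eta0.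
exists 1%N => // n /= n1; apply: (@le_trans _ _ (entropy n t)); last by rewrite lerDl ltW.
rewrite /entropy ler_pM2r ?invr_gt0 ?exprn_gt0 ?ltr0n//.
by rewrite ler_ln ?posrE ?coord_volume_gt0// coord_volume_mono.
Qed.

(** The square root of the Gram determinant n^2 is n. *)
Lemma mean0_volume (R : realType) (n : nat) (s : 'rV[R]_3) : (0 < n)%N -> positive_octant s ->
  fine (mean0_measure (hessian_polytope n s)) = n%:R * coord_volume n s.
Proof.
move=> n0 s0; rewrite /mean0_measure /span_measure det_gram_mean0; last first.
  by rewrite card_torus expn_gt0 n0.
rewrite (_ : Num.sqrt #|torus n|%:R = n%:R);
  last by rewrite card_torus natrX sqrtr_sqr ger0_norm.
by rewrite -/(coord_polytope n s) coord_volume_finite// => r; exact/ltW/s0.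
Qed.

(** Only the factor n and the exponent 1/(n^2 - 1) separate the volume root from
    the exponential of the entropy; both are negligible as the entropy is
    bounded. *)
Lemma cvg_volume_root (R : realType) (s : 'rV[R]_3) : positive_octant s ->
  volume_root n s @[n --> \oo] --> expR (entropy_limit s).
Proof.
move=> s0; have ents := cvg_entropy s0.
have key : (ln n%:R + n%:R ^+ 2 * entropy n s) / (n%:R ^+ 2 - 1) @[n --> \oo] -->
  entropy_limit s.
  apply/cvgrPdist_le => eta eta0; have eta20 : 0 < eta / 2 by rewrite divr_gt0.
  have bnd : \forall n \near \oo, `|entropy n s| <= `|entropy_limit s| + 1.
    move/cvgrPdist_le : (ents) => /(_ _ ltr01); apply: filterS => n H.
    rewrite -[entropy n s](subrK (entropy_limit s)) addrC; apply: le_trans (ler_normD _ _) _.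
    by rewrite lerD2l distrC.
  move/cvgrPdist_le : ents => /(_ _ eta20) ents.
  have small := ln_negligible (`|entropy_limit s| + 1) 1 eta20.
  have big : \forall n \near \oo, (2 <= n)%N by exists 2%N.
  apply: filterS3 (filterI bnd big) ents small => n [h1 n2] h2 h3.
  have n2R : 2 <= n%:R :> R by rewrite (ler_nat R 2).
  have q0 : 0 < n%:R ^+ 2 - 1 :> R by rewrite expr2; nra.
  have nq : n%:R <= n%:R ^+ 2 - 1 :> R by rewrite expr2; nra.
  have ln0 : 0 <= ln n%:R :> R by rewrite ln_ge0//; lra.
  set th := entropy n s in h1 h2 *.
  have -> : (ln n%:R + n%:R ^+ 2 * th) / (n%:R ^+ 2 - 1)
    = th + (ln n%:R + th) / (n%:R ^+ 2 - 1).
    by field; rewrite gt_eqF.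
  rewrite opprD addrA; apply: le_trans (ler_normB _ _) _;
    rewrite [leRHS](_ : _ = eta / 2 + eta / 2); last by field.
  apply: lerD => //; rewrite normrM normfV (gtr0_norm q0) ler_pdivrMr//.
  apply: le_trans (ler_normD _ _) _; rewrite (ger0_norm ln0).
  apply: (@le_trans _ _ (eta / 2 * n%:R)); last by rewrite ler_pM2l.
  by rewrite mul1r in h3; lra.
have := cvg_comp _ _ key (@continuous_expR R (entropy_limit s)).
apply: cvg_trans; apply: near_eq_cvg; exists 2%N => // n /= n2.
have n0 : (0 < n)%N by exact: leq_trans n2.
have n0R : 0 < n%:R :> R by rewrite ltr0n.
have V0 := coord_volume_gt0 n0 s0.
have nz : (n%:R * coord_volume n s == 0) = false by rewrite gt_eqF ?mulr_gt0.
rewrite /volume_root mean0_volume// /powR nz lnM ?posrE// entropyE//.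
by rewrite natrB ?expn_gt0 ?n0// natrX mulrC.
Qed.

(** * Concavity and Lipschitz continuity *)

Lemma positive_octant_scale (R : realType) (s : 'rV[R]_3) (c : R) :
  positive_octant s -> 0 < c -> positive_octant (c *: s).
Proof. by move=> s0 c0 r; rewrite mxE mulr_gt0. Qed.

Lemma positive_octant_convex (R : realType) (s t : 'rV[R]_3) (p : R) :
  positive_octant s -> positive_octant t -> 0 <= p <= 1 ->
    positive_octant (p *: s + (1 - p) *: t).
Proof.
move=> s0 t0 /andP[p0 p1] r; rewrite !mxE.
have [->|pn0] := eqVneq p 0; first by rewrite mul0r add0r subr0 mul1r.
have pp : 0 < p by rewrite lt_neqAle eq_sym pn0.
by rewrite ltr_wpDr ?mulr_gt0// mulr_ge0 ?subr_ge0// ltW.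
Qed.

(** The point of weight i / 2^(j+1) is the midpoint of s or t and a point with
    weight of denominator 2^j. *)
Lemma dyadic_quasiconcave (R : realType) (f : 'rV[R]_3 -> R) :
  (forall (s t : 'rV[R]_3), positive_octant s -> positive_octant t -> 1 <= f s -> 1 <= f t ->
    1 <= f (2^-1 *: (s + t))) ->
  forall (j i : nat) s t, (i <= 2 ^ j)%N -> positive_octant s -> positive_octant t ->
    1 <= f s -> 1 <= f t ->
    1 <= f ((i%:R / 2 ^+ j) *: s + (1 - i%:R / 2 ^+ j) *: t).
Proof.
move=> mid; elim=> [|j IH] i s t ij s0 t0 fs ft.
  move: ij; rewrite expr0 divr1 expn0; case: i => [|[|i]]// _.
    by rewrite scale0r add0r subr0 scale1r.
  by rewrite subrr scale0r addr0 scale1r.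
have p0 : 0 < 2 ^+ j :> R by rewrite exprn_gt0.
have oct k : (k <= 2 ^ j)%N -> positive_octant ((k%:R / 2 ^+ j) *: s + (1 - k%:R / 2 ^+ j) *:
  t).
  move=> kj; apply: positive_octant_convex => //; apply/andP; split;
    first by rewrite divr_ge0// ltW.
  by rewrite ler_pdivrMr// mul1r -natrX ler_nat.
have [ij'|ij'] := leqP i (2 ^ j).
  have := mid _ _ t0 (oct i ij') ft (IH i s t ij' s0 t0 fs ft); congr (1 <= f _).
  apply/rowP => r; rewrite !mxE exprS; field; rewrite gt_eqF//.
have i2 : (i - 2 ^ j <= 2 ^ j)%N by rewrite leq_subLR addnn -mul2n -expnS.
have iE : (i - 2 ^ j)%:R = i%:R - 2 ^+ j :> R by rewrite natrB ?natrX// ltnW.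
have := mid _ _ s0 (oct _ i2) fs (IH _ s t i2 s0 t0 fs ft); congr (1 <= f _).
apply/rowP => r; rewrite !mxE exprS iE; field; rewrite gt_eqF//.
Qed.

(** Monotonicity and homogeneity replace continuity in the passage from dyadic
    weights to real ones. *)
Lemma quasiconcave_of_midpoint (R : realType) (f : 'rV[R]_3 -> R) :
  (forall (s t : 'rV[R]_3), positive_octant s -> (forall r, s 0 r <= t 0 r) -> f s <= f t) ->
  (forall (s : 'rV[R]_3) c, positive_octant s -> 0 < c -> f (c *: s) = c * f s) ->
  (forall (s t : 'rV[R]_3), positive_octant s -> positive_octant t -> 1 <= f s -> 1 <= f t ->
    1 <= f (2^-1 *: (s + t))) ->
  forall s t p, positive_octant s -> positive_octant t -> 0 <= p <= 1 -> 1 <= f s -> 1 <= f t ->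
    1 <= f (p *: s + (1 - p) *: t).
Proof.
move=> mono homog mid s t p s0 t0 /andP[p0 p1] fs ft.
have [->|pn1] := eqVneq p 1; first by rewrite scale1r subrr scale0r addr0.
have pl1 : p < 1 by rewrite lt_neqAle pn1.
have pt0 : positive_octant (p *: s + (1 - p) *: t) by apply: positive_octant_convex;
  rewrite ?p0.
apply/ler_addgt0Pr => e e0.
set v := f _.
have [v1|v1] := leP 1 v; first by rewrite (le_trans v1)// lerDl ltW.
pose eta := Num.min (e / 2) 2^-1.
have eta0 : 0 < eta by rewrite lt_min divr_gt0//= invr_gt0.
have etae : eta <= e / 2 by rewrite ge_min lexx.
have eta1 : eta <= 2^-1 by rewrite ge_min lexx orbT.
have d0 : 0 < eta * (1 - p) by rewrite mulr_gt0// subr_gt0.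
have [j Hj] := exists_pow2_ge (eta * (1 - p))^-1.
have q0 : 0 < 2 ^+ j :> R by rewrite exprn_gt0.
have Hj' : (2 ^+ j)^-1 <= eta * (1 - p) by rewrite -[leRHS]invrK lef_pV2 ?posrE ?invr_gt0.
(* With weight i / 2^j slightly below p, the point of weight p dominates 1 - eta
   times the dyadic one. *)
pose i := Num.truncn (p * 2 ^+ j).
have /truncn_itv/andP[i1 i2] : 0 <= p * 2 ^+ j by rewrite mulr_ge0// ltW.
have ij : (i <= 2 ^ j)%N.
  by rewrite -(ler_nat R) natrX (le_trans i1)// ger_pMl.
have := @dyadic_quasiconcave R f mid j i s t ij s0 t0 fs ft.
set lam := i%:R / 2 ^+ j => flam.
have lam0 : 0 <= lam by rewrite divr_ge0// ltW.
have lamp : lam <= p by rewrite ler_pdivrMr.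
have plam : p <= lam + (2 ^+ j)^-1.
  by rewrite /lam -[X in _ + X]mul1r -mulrDl ler_pdivlMr// natr1 ltW.
have oct : positive_octant (lam *: s + (1 - lam) *: t).
  by apply: positive_octant_convex => //; rewrite lam0; lra.
have le1 : f ((1 - eta) *: (lam *: s + (1 - lam) *: t)) <= v.
  apply: mono; first by apply: positive_octant_scale => //; lra.
  move=> r; rewrite !mxE.
  have sr := ltW (s0 r); have tr := ltW (t0 r).
  have h1 : (1 - eta) * lam * s 0 r <= p * s 0 r.
    rewrite ler_wpM2r//; apply: le_trans lamp; rewrite ler_piMl//; lra.
  have h2 : (1 - eta) * (1 - lam) * t 0 r <= (1 - p) * t 0 r.
    rewrite ler_wpM2r//.
    apply: (@le_trans _ _ ((1 - eta) * (1 - p + eta * (1 - p)))).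
      by rewrite ler_wpM2l//; lra.
    have : 0 <= eta * eta * (1 - p) by rewrite !mulr_ge0 ?subr_ge0 ?ltW.
    by lra.
  by lra.
have h3 : 1 - eta <= v.
  apply: le_trans le1; rewrite homog//; last by lra.
  by rewrite ler_peMr//; lra.
by lra.
Qed.

(** The standard argument: normalize s and t to the level set {f = 1}. *)
Lemma concave_of_quasiconcave (R : realType) (f : 'rV[R]_3 -> R) :
  (forall s, positive_octant s -> 0 < f s) ->
  (forall (s : 'rV[R]_3) c, positive_octant s -> 0 < c -> f (c *: s) = c * f s) ->
  (forall (s t : 'rV[R]_3) p, positive_octant s -> positive_octant t -> 0 <= p <= 1 ->
    1 <= f s -> 1 <= f t ->
    1 <= f (p *: s + (1 - p) *: t)) ->
  forall s t p, positive_octant s -> positive_octant t -> 0 <= p <= 1 ->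
    p * f s + (1 - p) * f t <= f (p *: s + (1 - p) *: t).
Proof.
move=> pos homog qc s t p s0 t0 p01.
have /andP[p0 p1] := p01.
have a0 := pos _ s0; have b0 := pos _ t0.
set a := f s in a0 *; set b := f t in b0 *.
set w := p * a + (1 - p) * b.
have w0 : 0 < w.
  rewrite /w; have [->|pn0] := eqVneq p 0; first by rewrite mul0r add0r subr0 mul1r.
  have pp : 0 < p by rewrite lt_neqAle eq_sym pn0.
  by rewrite ltr_wpDr ?mulr_gt0// mulr_ge0 ?subr_ge0// ltW.
have ai : 0 < a^-1 by rewrite invr_gt0.
have bi : 0 < b^-1 by rewrite invr_gt0.
have sa := positive_octant_scale s0 ai; have tb := positive_octant_scale t0 bi.
(* The weight for which w times the mixture of s/a and t/b is the given one. *)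
pose lam := p * a / w.
have lamE : 1 - lam = (1 - p) * b / w by rewrite /lam /w; field; rewrite gt_eqF.
have lam01 : 0 <= lam <= 1.
  apply/andP; split; first by rewrite divr_ge0 ?mulr_ge0// ltW.
  by rewrite -subr_ge0 lamE divr_ge0 ?mulr_ge0 ?subr_ge0// ltW.
have := qc _ _ lam sa tb lam01.
rewrite !homog// !mulVf ?gt_eqF// lexx => /(_ isT isT) H.
have oct := positive_octant_convex sa tb lam01.
have -> : p *: s + (1 - p) *: t = w *: (lam *: (a^-1 *: s) + (1 - lam) *: (b^-1 *: t)).
  apply/rowP => r; rewrite !mxE lamE /lam; field; by rewrite !gt_eqF.
by rewrite homog// ler_peMr// ltW.
Qed.

Lemma entry_le_euclidean_norm (R : realType) (k : nat)
  (x : 'rV[R]_k) r : x 0 r <= euclidean_norm x.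
Proof.
apply: le_trans (ler_norm _) _; rewrite /euclidean_norm -sqrtr_sqr ler_wsqrtr//.
by rewrite (bigD1 r)//= lerDl sumr_ge0// => i _; exact: sqr_ge0.
Qed.

(** With mu the smallest ratio t_r / s_r, mu s <= t and f(t) >= mu f(s); the bound
    on f(s) by the very coordinate where the minimum is reached finishes the
    proof. *)
Lemma lipschitz_of_homogeneous (R : realType) (f : 'rV[R]_3 -> R) (K : R) :
  0 <= K -> (forall s, positive_octant s -> 0 <= f s) ->
  (forall (s t : 'rV[R]_3), positive_octant s -> (forall r, s 0 r <= t 0 r) -> f s <= f t) ->
  (forall (s : 'rV[R]_3) c, positive_octant s -> 0 < c -> f (c *: s) = c * f s) ->
  (forall (s : 'rV[R]_3) r, positive_octant s -> f s <= K * s 0 r) ->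
  forall s t, positive_octant s -> positive_octant t -> f s - f t <= K * euclidean_norm (s - t).
Proof.
move=> K0 pos mono homog bd s t s0 t0.
have [r _ rmin] := @Order.TotalTheory.arg_minP _ _ _ (ord0 : 'I_3) predT (fun r =>
  t 0 r / s 0 r) isT.
set mu := t 0 r / s 0 r in rmin.
have mu0 : 0 < mu by rewrite divr_gt0.
have le_t : f (mu *: s) <= f t.
  apply: mono; first exact: positive_octant_scale.
  by move=> r'; rewrite mxE -ler_pdivlMr//; exact: rmin.
rewrite homog// in le_t.
have N0 : 0 <= K * euclidean_norm (s - t) by rewrite mulr_ge0// sqrtr_ge0.
have [mu1|mu1] := leP 1 mu.
  apply: le_trans N0; rewrite subr_le0; apply: le_trans le_t.
  by rewrite ler_peMl// pos.
apply: (@le_trans _ _ ((1 - mu) * f s)); first by lra.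
apply: (@le_trans _ _ ((1 - mu) * (K * s 0 r))).
  by rewrite ler_wpM2l ?bd// subr_ge0 ltW.
have -> : (1 - mu) * (K * s 0 r) = K * (s - t) 0 r.
  by rewrite !mxE /mu; field; rewrite gt_eqF.
by rewrite ler_wpM2l// entry_le_euclidean_norm.
Qed.

Theorem corollary3p10 (R : realType) :
  exists f : 'rV[R]_3 -> R,
    [/\ forall s : 'rV[R]_3, positive_octant s ->
          volume_root n s @[n --> \oo] --> f s,
        forall s t : 'rV[R]_3, positive_octant s -> positive_octant t ->
          `|f s - f t| <= 2 * Num.sqrt 2 * expR 1 * euclidean_norm (s - t)
      & forall (s t : 'rV[R]_3) (p : R),
          positive_octant s -> positive_octant t -> 0 <= p <= 1 ->
          p * f s + (1 - p) * f t <= f (p *: s + (1 - p) *: t)].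
Proof.
have [f fE] : exists f : 'rV[R]_3 -> R, forall s, f s = expR (entropy_limit s).
  by exists (fun s => expR (entropy_limit s)).
exists f.
have fpos s : 0 < f s by rewrite fE expR_gt0.
have fmono (s t : 'rV[R]_3) : positive_octant s -> (forall r, s 0 r <= t 0 r) -> f s <= f t.
  by move=> s0 st; rewrite !fE ler_expR entropy_limit_mono.
have fhom (s : 'rV[R]_3) c : positive_octant s -> 0 < c -> f (c *: s) = c * f s.
  by move=> s0 c0; rewrite !fE entropy_limit_scale// expRD lnK ?posrE// mulrC.
have fbd (s : 'rV[R]_3) r : positive_octant s -> f s <= expR 1 * s 0 r.
  move=> s0; rewrite fE -[s 0 r]lnK ?posrE// -expRD ler_expR; exact: entropy_limit_upper.
have fmid (s t : 'rV[R]_3) : positive_octant s -> positive_octant t -> 1 <= f s -> 1 <= f t ->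
    1 <= f (2^-1 *: (s + t)).
  have ge1 (v : 'rV[R]_3) : (1 <= f v) = (0 <= entropy_limit v).
    by rewrite fE -[in RHS]ler_expR expR0.
  move=> s0 t0; rewrite !ge1 => fs ft.
  by have := entropy_limit_midpoint s0 t0; lra.
split.
- by move=> s s0; rewrite fE; exact: cvg_volume_root.
- move=> s t s0 t0.
  have lip := lipschitz_of_homogeneous (expR_ge0 1) (fun s _ => ltW (fpos s)) fmono fhom fbd.
  have normC : euclidean_norm (t - s) = euclidean_norm (s - t).
    by rewrite /euclidean_norm; congr Num.sqrt; apply: eq_bigr => r _;
      rewrite !mxE -sqrrN opprB.
  have weak : expR 1 * euclidean_norm (s - t)
    <= 2 * Num.sqrt 2 * expR 1 * euclidean_norm (s - t).
    rewrite ler_wpM2r ?sqrtr_ge0// ler_peMl ?expR_ge0//.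
    have : 1 <= Num.sqrt 2 :> R by rewrite -[X in X <= _]sqrtr1 ler_wsqrtr// ler1n.
    by lra.
  apply: le_trans weak; rewrite ler_norml lerNl opprB lip// andbT -normC.
  exact: lip.
- apply: concave_of_quasiconcave => // s t p s0 t0 p01.
  exact: quasiconcave_of_midpoint.
Qed.
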